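(* Let $\mathbf\Gamma=(\Gamma_1,\Gamma_2,\gamma)$ be a Belavin--Drinfeld triple of type $A_{n-1}$, $(\mathbf\Gamma,r_0)$ a Belavin--Drinfeld quadruple, $G\in\{\mathrm{SL}_n(\mathbb C),\mathrm{GL}_n(\mathbb C)\}$, and let $\psi$ be a frozen variable of $\mathcal{GC}^\dagger(\mathbf\Gamma,G)$ (in the $h$- or the $g$-convention). Then: 1) $\psi$ is semi-invariant with respect to the action of $\mathcal D$ on $\mathrm{GL}_n(\mathbb C)$ given by $(g',g).U=g'Ug^{-1}$; i.e. there is a character $\chi_\psi$ of $\mathcal D$ with $\psi(g'Ug^{-1})=\chi_\psi(g',g)\psi(U)$ (with $\psi$ viewed as a function on $\mathrm{GL}_n(\mathbb C)$ given by the same formula); 2) $\psi$ is log-canonical with every matrix entry $u_{ij}$: $\{\psi,u_{ij}\}^\dagger_{(\mathbf\Gamma,r_0)}=\omega\,\psi\,u_{ij}$ for some constant $\omega=\omega_{ij}\in\mathbb C$; 3) the zero locus of $\psi$ in $G$ foliates into a union of symplectic leaves of $(G,\pi^\dagger_{(\mathbf\Gamma,r_0)})$.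
   Context: **Notation.** $[a,b]$ is an interval of integers; $A_I^J$ is the submatrix of $A$ with rows $I$ and columns $J$. $\mathcal N_\pm$ are the groups of unipotent upper/lower triangular matrices. A generic $U$ is factored as $U=U_\oplus U_-=U_+U_\ominus$ with $U_\oplus$ upper triangular, $U_-\in\mathcal N_-$, $U_+\in\mathcal N_+$, $U_\ominus$ lower triangular. $E_{ab}$ are matrix units. **BD data.** $\Pi=[1,n-1]$. A BD triple is $\mathbf\Gamma=(\Gamma_1,\Gamma_2,\gamma)$, $\Gamma_1,\Gamma_2\subset\Pi$, $\gamma:\Gamma_1\to\Gamma_2$ a bijective isometry (preserving adjacency and non-adjacency in the Dynkin diagram), nilpotent: for every $\alpha\in\Gamma_1$ some $\gamma^m(\alpha)\notin\Gamma_1$. $\gamma^*:\Gamma_2\to\Gamma_1$ is the inverse. $\tilde\gamma^*:\mathcal N_-\to\mathcal N_-$ integrates the Lie algebra homomorphism with $E_{i+1,i}\mapsto E_{\gamma^*(i)+1,\gamma^*(i)}$ for $i\in\Gamma_2$ and $E_{ab}\mapsto0$ ($a>b$) unless $[b,a-1]\subset\Gamma_2$; $\tilde\gamma:\mathcal N_+\to\mathcal N_+$ integrates the one with $E_{i,i+1}\mapsto E_{\gamma(i),\gamma(i)+1}$ for $i\in\Gamma_1$ and $E_{ab}\mapsto 0$ ($a<b$) unless $[a,b-1]\subset\Gamma_1$. $\gamma$-string of $\alpha_0\in\Pi\setminus\Gamma_2$: $\alpha_0,\alpha_1=\gamma(\alpha_0),\dots,\alpha_m\notin\Gamma_1$;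 $\gamma^*$-string of $\alpha_0\in\Pi\setminus\Gamma_1$: the same with $\gamma^*$, ending at $\alpha_m\notin\Gamma_2$. **Frozen variables.** $\mathcal F_0(U)=U$, $\mathcal F_k(U)=\tilde\gamma^*([\mathcal F_{k-1}(U)]_-)U$, stabilizing to $\mathcal F(U)$; $\mathcal F^{\rm op}_0(U)=U$, $\mathcal F^{\rm op}_k(U)=U\tilde\gamma([\mathcal F^{\rm op}_{k-1}(U)]_+)$, stabilizing to $\mathcal F^{\rm op}(U)$. The frozen variables in the $h$-convention are: $c_1,\dots,c_{n-1}$, where $\det(I+\lambda U)=\sum_i\lambda^i(-1)^{i(n-1)}c_i(U)$; for each $\alpha_0\in\Pi\setminus\Gamma_2$ with $\gamma$-string $\alpha_0,\dots,\alpha_m$ the regular function $h_{\alpha_0+1,\alpha_0+1}(U)=\prod_{t=0}^m\det[\mathcal F(U)]_{[\alpha_t+1,n]}^{[\alpha_t+1,n]}$; and $h_{11}=\det U$ when $G=\mathrm{GL}_n$. In the $g$-convention they are $c_1,\dots,c_{n-1}$; for each $\alpha_0\in\Pi\setminus\Gamma_1$ with $\gamma^*$-string $\alpha_0,\dots,\alpha_m$, $g_{\alpha_0+1,\alpha_0+1}(U)=\prod_{t=0}^m\det[\mathcal F^{\rm op}(U)]_{[\alpha_t+1,n]}^{[\alpha_t+1,n]}$; and $g_{11}=\det U$ when $G=\mathrm{GL}_n$. **The group $\mathcal D$.** The $X$-runs are the maximal intervals $[a,b]\subset[1,n]$ such that $[a,b-1]\subset\Gamma_1$ (they partition $[1,n]$);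 $Y$-runs are defined likewise with $\Gamma_2$. A run is nontrivial if it has more than one element. $\gamma$ induces a bijection $\Delta\mapsto\bar\Delta$ of nontrivial $X$-runs to nontrivial $Y$-runs, and on each $\Delta$ it is either increasing ($\gamma|_{\Delta\cap\Gamma_1}>0$; also used when $|\Delta|=2$) or decreasing ($<0$). $\mathcal P_+(\Gamma_1)\subset\mathrm{GL}_n$ is the group of invertible matrices that are block upper triangular with respect to the partition into $X$-runs, $\mathcal P_-(\Gamma_2)$ the group of invertible matrices block lower triangular with respect to the partition into $Y$-runs. $\mathrm{GL}_n(\Gamma_1)$ (resp. $\mathrm{GL}_n(\Gamma_2)$) is the product of the groups $\mathrm{GL}(\Delta)$ over nontrivial $X$-runs (resp. $Y$-runs); $\mathring\Pi_{\Gamma_1}:\mathcal P_+(\Gamma_1)\to\mathrm{GL}_n(\Gamma_1)$ and $\mathring\Pi_{\Gamma_2}:\mathcal P_-(\Gamma_2)\to\mathrm{GL}_n(\Gamma_2)$ take the diagonal blocks over nontrivial runs. The isomorphism $\mathring{\tilde\gamma}:\mathrm{GL}_n(\Gamma_1)\to\mathrm{GL}_n(\Gamma_2)$ sends the block of $\Delta$ to the block of $\bar\Delta$ (both identified with $\mathrm{GL}_{|\Delta|}$ preserving the order of indices) by $A\mapsto A$ if $\gamma|_{\Delta\cap\Gamma_1}>0$, and by $A\mapsto w_0A^{-T}w_0^{-1}$, $w_0=\sum_{j=1}^{|\Delta|}(-1)^{j-1}E_{|\Delta|-j+1,j}$, if $\gamma|_{\Delta\cap\Gamma_1}<0$. Then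 $$\mathcal D=\{(g',g)\in\mathcal P_+(\Gamma_1)\times\mathcal P_-(\Gamma_2)\mid\mathring{\tilde\gamma}(\mathring\Pi_{\Gamma_1}(g'))=\mathring\Pi_{\Gamma_2}(g)\}.$$ **Poisson structure.** Let $\mathfrak g$ be the Lie algebra of $G$ with trace form, $\mathfrak h$ its diagonal matrices, $\pi_>,\pi_<,\pi_0$ projections to strictly upper, strictly lower, diagonal part. $\mathfrak g_{\Gamma_i}$ is the subalgebra generated by $E_{a,a+1},E_{a+1,a}$, $a\in\Gamma_i$; $\gamma:\mathfrak g_{\Gamma_1}\to\mathfrak g_{\Gamma_2}$ is the isomorphism $E_{a,a+1}\mapsto E_{\gamma(a),\gamma(a)+1}$, $E_{a+1,a}\mapsto E_{\gamma(a)+1,\gamma(a)}$, extended by zero on $\mathfrak g_{\Gamma_1}^\perp$; $\gamma^*$ is its adjoint. $(\mathbf\Gamma,r_0)$ is a BD quadruple if $r_0=[1\otimes R_0]\Omega_0\in\mathfrak h\otimes\mathfrak h$ ($\Omega_0$ dual to the form on $\mathfrak h$) with $R_0+R_0^*=\mathrm{id}$ and $R_0(h_\alpha-\gamma(h_\alpha))=h_\alpha$, $h_\alpha=E_{\alpha\alpha}-E_{\alpha+1,\alpha+1}$, $\alpha\in\Gamma_1$. With $R_+=\frac1{1-\gamma}\pi_>-\frac{\gamma^*}{1-\gamma^*}\pi_<+R_0\pi_0$ and $\langle\nabla^Lf|_U,x\rangle=\frac d{dt}|_0f(U e^{tx})$, $\langle\nabla^Rf|_U,x\rangle=\frac d{dt}|_0f(e^{tx}U)$,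 the bracket of $\pi^\dagger_{(\mathbf\Gamma,r_0)}$ is $$\{f_1,f_2\}^\dagger=\langle R_+(\nabla^Lf_1-\nabla^Rf_1),\nabla^Lf_2-\nabla^Rf_2\rangle-\langle\nabla^Lf_1-\nabla^Rf_1,\nabla^Lf_2\rangle.$$
   Formalization: Part 1) is stated only for the frozen variables h, g and det U, not for c_1,…,c_{n-1}, for which it is false (n=2, Γ empty: c_1=-tr is not semi-invariant under (diag(2,1), I)); parts 2) and 3) cover all frozen variables. *)

(* Defs.v *)
From HB Require Import structures.
From mathcomp Require Import all_boot all_order all_algebra.
From mathcomp Require Import all_classical all_reals all_analysis.
From mathcomp Require Import complex.
From Stdlib Require Import Relation_Operators.

Set Implicit Arguments.
Unset Strict Implicit.
Unset Printing Implicit Defensive.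

Import Order.TTheory GRing.Theory Num.Theory.
Import numFieldNormedType.Exports.

Local Open Scope classical_set_scope.
Local Open Scope ring_scope.
Local Open Scope complex_scope.

(** The complex numbers are [R[i]] for a [realType] [R]; [R[i]^o] is the same
    type seen as a normed space over itself, for limits and derivatives.

    Simple roots and matrix indices are natural numbers counted from 1: the
    simple roots are [1, n-1], and row (column) number [a] of an [n x n] matrix
    is the ordinal of value [a - 1]. *)

Definition Eij (R : realType) (n : nat) (a b : nat) : 'M[R[i]]_n :=
  \matrix_(i, j) ((i.+1 == a) && (j.+1 == b))%:R.

(** Only used for indices in [1, n]; other indices give 0. *)
Definition entry (R : realType) (n : nat) (A : 'M[R[i]]_n) (a b : nat) : R[i] :=
  match insub a.-1 : option 'I_n, insub b.-1 : option 'I_n with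
  | Some i, Some j => A i j
  | _, _ => 0
  end.

(** The submatrix with rows and columns [a, a + m - 1]. *)
Definition block (R : realType) (n m a : nat) (A : 'M[R[i]]_n) : 'M[R[i]]_m :=
  \matrix_(p, q) entry A (a + p) (a + q).

(** [\det A] restricted to rows and columns [a + 1, n]. *)
Definition trailing_minor (R : realType) (n a : nat) (A : 'M[R[i]]_n) : R[i] :=
  \det (block (n - a) a.+1 A).

Definition lie (R : realType) (n : nat) (x y : 'M[R[i]]_n) : 'M[R[i]]_n :=
  x *m y - y *m x.

(** * Belavin--Drinfeld triples *)

Definition adjacent (a b : nat) : bool := (a.+1 == b) || (b.+1 == a).

(** [gam] and [gams] only matter on [Gam1] and [Gam2] respectively. *)
Record BDtriple (n : nat) := mkBDtriple {
  Gam1 : pred nat;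
  Gam2 : pred nat;
  gam : nat -> nat;
  gams : nat -> nat;
  Gam1_sub : forall a, Gam1 a -> (0 < a < n)%N;
  Gam2_sub : forall a, Gam2 a -> (0 < a < n)%N;
  gam_in : forall a, Gam1 a -> Gam2 (gam a);
  gams_in : forall a, Gam2 a -> Gam1 (gams a);
  gamK : forall a, Gam1 a -> gams (gam a) = a;
  gamsK : forall a, Gam2 a -> gam (gams a) = a;
  gam_isometry : forall a b, Gam1 a -> Gam1 b ->
    adjacent (gam a) (gam b) = adjacent a b;
  gam_nilpotent : forall a, Gam1 a -> exists m, ~~ Gam1 (iter m gam a)
}.

(** [a0 :: s] is the [f]-string of [a0]: it is continued as long as its last
    element lies in the domain [S] of [f]. *)
Definition is_string (S : pred nat) (f : nat -> nat) (a0 : nat) (s : seq nat) :=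
  path (fun a b => S a && (b == f a)) a0 s && ~~ S (last a0 s).

(** * The Lie algebra maps induced by gamma *)

(** Image of [E_{a,a+k+1} = [E_{a,a+1}, E_{a+1,a+k+1}]] under the homomorphism
    [E_{i,i+1} |-> E_{f(i),f(i)+1}]. *)
Fixpoint upper_image (R : realType) (n : nat) (f : nat -> nat) (a k : nat) :
    'M[R[i]]_n :=
  match k with
  | 0 => Eij R n (f a) (f a).+1
  | k'.+1 => lie (Eij R n (f a) (f a).+1) (upper_image R n f a.+1 k')
  end.

(** Image of [E_{a+k+1,a} = [E_{a+k+1,a+1}, E_{a+1,a}]] under the homomorphism
    [E_{i+1,i} |-> E_{f(i)+1,f(i)}]. *)
Fixpoint lower_image (R : realType) (n : nat) (f : nat -> nat) (a k : nat) :
    'M[R[i]]_n :=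
  match k with
  | 0 => Eij R n (f a).+1 (f a)
  | k'.+1 => lie (lower_image R n f a.+1 k') (Eij R n (f a).+1 (f a))
  end.

(** gamma on strictly upper triangular matrices. The entry of [X] at the
    ordinals [(i, j)] is the coefficient of [E_{i+1,j+1}], and
    [index_iota i.+1 j.+1] lists [i+1, ..., j]. *)
Definition gamma_up (R : realType) (n : nat) (T : BDtriple n)
    (X : 'M[R[i]]_n) : 'M[R[i]]_n :=
  \sum_(i < n) \sum_(j < n | (i < j)%N && all (Gam1 T) (index_iota i.+1 j.+1))
    X i j *: upper_image R n (gam T) i.+1 (j - i).-1.

(** gamma^* on strictly lower triangular matrices, given on generators. *)
Definition gammas_low (R : realType) (n : nat) (T : BDtriple n)
    (X : 'M[R[i]]_n) : 'M[R[i]]_n :=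
  \sum_(i < n) \sum_(j < n | (j < i)%N && all (Gam2 T) (index_iota j.+1 i.+1))
    X i j *: lower_image R n (gams T) j.+1 (i - j).-1.

(** gamma^* on strictly lower triangular matrices, as the adjoint of gamma for
    the trace form: [tr (gamma_adj Y * X) = tr (Y * gamma X)] for [X] strictly
    upper triangular. Since gamma preserves the triangular decomposition, the
    diagonal and lower parts of gamma do not contribute. *)
Definition gamma_adj (R : realType) (n : nat) (T : BDtriple n)
    (Y : 'M[R[i]]_n) : 'M[R[i]]_n :=
  \matrix_(i, j) if (j < i)%N then \tr (Y *m gamma_up T (delta_mx j i)) else 0.

(** * Integration to the unipotent groups *)

(** Exponential of a nilpotent matrix and logarithm of a unipotent one; the
    remaining terms of the series vanish. *)
Definition nilexp (R : realType) (n : nat) (X : 'M[R[i]]_n) : 'M[R[i]]_n :=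
  \sum_(k < n) (k`!%:R)^-1 *: X ^+ k.

Definition uniplog (R : realType) (n : nat) (V : 'M[R[i]]_n) : 'M[R[i]]_n :=
  \sum_(1 <= k < n) ((-1) ^+ k.-1 / k%:R) *: (V - 1%:M) ^+ k.

Definition tgamma (R : realType) (n : nat) (T : BDtriple n)
    (V : 'M[R[i]]_n) : 'M[R[i]]_n :=
  nilexp (gamma_up T (uniplog V)).

Definition tgammas (R : realType) (n : nat) (T : BDtriple n)
    (V : 'M[R[i]]_n) : 'M[R[i]]_n :=
  nilexp (gammas_low T (uniplog V)).

(** * The maps F and F^op *)

Definition upper_tri (R : realType) (n : nat) (A : 'M[R[i]]_n) : Prop :=
  forall i j : 'I_n, (j < i)%N -> A i j = 0.

Definition lower_tri (R : realType) (n : nat) (A : 'M[R[i]]_n) : Prop :=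
  forall i j : 'I_n, (i < j)%N -> A i j = 0.

Definition unip_upper (R : realType) (n : nat) (A : 'M[R[i]]_n) : Prop :=
  upper_tri A /\ forall i, A i i = 1.

Definition unip_lower (R : realType) (n : nat) (A : 'M[R[i]]_n) : Prop :=
  lower_tri A /\ forall i, A i i = 1.

(** [F_iter T U k V]: the k-th iterate is defined at [U] and equals [V]. For
    invertible [U] the factorizations are unique when they exist. *)
Inductive F_iter (R : realType) (n : nat) (T : BDtriple n) (U : 'M[R[i]]_n) :
    nat -> 'M[R[i]]_n -> Prop :=
| F_iter0 : F_iter T U 0 U
| F_iterS k B L : F_iter T U k (B *m L) -> upper_tri B -> unip_lower L ->
    F_iter T U k.+1 (tgammas T L *m U).

Inductive Fop_iter (R : realType) (n : nat) (T : BDtriple n)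
    (U : 'M[R[i]]_n) : nat -> 'M[R[i]]_n -> Prop :=
| Fop_iter0 : Fop_iter T U 0 U
| Fop_iterS k N B : Fop_iter T U k (N *m B) -> unip_upper N -> lower_tri B ->
    Fop_iter T U k.+1 (U *m tgamma T N).

Definition F_value (R : realType) (n : nat) (T : BDtriple n)
    (U V : 'M[R[i]]_n) : Prop :=
  exists K, forall k, (K <= k)%N -> F_iter T U k V.

Definition Fop_value (R : realType) (n : nat) (T : BDtriple n)
    (U V : 'M[R[i]]_n) : Prop :=
  exists K, forall k, (K <= k)%N -> Fop_iter T U k V.

(** * Regular functions *)

(** The algebra of functions generated by the set [gens]. *)
Inductive generated (R : realType) (X : Type) (gens : set (X -> R[i])) :
    (X -> R[i]) -> Prop :=
| generated_gen f : gens f -> generated gens f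
| generated_const c : generated gens (fun _ => c)
| generated_add f g : generated gens f -> generated gens g ->
    generated gens (fun x => f x + g x)
| generated_mul f g : generated gens f -> generated gens g ->
    generated gens (fun x => f x * g x).

Definition GL_coord (R : realType) (n : nat) : set ('M[R[i]]_n -> R[i]) :=
  [set f : 'M[R[i]]_n -> R[i] |
    (exists i j, f = (fun U => U i j)) \/ f = (fun U => (\det U)^-1)].

Definition GL2_coord (R : realType) (n : nat) :
    set ('M[R[i]]_n * 'M[R[i]]_n -> R[i]) :=
  [set f : 'M[R[i]]_n * 'M[R[i]]_n -> R[i] |
    exists2 g, @GL_coord R n g & f = g \o fst \/ f = g \o snd].

(** Elements of the coordinate ring of [GL_n]; values outside [GL_n] are
    irrelevant. Restrictions to [SL_n] give its whole coordinate ring. *)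
Definition regular (R : realType) (n : nat) (f : 'M[R[i]]_n -> R[i]) : Prop :=
  exists2 g, generated (@GL_coord R n) g &
    forall U, U \in unitmx -> f U = g U.

(** * Frozen variables *)

Variant gtype := SL | GL.

Variant convention := h_convention | g_convention.

Definition charcoef (R : realType) (n : nat) (i : nat) (U : 'M[R[i]]_n) : R[i] :=
  (-1) ^+ (i * n.-1) *
  (\det (1%:M + 'X *: map_mx (@polyC R[i]) U : 'M[{poly R[i]}]_n))`_i.

Definition casimir_frozen (R : realType) (n : nat)
    (psi : 'M[R[i]]_n -> R[i]) : Prop :=
  exists2 i, (0 < i < n)%N & psi = @charcoef R n i.

(** [h_{a0+1,a0+1}] and [g_{a0+1,a0+1}] are the regular functions on [GL_n]
    given by the product formula wherever [F] ([F^op]) is defined, which is a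
    Zariski dense open set. *)
Variant minor_frozen (R : realType) (n : nat) (cv : convention) (G : gtype)
    (T : BDtriple n) : ('M[R[i]]_n -> R[i]) -> Prop :=
| frozen_h a0 s psi : cv = h_convention ->
    (0 < a0 < n)%N -> ~~ Gam2 T a0 -> is_string (Gam1 T) (gam T) a0 s ->
    regular psi ->
    (forall U V, U \in unitmx -> F_value T U V ->
       psi U = \prod_(a <- a0 :: s) trailing_minor a V) ->
    minor_frozen cv G T psi
| frozen_g a0 s psi : cv = g_convention ->
    (0 < a0 < n)%N -> ~~ Gam1 T a0 -> is_string (Gam2 T) (gams T) a0 s ->
    regular psi ->
    (forall U V, U \in unitmx -> Fop_value T U V ->
       psi U = \prod_(a <- a0 :: s) trailing_minor a V) ->
    minor_frozen cv G T psi
| frozen_det : G = GL -> minor_frozen cv G T (fun U => \det U).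

Definition frozen (R : realType) (n : nat) (cv : convention) (G : gtype)
    (T : BDtriple n) (psi : 'M[R[i]]_n -> R[i]) : Prop :=
  casimir_frozen psi \/ minor_frozen cv G T psi.

(** * The group D *)

(** [[a, b]] is a maximal interval of [1, n] with [[a, b-1]] inside [S]. *)
Definition is_run (n : nat) (S : pred nat) (a b : nat) : Prop :=
  [/\ (0 < a)%N, (a <= b)%N, (b <= n)%N, all S (index_iota a b) &
      forall a' b', (0 < a')%N -> (a' <= a)%N -> (b <= b')%N -> (b' <= n)%N ->
        all S (index_iota a' b') -> a' = a /\ b' = b].

Definition block_upper (R : realType) (n : nat) (S : pred nat)
    (A : 'M[R[i]]_n) : Prop :=
  forall a b a' b', is_run n S a b -> is_run n S a' b' -> (b' < a)%N ->
    forall i j : 'I_n, (a <= i.+1 <= b)%N -> (a' <= j.+1 <= b')%N -> A i j = 0.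

Definition block_lower (R : realType) (n : nat) (S : pred nat)
    (A : 'M[R[i]]_n) : Prop :=
  forall a b a' b', is_run n S a b -> is_run n S a' b' -> (b < a')%N ->
    forall i j : 'I_n, (a <= i.+1 <= b)%N -> (a' <= j.+1 <= b')%N -> A i j = 0.

(** The nontrivial Y-run [[a', b']] corresponds to the nontrivial X-run
    [[a, b]] under gamma. *)
Definition run_image (n : nat) (T : BDtriple n) (a b a' b' : nat) : Prop :=
  [/\ is_run n (Gam1 T) a b, (a < b)%N, is_run n (Gam2 T) a' b', (a' < b')%N &
      forall k, (a <= k < b)%N -> (a' <= gam T k < b')%N].

Definition increasing_run (n : nat) (T : BDtriple n) (a b : nat) : Prop :=
  forall k l, (a <= k)%N -> (k < l)%N -> (l < b)%N -> (gam T k < gam T l)%N.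

(** An X-run with two elements counts as increasing. *)
Definition decreasing_run (n : nat) (T : BDtriple n) (a b : nat) : Prop :=
  (a.+1 < b)%N /\
  forall k l, (a <= k)%N -> (k < l)%N -> (l < b)%N -> (gam T l < gam T k)%N.

Definition w0 (R : realType) (m : nat) : 'M[R[i]]_m :=
  \sum_(1 <= j < m.+1) (-1) ^+ j.-1 *: Eij R m (m - j).+1 j.

Definition inD (R : realType) (n : nat) (T : BDtriple n) :
    set ('M[R[i]]_n * 'M[R[i]]_n) :=
  [set p | [/\ p.1 \in unitmx, p.2 \in unitmx,
    block_upper (Gam1 T) p.1, block_lower (Gam2 T) p.2 &
    forall a b a' b', run_image T a b a' b' ->
      let m := (b - a).+1 in
      let A := block m a p.1 in
      (increasing_run T a b -> block m a' p.2 = A) /\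
      (decreasing_run T a b ->
         block m a' p.2 = w0 R m *m (invmx A)^T *m invmx (w0 R m))]].

(** Characters of the algebraic group D. *)
Definition is_character (R : realType) (n : nat) (T : BDtriple n)
    (chi : 'M[R[i]]_n * 'M[R[i]]_n -> R[i]) : Prop :=
  [/\ exists2 f, generated (@GL2_coord R n) f &
        forall p, inD T p -> chi p = f p,
      forall p, inD T p -> chi p != 0 &
      forall p q, inD T p -> inD T q ->
        chi (p.1 *m q.1, p.2 *m q.2) = chi p * chi q].

Definition semi_invariant (R : realType) (n : nat) (T : BDtriple n)
    (psi : 'M[R[i]]_n -> R[i]) : Prop :=
  exists2 chi, is_character T chi &
    forall p U, inD T p -> U \in unitmx ->
      psi (p.1 *m U *m invmx p.2) = chi p * psi U.

(** * The Poisson bracket *)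

Definition inG (R : realType) (n : nat) (G : gtype) : set 'M[R[i]]_n :=
  [set U | match G with SL => \det U = 1 | GL => U \in unitmx end].

Definition inLie (R : realType) (n : nat) (G : gtype) : set 'M[R[i]]_n :=
  [set x | match G with SL => \tr x = 0 | GL => True end].

Definition cartan (R : realType) (n : nat) (G : gtype) : set 'M[R[i]]_n :=
  [set x | is_diag_mx x /\ inLie G x].

Definition coroot (R : realType) (n : nat) (a : nat) : 'M[R[i]]_n :=
  Eij R n a a - Eij R n a.+1 a.+1.

(** The element [r_0] is given by the linear operator [R_0] on the Cartan
    subalgebra; the values of [R0] off the Cartan subalgebra are irrelevant. *)
Definition BD_quadruple (R : realType) (n : nat) (G : gtype) (T : BDtriple n)
    (R0 : {linear 'M[R[i]]_n -> 'M[R[i]]_n}) : Prop :=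
  [/\ forall x, cartan G x -> cartan G (R0 x),
      forall x y, cartan G x -> cartan G y ->
        \tr (R0 x *m y) + \tr (x *m R0 y) = \tr (x *m y) &
      forall a, Gam1 T a ->
        R0 (coroot R n a - coroot R n (gam T a)) = coroot R n a].

Definition upper_part (R : realType) (n : nat) (x : 'M[R[i]]_n) : 'M[R[i]]_n :=
  \matrix_(i, j) if (i < j)%N then x i j else 0.

Definition lower_part (R : realType) (n : nat) (x : 'M[R[i]]_n) : 'M[R[i]]_n :=
  \matrix_(i, j) if (j < i)%N then x i j else 0.

Definition diag_part (R : realType) (n : nat) (x : 'M[R[i]]_n) : 'M[R[i]]_n :=
  \matrix_(i, j) if i == j then x i j else 0.

(** The operators [1 / (1 - gamma)] and [gamma^* / (1 - gamma^* )] are finite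
    geometric series, since gamma and its adjoint are nilpotent on strictly
    upper, resp. lower, triangular matrices, with vanishing [n]-th power. *)
Definition Rplus (R : realType) (n : nat) (T : BDtriple n)
    (R0 : {linear 'M[R[i]]_n -> 'M[R[i]]_n}) (x : 'M[R[i]]_n) : 'M[R[i]]_n :=
  \sum_(0 <= k < n) iter k (gamma_up T) (upper_part x)
  - \sum_(1 <= k < n) iter k (gamma_adj T) (lower_part x)
  + R0 (diag_part x).

Definition expmx (R : realType) (n : nat) (X : 'M[R[i]]_n) : 'M[R[i]]_n :=
  \matrix_(i, j)
    limn (fun N => (\sum_(k < N) (k`!%:R)^-1 *: X ^+ k) i j : R[i]^o).

Definition is_gradL (R : realType) (n : nat) (G : gtype)
    (f : 'M[R[i]]_n -> R[i]) (U X : 'M[R[i]]_n) : Prop :=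
  inLie G X /\ forall x, inLie G x ->
    is_derive (0 : R[i]^o) (1 : R[i]^o)
      (fun t : R[i]^o => f (U *m expmx (t *: x)) : R[i]^o) (\tr (X *m x)).

Definition is_gradR (R : realType) (n : nat) (G : gtype)
    (f : 'M[R[i]]_n -> R[i]) (U X : 'M[R[i]]_n) : Prop :=
  inLie G X /\ forall x, inLie G x ->
    is_derive (0 : R[i]^o) (1 : R[i]^o)
      (fun t : R[i]^o => f (expmx (t *: x) *m U) : R[i]^o) (\tr (X *m x)).

(** The gradients are unique by nondegeneracy of the trace form on the Lie
    algebra, and exist for regular functions. *)
Definition gradL (R : realType) (n : nat) (G : gtype)
    (f : 'M[R[i]]_n -> R[i]) (U : 'M[R[i]]_n) : 'M[R[i]]_n :=
  xget 0 [set X | is_gradL G f U X].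

Definition gradR (R : realType) (n : nat) (G : gtype)
    (f : 'M[R[i]]_n -> R[i]) (U : 'M[R[i]]_n) : 'M[R[i]]_n :=
  xget 0 [set X | is_gradR G f U X].

Definition pbracket (R : realType) (n : nat) (G : gtype) (T : BDtriple n)
    (R0 : {linear 'M[R[i]]_n -> 'M[R[i]]_n})
    (f1 f2 : 'M[R[i]]_n -> R[i]) (U : 'M[R[i]]_n) : R[i] :=
  let d1 := gradL G f1 U - gradR G f1 U in
  let d2 := gradL G f2 U - gradR G f2 U in
  \tr (Rplus T R0 d1 *m d2) - \tr (d1 *m gradL G f2 U).

Definition log_canonical (R : realType) (n : nat) (G : gtype) (T : BDtriple n)
    (R0 : {linear 'M[R[i]]_n -> 'M[R[i]]_n})
    (f1 f2 : 'M[R[i]]_n -> R[i]) : Prop :=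
  exists omega : R[i], forall U, inG G U ->
    pbracket G T R0 f1 f2 U = omega * f1 U * f2 U.

(** * Symplectic leaves *)

(** [c] is, on the open interval [(a, b)], an integral curve in [G] of the
    Hamiltonian vector field of [f], with real time parameter. *)
Definition hamiltonian_curve (R : realType) (n : nat) (G : gtype)
    (T : BDtriple n) (R0 : {linear 'M[R[i]]_n -> 'M[R[i]]_n})
    (f : 'M[R[i]]_n -> R[i]) (a b : R) (c : R -> 'M[R[i]]_n) : Prop :=
  forall t : R, a < t < b -> inG G (c t) /\
    forall i j, let v := pbracket G T R0 (fun V => V i j) f (c t) in
      is_derive t 1 (fun r : R => complex.Re (c r i j) : R) (complex.Re v) /\
      is_derive t 1 (fun r : R => complex.Im (c r i j) : R) (complex.Im v).

Definition hamiltonian_step (R : realType) (n : nat) (G : gtype)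
    (T : BDtriple n) (R0 : {linear 'M[R[i]]_n -> 'M[R[i]]_n})
    (U V : 'M[R[i]]_n) : Prop :=
  exists (f : 'M[R[i]]_n -> R[i]) (a b s t : R) (c : R -> 'M[R[i]]_n),
    [/\ regular f, hamiltonian_curve G T R0 f a b c, a < s < b, a < t < b &
        c s = U /\ c t = V].

(** The leaf through [U]: the points reached from [U] along piecewise
    Hamiltonian curves. As the differentials of regular functions span every
    cotangent space, they yield the same leaves as local holomorphic ones. *)
Definition leaf (R : realType) (n : nat) (G : gtype) (T : BDtriple n)
    (R0 : {linear 'M[R[i]]_n -> 'M[R[i]]_n}) (U : 'M[R[i]]_n) :
    set 'M[R[i]]_n :=
  [set V | clos_refl_trans _ (hamiltonian_step G T R0) U V].

Definition symplectic_leaf (R : realType) (n : nat) (G : gtype)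
    (T : BDtriple n) (R0 : {linear 'M[R[i]]_n -> 'M[R[i]]_n})
    (L : set 'M[R[i]]_n) : Prop :=
  exists2 U, inG G U & L = leaf G T R0 U.

Definition union_of_leaves (R : realType) (n : nat) (G : gtype)
    (T : BDtriple n) (R0 : {linear 'M[R[i]]_n -> 'M[R[i]]_n})
    (Z : set 'M[R[i]]_n) : Prop :=
  exists2 S : set (set 'M[R[i]]_n),
    S `<=` symplectic_leaf G T R0 & Z = \bigcup_(L in S) L.

Definition zero_locus (R : realType) (n : nat) (G : gtype)
    (psi : 'M[R[i]]_n -> R[i]) : set 'M[R[i]]_n :=
  [set U | inG G U /\ psi U = 0].

(* Main.v *)
(** Let [F(U) = B L] with [B] upper triangular and [L] unipotent lower
    triangular, so that [B L = tgammas(L) U]. If [(g', g)] is in [D] and [B' L']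
    is the value of F at [g' U g^-1], then [B' b = A B] for
    [A = tgammas(L') g' tgammas(L)^-1] and [b = L' g L^-1], and [(A, b)] is again
    in [D]. As [b = B'^-1 A B], a root moved by [A] is moved by [b] as soon as its
    image under gamma is; since gamma is nilpotent, [A] and [b] are upper
    triangular. Hence each trailing minor of F is multiplied by a ratio of
    products of diagonal entries of [A] and [b]. Along a gamma-string these
    telescope, the diagonal blocks of [A] and [b] over corresponding runs being
    related, and leave trailing minors of [g'] and [g] at positions separating
    runs, which are characters of [D]. The argument also applies to pairs whose
    blocks correspond only up to scalars; transposing everything and exchanging
    [Gamma_1] and [Gamma_2] gives the g-convention.

    If [z] is the difference of the left and right gradients of [f], then
    [{psi, f}(U)] is the derivative of [psi] at [U] in the direction
    [R_+(z) U - U (R_+(z) - z)]. For [z] strictly upper or lower triangular,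
    [(R_+(z), R_+(z) - z)] is a nilpotent element of the Lie algebra of [D], on
    which the character vanishes; for [z] diagonal it generates a torus covered
    by the semi-invariance up to scalars. So only the diagonal part of [z]
    contributes, which for [f = u_ij] is a multiple of [u_ij] times a constant
    matrix: [psi] is log-canonical with [u_ij]. The coefficients [c_i] are
    invariant under conjugation, hence Casimirs.

    Along a Hamiltonian curve, [psi] therefore satisfies a homogeneous linear
    differential equation, and vanishes identically if it vanishes once. *)
Require Import Defs.
From mathcomp Require Import all_boot all_order all_algebra.
From mathcomp Require Import all_classical all_reals all_analysis.
From mathcomp Require Import complex zify ring.
From Stdlib Require Import Relation_Operators.

Set Implicit Arguments.
Unset Strict Implicit.
Unset Printing Implicit Defensive.

Import Order.TTheory GRing.Theory Num.Theory.

Local Open Scope ring_scope.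

(** * Polynomial and rational functions of a matrix *)

Section FunctionAlgebra.
Variables (X : Type) (K : comNzRingType) (C : (X -> K) -> Prop).

Record function_algebra : Prop := FunctionAlgebra {
  falg_const : forall c, C (fun=> c);
  falg_add : forall f g, C f -> C g -> C (fun x => f x + g x);
  falg_mul : forall f g, C f -> C g -> C (fun x => f x * g x)
}.

Hypothesis algC : function_algebra.

Lemma falg_ext f g : f =1 g -> C f -> C g.
Proof. by move=> /funext ->. Qed.

Lemma falg_sum (I : Type) (r : seq I) (P : pred I) (F : I -> X -> K) :
  (forall i, P i -> C (F i)) -> C (fun x => \sum_(i <- r | P i) F i x).
Proof.
move=> H; elim: r => [|i r IH].
  by apply: falg_ext (falg_const algC 0) => x; rewrite big_nil.
case Pi: (P i); last by apply: falg_ext IH => x; rewrite big_cons Pi.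
by apply: falg_ext (falg_add algC (H i Pi) IH) => x; rewrite big_cons Pi.
Qed.

Lemma falg_prod (I : Type) (r : seq I) (P : pred I) (F : I -> X -> K) :
  (forall i, P i -> C (F i)) -> C (fun x => \prod_(i <- r | P i) F i x).
Proof.
move=> H; elim: r => [|i r IH].
  by apply: falg_ext (falg_const algC 1) => x; rewrite big_nil.
case Pi: (P i); last by apply: falg_ext IH => x; rewrite big_cons Pi.
by apply: falg_ext (falg_mul algC (H i Pi) IH) => x; rewrite big_cons Pi.
Qed.

Lemma falg_exp f k : C f -> C (fun x => f x ^+ k).
Proof.
move=> Cf; elim: k => [|k IH]; first exact: (falg_const algC 1).
by apply: falg_ext (falg_mul algC Cf IH) => x; rewrite exprS.
Qed.

Lemma falg_det m (M : X -> 'M[K]_m) :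
  (forall i j, C (fun x => M x i j)) -> C (fun x => \det (M x)).
Proof.
move=> H; apply: falg_sum => s _; apply: (falg_mul algC); first exact: falg_const.
by apply: falg_prod => i _.
Qed.

End FunctionAlgebra.

Lemma poly_exists_nonroot (K : numFieldType) (p : {poly K}) :
  p != 0 -> exists t, p.[t] != 0.
Proof.
move=> p0; pose s : seq K := [seq k%:R | k <- iota 0 (size p)].
have us : uniq s.
  by rewrite map_inj_uniq ?iota_uniq // => a b /eqP; rewrite eqr_nat => /eqP.
case: (boolP (all (root p) s)) => [rs | /allPn[t _ nt]]; last by exists t.
by have := max_poly_roots p0 rs us; rewrite size_map size_iota ltnn.
Qed.

Section Polyfun.
Variables (K : numFieldType) (n : nat).
Implicit Types (f g : 'M[K]_n -> K).

Definition polyfun f :=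
  forall A B, exists p : {poly K}, forall t, f (A + t *: B) = p.[t].

Lemma polyfun_const c : polyfun (fun=> c).
Proof. by move=> A B; exists c%:P => t; rewrite hornerC. Qed.

Lemma polyfun_coord i j : polyfun (fun U => U i j).
Proof.
move=> A B; exists ((A i j)%:P + B i j *: 'X) => t.
by rewrite !hornerE !mxE mulrC.
Qed.

Lemma polyfun_add f g : polyfun f -> polyfun g -> polyfun (fun U => f U + g U).
Proof.
move=> pf pg A B; have [p Hp] := pf A B; have [q Hq] := pg A B.
by exists (p + q) => t; rewrite hornerD Hp Hq.
Qed.

Lemma polyfun_mul f g : polyfun f -> polyfun g -> polyfun (fun U => f U * g U).
Proof.
move=> pf pg A B; have [p Hp] := pf A B; have [q Hq] := pg A B.
by exists (p * q) => t; rewrite hornerM Hp Hq.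
Qed.

Lemma polyfun_alg : function_algebra polyfun.
Proof. by split; [exact: polyfun_const|exact: polyfun_add|exact: polyfun_mul]. Qed.

Lemma polyfun_det : polyfun (fun U => \det U).
Proof. exact: (falg_det polyfun_alg (M := id) polyfun_coord). Qed.

Lemma polyfun_conj f (P Q : 'M[K]_n) :
  polyfun f -> polyfun (fun U => f (P *m U *m Q)).
Proof.
move=> pf A B; have [p Hp] := pf (P *m A *m Q) (P *m B *m Q); exists p => t.
by rewrite -Hp mulmxDr mulmxDl -scalemxAr -scalemxAl.
Qed.

Lemma polyfun_mul_eq0 f g : polyfun f -> polyfun g ->
  (forall U, f U * g U = 0) -> (exists U, g U != 0) -> forall U, f U = 0.
Proof.
move=> pf pg fg0 [B gB] A; apply/eqP/negP => /negP fA.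
have [p Hp] := pf A (B - A); have [q Hq] := pg A (B - A).
have p0 : p != 0.
  by apply: contraNneq fA => p0; rewrite -[A]addr0 -(scale0r (B - A)) Hp p0 horner0.
have q0 : q != 0.
  apply: contraNneq gB => q0; rewrite -[B](subrK A) addrC.
  by rewrite -(scale1r (B - A)) Hq q0 horner0.
have [t] := poly_exists_nonroot (mulf_neq0 p0 q0).
by rewrite hornerM -Hp -Hq fg0 eqxx.
Qed.

Definition generic (S : 'M[K]_n -> Prop) :=
  exists q, [/\ polyfun q, q 1%:M != 0 & forall U, q U != 0 -> S U].

Lemma genericT (S : 'M[K]_n -> Prop) : (forall U, S U) -> generic S.
Proof.
by move=> H; exists (fun=> 1); split=> [||U _]; [exact: polyfun_const|exact: oner_neq0|exact: H].
Qed.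

Lemma genericI (S1 S2 : 'M[K]_n -> Prop) :
  generic S1 -> generic S2 -> generic (fun U => S1 U /\ S2 U).
Proof.
move=> [p [pp p1 Hp]] [q [pq q1 Hq]]; exists (fun U => p U * q U); split.
- exact: polyfun_mul.
- exact: mulf_neq0.
by move=> U; rewrite mulf_eq0 negb_or => /andP[/Hp ? /Hq].
Qed.

Lemma generic_sub (S1 S2 : 'M[K]_n -> Prop) :
  (forall U, S1 U -> S2 U) -> generic S1 -> generic S2.
Proof. by move=> H [p [pp p1 Hp]]; exists p; split=> // U /Hp /H. Qed.

Definition rational f := exists p q, [/\ polyfun p, polyfun q, q 1%:M != 0 &
  forall U, q U != 0 -> f U = p U / q U].

Lemma rational_poly f : polyfun f -> rational f.
Proof.
move=> pf; exists f, (fun=> 1); split=> [|||U _].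
- exact: pf.
- exact: polyfun_const.
- exact: oner_neq0.
by rewrite divr1.
Qed.

Lemma rational_add f g : rational f -> rational g -> rational (fun U => f U + g U).
Proof.
move=> [p [q [pp pq q1 H]]] [p' [q' [pp' pq' q1' H']]].
exists (fun U => p U * q' U + p' U * q U), (fun U => q U * q' U); split.
- by apply: polyfun_add; exact: polyfun_mul.
- exact: polyfun_mul.
- exact: mulf_neq0.
move=> U; rewrite mulf_eq0 negb_or => /andP[a b].
by rewrite H // H' // addf_div.
Qed.

Lemma rational_mul f g : rational f -> rational g -> rational (fun U => f U * g U).
Proof.
move=> [p [q [pp pq q1 H]]] [p' [q' [pp' pq' q1' H']]].
exists (fun U => p U * p' U), (fun U => q U * q' U); split.
- exact: polyfun_mul.
- exact: polyfun_mul.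
- exact: mulf_neq0.
move=> U; rewrite mulf_eq0 negb_or => /andP[a b].
by rewrite H // H' // mulf_div.
Qed.

Lemma rational_alg : function_algebra rational.
Proof.
split; [|exact: rational_add|exact: rational_mul].
by move=> c; exact/rational_poly/polyfun_const.
Qed.

Lemma rational_generic f : rational f -> f 1%:M != 0 -> generic (fun U => f U != 0).
Proof.
move=> [p [q [pp pq q1 H]]] f1; exists (fun U => p U * q U); split.
- exact: polyfun_mul.
- by apply: mulf_neq0 => //; move: f1; rewrite H // mulf_eq0 negb_or => /andP[].
move=> U; rewrite mulf_eq0 negb_or => /andP[a b].
by rewrite H // mulf_neq0 // invr_eq0.
Qed.

Lemma rational_inv f : rational f -> f 1%:M != 0 -> rational (fun U => (f U)^-1).
Proof.
move=> [p [q [pp pq q1 H]]] f1.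
exists (fun U => q U * q U), (fun U => p U * q U); split.
- exact: polyfun_mul.
- exact: polyfun_mul.
- by apply: mulf_neq0 => //; move: f1; rewrite H // mulf_eq0 negb_or => /andP[].
move=> U; rewrite mulf_eq0 negb_or => /andP[a b].
by rewrite H // invf_div -mulf_div divff // mulr1.
Qed.

Definition rational_mx (A : 'M[K]_n -> 'M[K]_n) :=
  forall i j, rational (fun U => A U i j).

Lemma rational_mx_ext A B : A =1 B -> rational_mx A -> rational_mx B.
Proof. by move=> AB H i j; apply: falg_ext (H i j) => U; rewrite AB. Qed.

Lemma rational_mx_const (A : 'M[K]_n) : rational_mx (fun=> A).
Proof. by move=> i j; exact/rational_poly/polyfun_const. Qed.

Lemma rational_mx_id : rational_mx id.
Proof. by move=> i j; exact/rational_poly/polyfun_coord. Qed.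

Lemma rational_mx_mul A B :
  rational_mx A -> rational_mx B -> rational_mx (fun U => A U *m B U).
Proof.
move=> rA rB i j; apply: (@falg_ext _ _ _ (fun U => \sum_k A U i k * B U k j)).
  by move=> U; rewrite mxE.
by apply: (falg_sum rational_alg) => k _; exact: rational_mul.
Qed.

Lemma rational_mx_add A B :
  rational_mx A -> rational_mx B -> rational_mx (fun U => A U + B U).
Proof.
move=> rA rB i j; apply: (@falg_ext _ _ _ (fun U => A U i j + B U i j)).
  by move=> U; rewrite mxE.
exact: rational_add.
Qed.

Lemma rational_mx_scale f A :
  rational f -> rational_mx A -> rational_mx (fun U => f U *: A U).
Proof.
move=> rf rA i j; apply: (@falg_ext _ _ _ (fun U => f U * A U i j)).
  by move=> U; rewrite mxE.
exact: rational_mul.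
Qed.

Lemma rational_mx_cscale c A : rational_mx A -> rational_mx (fun U => c *: A U).
Proof. exact/rational_mx_scale/rational_poly/polyfun_const. Qed.

Lemma rational_mx_opp A : rational_mx A -> rational_mx (fun U => - A U).
Proof.
by move=> rA; apply: rational_mx_ext (rational_mx_cscale (-1) rA) => U; rewrite scaleN1r.
Qed.

Lemma rational_mx_sum (I : Type) (r : seq I) (P : pred I) F :
  (forall i, P i -> rational_mx (F i)) ->
  rational_mx (fun U => \sum_(i <- r | P i) F i U).
Proof.
move=> H i j.
apply: (@falg_ext _ _ _ (fun U => \sum_(k <- r | P k) F k U i j)).
  by move=> U; rewrite summxE.
by apply: (falg_sum rational_alg) => k /H.
Qed.

Lemma rational_mx_exp A k : rational_mx A -> rational_mx (fun U => A U ^+ k).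
Proof.
move=> rA; elim: k => [|k IH]; first exact: rational_mx_const.
by apply: rational_mx_ext (rational_mx_mul rA IH) => U; rewrite exprS.
Qed.

(* Gaussian elimination of the entries to the left of the diagonal, from the
   last row upwards, acting on columns. *)
Definition pivot_row (i : 'I_n) (A : 'M[K]_n) : 'M[K]_n :=
  \matrix_(k, j) if (k == i) && (j < i)%N then A i j / A i i else 0.

Fixpoint UL_elim k (A : 'M[K]_n) : 'M[K]_n * 'M[K]_n :=
  match k with
  | 0 => (A, 1%:M)
  | k'.+1 =>
      let BL := UL_elim k' A in
      match insub (n - k)%N : option 'I_n with
      | Some i => (BL.1 *m (1%:M - pivot_row i BL.1), (1%:M + pivot_row i BL.1) *m BL.2)
      | None => BL
      end
  end.

Lemma pivot_row_sq i (A : 'M[K]_n) : pivot_row i A *m pivot_row i A = 0.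
Proof.
apply/matrixP => k j; rewrite !mxE big1 // => l _; rewrite !mxE.
by case: (altP (l =P i)) => [->|_] /=; rewrite ?ltnn ?andbF ?mul0r ?mulr0.
Qed.

Lemma pivot_row_1 i : pivot_row i 1%:M = 0.
Proof.
apply/matrixP => k j; rewrite !mxE; case: ifP => // /andP[_ ji].
by rewrite -val_eqE /= gtn_eqF // mul0r.
Qed.

Lemma UL_elim1 k : UL_elim k 1%:M = (1%:M, 1%:M).
Proof.
elim: k => //= k ->; case: insub => [i|] //=.
by rewrite pivot_row_1 subr0 addr0 mulmx1.
Qed.

Lemma UL_elim_mul k A : (UL_elim k A).1 *m (UL_elim k A).2 = A.
Proof.
elim: k => [|k IH] /=; first by rewrite mulmx1.
case: insub => [i|] //=; set BL := UL_elim k A in IH *; set N := pivot_row i _.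
have NN : (1%:M - N) *m (1%:M + N) = 1%:M.
  by rewrite mulmxBl mul1mx mulmxDr mulmx1 pivot_row_sq addr0 addrK.
by rewrite mulmxA -(mulmxA BL.1) NN mulmx1.
Qed.

Lemma mulmx_unip_lower (A B : 'M[K]_n) :
  (forall i j : 'I_n, (i < j)%N -> A i j = 0) -> (forall i, A i i = 1) ->
  (forall i j : 'I_n, (i < j)%N -> B i j = 0) -> (forall i, B i i = 1) ->
  (forall i j : 'I_n, (i < j)%N -> (A *m B) i j = 0) /\
  (forall i, (A *m B) i i = 1).
Proof.
move=> lA dA lB dB; split=> [i j ij|i]; rewrite mxE.
  rewrite big1 // => k _; case: (ltnP i k) => ik; first by rewrite lA ?mul0r.
  by rewrite lB ?mulr0 // (leq_ltn_trans ik ij).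
rewrite (bigD1 i) //= dA dB mulr1 big1 ?addr0 // => k; rewrite -val_eqE neq_ltn.
by case/orP => H; [rewrite lB ?mulr0|rewrite lA ?mul0r].
Qed.

Lemma UL_elim_lower k A :
  (forall i j : 'I_n, (i < j)%N -> (UL_elim k A).2 i j = 0) /\
  (forall i, (UL_elim k A).2 i i = 1).
Proof.
elim: k => [|k [IH1 IH2]] /=.
  split=> [i j ij|i]; rewrite !mxE ?eqxx //.
  by rewrite -val_eqE ltn_eqF.
case: insub => [x|] //=; apply: mulmx_unip_lower => // [i j ij|i]; rewrite !mxE.
  rewrite -val_eqE ltn_eqF // add0r; case: ifP => // /andP[/eqP<- /ltnW].
  by rewrite leqNgt ij.
by rewrite eqxx; case: ifP => [/andP[/eqP->]|]; rewrite ?ltnn ?addr0.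
Qed.

Lemma rational_UL_elim k A : rational_mx A -> A 1%:M = 1%:M ->
  rational_mx (fun U => (UL_elim k (A U)).1) /\
  rational_mx (fun U => (UL_elim k (A U)).2).
Proof.
move=> rA A1; elim: k => [|k [IH1 IH2]] /=.
  by split=> //; exact: rational_mx_const.
case: insub => [x|] //=.
have rN : rational_mx (fun U => pivot_row x (UL_elim k (A U)).1).
  move=> i j; set b := (i == x) && (j < x)%N.
  apply: (@falg_ext _ _ _ (fun U => (b%:R : K) *
    ((UL_elim k (A U)).1 i j * ((UL_elim k (A U)).1 x x)^-1))).
    move=> U; rewrite mxE -/b; case: (boolP b) => [|_]; last by rewrite mul0r.
    by case/andP => /eqP-> _; rewrite mul1r.
  apply: rational_mul; first exact/rational_poly/polyfun_const.
  apply: rational_mul => //; apply: rational_inv => //.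
  by rewrite A1 UL_elim1 mxE eqxx oner_neq0.
have r1 := rational_mx_const 1%:M.
split; apply: rational_mx_mul => //; apply: rational_mx_add => //.
exact: rational_mx_opp.
Qed.

Lemma generic_UL_elim k A : rational_mx A -> A 1%:M = 1%:M ->
  generic (fun U => forall i j : 'I_n, (n - k <= i)%N -> (j < i)%N ->
    (UL_elim k (A U)).1 i j = 0).
Proof.
move=> rA A1; elim: k => [|k IH] /=.
  by apply: genericT => U i j; rewrite subn0 leqNgt ltn_ord.
case: insubP => [x xn ex|xn] /=; last first.
  apply: generic_sub IH => U H i j ki ji; apply: H => //.
  by move: xn; rewrite ltn_subrL (leq_ltn_trans _ (ltn_ord i)).
have [rB _] := rational_UL_elim k rA A1.
have gx : generic (fun U => (UL_elim k (A U)).1 x x != 0).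
  apply: rational_generic; first exact: rB.
  by rewrite A1 UL_elim1 mxE eqxx oner_neq0.
have nk : (n - k <= x.+1)%N by rewrite ex subnS leqSpred.
apply: generic_sub (genericI IH gx) => U [H px] i j; rewrite -ex => xi ji.
set B := (UL_elim k (A U)).1 in H px *.
rewrite mulmxBr mulmx1 mxE [X in _ + X]mxE.
have -> : (B *m pivot_row x B) i j = if (j < x)%N then B i x * (B x j / B x x) else 0.
  rewrite mxE (bigD1 x) //= mxE eqxx /= big1 ?addr0; first by case: ifP => //; rewrite mulr0.
  by move=> l /negbTE lx; rewrite mxE lx mulr0.
move: xi; rewrite leq_eqVlt => /orP[/eqP xi|xi].
  have xi' : x = i by exact/val_inj.
  by move: ji; rewrite -xi' => ji; rewrite ji mulrCA divff // mulr1 subrr.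
have ki := leq_trans nk xi.
by rewrite (H i j ki ji) (H i x ki xi) mul0r if_same subrr.
Qed.

End Polyfun.

(** * Block triangular matrices *)

Lemma invmx_closed (K : fieldType) (n : nat) (P : 'M[K]_n -> Prop) (A : 'M[K]_n) :
  P 1%:M -> (forall X Y, P X -> P Y -> P (X + Y)) ->
  (forall c X, P X -> P (c *: X)) -> (forall X Y, P X -> P Y -> P (X *m Y)) ->
  P A -> P (invmx A).
Proof.
move=> P1 PD PZ PM PA.
case: n P A P1 PD PZ PM PA => [|n] P A P1 PD PZ PM PA.
  by rewrite (flatmx0 (invmx A)) -(flatmx0 A).
case: (boolP (A \in unitmx)) => uA; last by rewrite /invmx (negbTE uA).
have PH p : P (horner_mx A p).
  elim/poly_ind: p => [|p c IH]; first by rewrite rmorph0 -(scale0r 1%:M); exact: PZ.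
  rewrite rmorphD rmorphM /= horner_mx_X horner_mx_C; apply: PD; first exact: PM.
  by rewrite -scalemx1; exact: PZ.
have [q [c pE]] : exists q c, char_poly A = q * 'X + c%:P.
  elim/poly_ind: (char_poly A) => [|p c _]; last by exists p, c.
  by exists 0, 0; rewrite mul0r addr0.
have cE : c = (- 1) ^+ n.+1 * \det A.
  by rewrite -char_poly_det pE coefD coefMX coefC add0r.
have c0 : c != 0.
  rewrite cE mulf_neq0 ?expf_neq0 ?oppr_eq0 ?oner_neq0 //.
  by move: uA; rewrite unitmxE unitfE.
have := Cayley_Hamilton A; rewrite pE rmorphD rmorphM /= horner_mx_X horner_mx_C.
set Q := horner_mx A q => QA.
have -> : invmx A = (- c^-1) *: Q.
  apply: (@row_full_inj _ _ _ _ A); first by rewrite row_full_unit.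
  rewrite -scalemxAr mulmxV //.
  have AQ : A *m Q = Q *m A.
    exact/esym/comm_horner_mx/comm_mx_refl.
  rewrite AQ.
  have -> : Q *m A = - c%:M by apply/eqP; rewrite -addr_eq0; apply/eqP.
  by rewrite scalerN scaleNr opprK scale_scalar_mx mulVf.
exact/PZ/PH.
Qed.

Lemma conj_factor (K : comUnitRingType) (n : nat) (t t' g g' U B L B' L' : 'M[K]_n) :
  t \in unitmx -> g \in unitmx -> L \in unitmx ->
  B *m L = t *m U -> B' *m L' = t' *m (g' *m U *m invmx g) ->
  B' *m (L' *m g *m invmx L) = t' *m g' *m invmx t *m B.
Proof.
move=> ut ug uL E E'; have UE : U = invmx t *m B *m L by rewrite -mulmxA E mulKmx.
rewrite !mulmxA E' UE !mulmxA.
by rewrite mulmxKV // mulmxK.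
Qed.

Section Parabolic.
Variables (K : fieldType) (n : nat).
Implicit Types (S : pred nat) (A B : 'M[K]_n).

(** Roots are counted from 1 and indices from 0, so that the roots separating
    the indices [j < i] are [j + 1, ..., i]. *)
Definition upin S A := forall i j : 'I_n, (j < i)%N ->
  ~~ all S (index_iota j.+1 i.+1) -> A i j = 0.

Definition loin S A := upin S A^T.

Lemma all_iotaPn S (i j : nat) :
  reflect (exists2 r, (j < r <= i)%N & ~~ S r) (~~ all S (index_iota j.+1 i.+1)).
Proof.
apply: (iffP allPn) => -[r Hr Sr]; exists r => //; move: Hr; rewrite mem_index_iota //.
Qed.

Lemma upinP S A :
  upin S A <-> forall r (i j : 'I_n), ~~ S r -> (j < r)%N -> (r <= i)%N -> A i j = 0.
Proof.
split=> [H r i j Sr jr ri|H i j ji /all_iotaPn[r /andP[jr ri] Sr]]; last exact: (H r).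
apply: H; first exact: leq_trans ri.
by apply/all_iotaPn; exists r; rewrite ?jr.
Qed.

Lemma loinP S A :
  loin S A <-> forall r (i j : 'I_n), ~~ S r -> (i < r)%N -> (r <= j)%N -> A i j = 0.
Proof.
split=> [/upinP H r i j Sr ir rj|H]; first by have := H r j i Sr ir rj; rewrite mxE.
by apply/upinP => r i j Sr jr ri; rewrite mxE (H r).
Qed.

Lemma upin_sub S S' A : (forall r, S r -> S' r) -> upin S A -> upin S' A.
Proof.
move=> SS /upinP H; apply/upinP => r i j Sr; apply: H.
by apply: contraNN Sr => /SS.
Qed.

Lemma upin1 S : upin S 1%:M.
Proof. by move=> i j ji _; rewrite mxE -val_eqE gtn_eqF. Qed.

Lemma upin0 S : upin S 0.
Proof. by move=> i j ji _; rewrite mxE. Qed.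

Lemma upinD S A B : upin S A -> upin S B -> upin S (A + B).
Proof. by move=> HA HB i j ji H; rewrite mxE HA // HB // addr0. Qed.

Lemma upinZ S c A : upin S A -> upin S (c *: A).
Proof. by move=> HA i j ji H; rewrite mxE HA // mulr0. Qed.

Lemma upin_sum S (I : Type) (r : seq I) (P : pred I) (F : I -> 'M[K]_n) :
  (forall i, P i -> upin S (F i)) -> upin S (\sum_(i <- r | P i) F i).
Proof. by move=> H; apply: big_ind => //; [exact: upin0|exact: upinD]. Qed.

Lemma upinM S A B : upin S A -> upin S B -> upin S (A *m B).
Proof.
move=> /upinP HA /upinP HB; apply/upinP => r i j Sr jr ri.
rewrite mxE big1 // => k _; case: (leqP r k) => kr; first by rewrite (HB r) ?mulr0.
by rewrite (HA r) ?mul0r.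
Qed.

Lemma upinX S A k : upin S A -> upin S (A ^+ k).
Proof.
move=> HA; elim: k => [|k IH]; first exact: upin1.
by rewrite exprS; exact: upinM.
Qed.

Lemma upinV S A : upin S A -> upin S (invmx A).
Proof.
by apply: invmx_closed; [exact: upin1|exact: upinD|exact: upinZ|exact: upinM].
Qed.

Lemma loin1 S : loin S 1%:M. Proof. by rewrite /loin tr_scalar_mx; exact: upin1. Qed.

Lemma loinD S A B : loin S A -> loin S B -> loin S (A + B).
Proof. by rewrite /loin linearD; exact: upinD. Qed.

Lemma loinZ S c A : loin S A -> loin S (c *: A).
Proof. by rewrite /loin linearZ; exact: upinZ. Qed.

Lemma loin_sum S (I : Type) (r : seq I) (P : pred I) (F : I -> 'M[K]_n) :
  (forall i, P i -> loin S (F i)) -> loin S (\sum_(i <- r | P i) F i).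
Proof. by move=> H; rewrite /loin linear_sum; apply: upin_sum. Qed.

Lemma loinM S A B : loin S A -> loin S B -> loin S (A *m B).
Proof. by rewrite /loin trmx_mul => HA HB; exact: upinM. Qed.

Lemma loinX S A k : loin S A -> loin S (A ^+ k).
Proof.
move=> HA; elim: k => [|k IH]; first exact: loin1.
by rewrite exprS; exact: loinM.
Qed.

Lemma loinV S A : loin S A -> loin S (invmx A).
Proof. by rewrite /loin trmx_inv; exact: upinV. Qed.

Lemma upin_pred0 A : upin pred0 A <-> (forall i j : 'I_n, (j < i)%N -> A i j = 0).
Proof.
split=> [/upinP H i j ji|H i j ji _]; last exact: H.
exact: (H i).
Qed.

Lemma loin_pred0 A : loin pred0 A <-> (forall i j : 'I_n, (i < j)%N -> A i j = 0).
Proof.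
rewrite /loin upin_pred0; split=> H i j ij; last by rewrite mxE H.
by have := H j i ij; rewrite mxE.
Qed.

Lemma lower_loin S A : (forall i j : 'I_n, (i < j)%N -> A i j = 0) -> loin S A.
Proof. by move=> H; apply: upin_sub (proj2 (loin_pred0 A) H). Qed.

Lemma upper_upin S A : (forall i j : 'I_n, (j < i)%N -> A i j = 0) -> upin S A.
Proof. by move=> H; apply: upin_sub (proj2 (upin_pred0 A) H). Qed.

Definition trailing_mx r A : 'M[K]_n :=
  \matrix_(i, j) if (r <= i)%N && (r <= j)%N then A i j else (i == j)%:R.

Lemma trailing_mxM r A B :
  (forall i j : 'I_n, (j < r)%N -> (r <= i)%N -> A i j = 0) \/
  (forall i j : 'I_n, (i < r)%N -> (r <= j)%N -> B i j = 0) ->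
  trailing_mx r (A *m B) = trailing_mx r A *m trailing_mx r B.
Proof.
move=> H; apply/matrixP => i j; rewrite !mxE.
have Hs : forall k : 'I_n, (k < r)%N -> (r <= i)%N -> (r <= j)%N -> A i k * B k j = 0.
  by move=> k kr ri rj; case: H => H; rewrite H // ?mul0r ?mulr0.
case: (leqP r i) => ri /=; last first.
  rewrite (bigD1 i) //= !mxE leqNgt ri /= eqxx mul1r big1 ?addr0 // => k /negbTE ki.
  by rewrite !mxE [(r <= i)%N]leqNgt ri /= eq_sym ki mul0r.
case: (leqP r j) => rj /=; last first.
  rewrite (bigD1 j) //= !mxE [(r <= j)%N]leqNgt rj /= !andbF eqxx mulr1 big1 ?addr0 // => k /negbTE kj.
  by rewrite !mxE [(r <= j)%N]leqNgt rj /= !andbF kj mulr0.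
apply: eq_bigr => k _; rewrite !mxE ri rj !andbT /=.
case: (leqP r k) => kr //=; rewrite Hs //.
have -> : (i == k) = false by rewrite -val_eqE gtn_eqF // (leq_trans kr).
by rewrite mul0r.
Qed.

Lemma det_trailing_tri r A :
  (forall i j : 'I_n, (j < i)%N -> A i j = 0) \/
  (forall i j : 'I_n, (i < j)%N -> A i j = 0) ->
  \det (trailing_mx r A) = \prod_(i < n | (r <= i)%N) A i i.
Proof.
move=> H; have -> : \det (trailing_mx r A) = \prod_i trailing_mx r A i i.
  case: H => H; last first.
    rewrite det_trig //; apply/is_trig_mxP => i j ij; rewrite mxE H //.
    by rewrite -val_eqE ltn_eqF // if_same.
  rewrite -det_tr det_trig; first by apply: eq_bigr => i _; rewrite mxE.
  apply/is_trig_mxP => i j ij; rewrite mxE [LHS]mxE H //.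
  by rewrite -val_eqE gtn_eqF // if_same.
rewrite [RHS]big_mkcond; apply: eq_bigr => i _; rewrite !mxE eqxx andbb.
by case: ifP.
Qed.

Lemma trailing_mx_tr r A : trailing_mx r A^T = (trailing_mx r A)^T.
Proof. by apply/matrixP => i j; rewrite !mxE andbC eq_sym. Qed.

End Parabolic.

Section Blocks.
Variables (R : realType) (n : nat).
Implicit Types (A B : 'M[R[i]]_n).

Lemma blockE m a A (p q : 'I_m) (i j : 'I_n) :
  i = (a + p)%N :> nat -> j = (a + q)%N :> nat -> block m a.+1 A p q = A i j.
Proof.
move=> ip jq; rewrite /block mxE /entry !addSn /= -ip -jq.
by rewrite !valK.
Qed.

Lemma trailing_minorE r A : trailing_minor r A = \det (trailing_mx r A).
Proof.
rewrite /trailing_minor; case: (leqP r n) => rn; last first.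
  have -> : trailing_mx r A = 1%:M.
    apply/matrixP => i j; rewrite !mxE leqNgt (ltn_trans (ltn_ord i) rn) //=.
  rewrite det1; have : (n - r = 0)%N by apply/eqP; rewrite subn_eq0 ltnW.
  by move=> e; move: (block _ _ _); rewrite e => M; rewrite det_mx00.
have : (r + (n - r) = n)%N by rewrite subnKC.
move: (n - r)%N => k e; subst n; rename A into A0.
have -> : trailing_mx r A0 = block_mx 1%:M 0 0 (block k r.+1 A0).
  apply/matrixP => i j; rewrite -(fintype.splitK i) -(fintype.splitK j).
  case: (fintype.split i) => i'; case: (fintype.split j) => j' /=;
   rewrite ?block_mxEul ?block_mxEur ?block_mxEdl ?block_mxEdr !mxE /=.
  - by rewrite leqNgt ltn_ord.
  - by rewrite leqNgt ltn_ord /= -val_eqE /= ltn_eqF // (leq_trans (ltn_ord i')) ?leq_addr.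
  - by rewrite andbC leqNgt ltn_ord /= -val_eqE /= gtn_eqF // (leq_trans (ltn_ord j')) ?leq_addr.
  - by rewrite !leq_addr /= /entry !addSn /= (valK (rshift r i')) (valK (rshift r j')).
by rewrite det_ublock det1 mul1r.
Qed.

Lemma trailing_minorM r A B :
  (forall i j : 'I_n, (j < r)%N -> (r <= i)%N -> A i j = 0) \/
  (forall i j : 'I_n, (i < r)%N -> (r <= j)%N -> B i j = 0) ->
  trailing_minor r (A *m B) = trailing_minor r A * trailing_minor r B.
Proof. by move=> H; rewrite !trailing_minorE trailing_mxM // det_mulmx. Qed.

Lemma trailing_minor_tri r A :
  (forall i j : 'I_n, (j < i)%N -> A i j = 0) \/
  (forall i j : 'I_n, (i < j)%N -> A i j = 0) ->
  trailing_minor r A = \prod_(i < n | (r <= i)%N) A i i.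
Proof. by move=> H; rewrite trailing_minorE det_trailing_tri. Qed.

Lemma trailing_minor_tr r A : trailing_minor r A^T = trailing_minor r A.
Proof. by rewrite !trailing_minorE trailing_mx_tr det_tr. Qed.

Lemma trailing_minor1 r : trailing_minor r (1%:M : 'M[R[i]]_n) = 1.
Proof.
rewrite trailing_minor_tri; first by rewrite big1 // => i _; rewrite mxE eqxx.
by left=> i j ij; rewrite mxE -val_eqE gtn_eqF.
Qed.

Lemma trailing_minor0 A : trailing_minor 0 A = \det A.
Proof.
by rewrite trailing_minorE; congr (\det _); apply/matrixP => i j; rewrite mxE.
Qed.

Lemma block_mul m a S A B : (a + m < n)%N -> ~~ S a -> ~~ S (a + m).+1 ->
  (upin S A /\ upin S B) \/ (loin S A /\ loin S B) ->
  block m.+1 a.+1 (A *m B) = block m.+1 a.+1 A *m block m.+1 a.+1 B.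
Proof.
move=> amn Sa Sam H.
have lt (p : 'I_m.+1) : (a + p < n)%N.
  by apply: leq_ltn_trans amn; rewrite leq_add2l -ltnS.
pose o p := Ordinal (lt p).
apply/matrixP => p q; rewrite (@blockE _ _ _ p q (o p) (o q)) // !mxE.
rewrite (bigID (fun k : 'I_n => (a <= k <= a + m)%N)) /= [X in _ + X]big1 ?addr0; last first.
  move=> k; rewrite negb_and -!ltnNge => kam.
  have pm : (o p <= a + m)%N by rewrite /= leq_add2l -ltnS.
  have qm : (o q <= a + m)%N by rewrite /= leq_add2l -ltnS.
  have ap : (a <= o p)%N by rewrite /= leq_addr.
  have aq : (a <= o q)%N by rewrite /= leq_addr.
  case: H => -[HA HB]; case/orP: kam => kam.
  - by move/upinP: HA => /(_ a _ _ Sa) ->; rewrite ?mul0r.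
  - by move/upinP: HB => /(_ _ _ _ Sam) ->; rewrite ?mulr0.
  - by move/loinP: HB => /(_ a _ _ Sa) ->; rewrite ?mulr0.
  - by move/loinP: HA => /(_ _ _ _ Sam) ->; rewrite ?mul0r.
rewrite (reindex_onto o (fun k : 'I_n => inord (k - a))) /=; last first.
  move=> k /andP[ak kam]; apply/val_inj; rewrite /= inordK ?subnKC //.
  by rewrite ltnS leq_subLR.
apply: eq_big => [k|k _]; last first.
  by rewrite (@blockE _ _ A p k (o p) (o k)) // (@blockE _ _ B k q (o k) (o q)).
by rewrite /= leq_addr leq_add2l -ltnS ltn_ord /= addKn inord_val eqxx.
Qed.

Lemma block1 m a : (a + m < n)%N -> block m.+1 a.+1 (1%:M : 'M[R[i]]_n) = 1%:M.
Proof.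
move=> amn.
have lt (p : 'I_m.+1) : (a + p < n)%N.
  by apply: leq_ltn_trans amn; rewrite leq_add2l -ltnS.
apply/matrixP => p q.
by rewrite (@blockE _ _ _ p q (Ordinal (lt p)) (Ordinal (lt q))) // !mxE -!val_eqE /= eqn_add2l.
Qed.

Lemma entryD A B a b : entry (A + B) a b = entry A a b + entry B a b.
Proof.
by rewrite /entry; case: insub => [i|]; [case: insub => [j|]|]; rewrite ?mxE ?addr0.
Qed.

Lemma entryZ c A a b : entry (c *: A) a b = c * entry A a b.
Proof.
by rewrite /entry; case: insub => [i|]; [case: insub => [j|]|]; rewrite ?mxE ?mulr0.
Qed.

Lemma blockD m a A B : block m a (A + B) = block m a A + block m a B.
Proof. by apply/matrixP => p q; rewrite !mxE entryD. Qed.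

Lemma blockZ m a c A : block m a (c *: A) = c *: block m a A.
Proof. by apply/matrixP => p q; rewrite !mxE entryZ. Qed.

Lemma block0 m a : block m a (0 : 'M[R[i]]_n) = 0.
Proof. by rewrite -(scale0r (0 : 'M[R[i]]_n)) blockZ scale0r. Qed.

Lemma block_sum m a (I : Type) (r : seq I) (P : pred I) (F : I -> 'M[R[i]]_n) :
  block m a (\sum_(i <- r | P i) F i) = \sum_(i <- r | P i) block m a (F i).
Proof. by apply: (big_morph (block m a)) => [A B|]; [exact: blockD|exact: block0]. Qed.

Lemma block_tr m a A : block m a A^T = (block m a A)^T.
Proof.
apply/matrixP => p q; rewrite !mxE /entry.
by case: insub => [i|]; case: insub => [j|] //; rewrite mxE.
Qed.

Lemma block_exp m a S A k : (a + m < n)%N -> ~~ S a -> ~~ S (a + m).+1 ->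
  upin S A \/ loin S A -> block m.+1 a.+1 (A ^+ k) = (block m.+1 a.+1 A) ^+ k.
Proof.
move=> amn Sa Sam H; elim: k => [|k IH]; first exact: block1.
rewrite !exprS (@block_mul m a S) ?IH //.
by case: H => H; [left|right]; split=> //; [exact: upinX|exact: loinX].
Qed.

Lemma block_inv m a S A : (a + m < n)%N -> ~~ S a -> ~~ S (a + m).+1 ->
  upin S A \/ loin S A -> A \in unitmx ->
  block m.+1 a.+1 A \in unitmx /\ block m.+1 a.+1 (invmx A) = invmx (block m.+1 a.+1 A).
Proof.
move=> amn Sa Sam H uA.
have E : block m.+1 a.+1 A *m block m.+1 a.+1 (invmx A) = 1%:M.
  rewrite -(@block_mul m a S) // ?mulmxV ?block1 //.
  by case: H => H; [left|right]; split=> //; [exact: upinV|exact: loinV].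
have [u1 _] := mulmx1_unit E; split=> //.
by rewrite -[RHS]mulmx1 -E mulKmx.
Qed.

End Blocks.

(* Otherwise unification unfolds distinct blocks before failing. *)
Opaque block.

(** * Truncated exponential and logarithm *)

Lemma trmx_exp (K : comNzRingType) (n : nat) (X : 'M[K]_n) k : (X ^+ k)^T = X^T ^+ k.
Proof.
elim: k => [|k IH]; first by rewrite !expr0 tr_scalar_mx.
by rewrite exprSr exprS -!mulmxE trmx_mul IH.
Qed.

Definition strict_upper (K : nmodType) (n : nat) (A : 'M[K]_n) :=
  forall i j : 'I_n, (j <= i)%N -> A i j = 0.
Definition strict_lower (K : nmodType) (n : nat) (A : 'M[K]_n) :=
  forall i j : 'I_n, (i <= j)%N -> A i j = 0.

Lemma strict_upper_nilpotent (K : nzRingType) (n : nat) (X : 'M[K]_n) :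
  strict_upper X -> X ^+ n = 0.
Proof.
move=> H.
have Hk k : forall i j : 'I_n, (j < i + k)%N -> (X ^+ k) i j = 0.
  elim: k => [|k IH] i j ijk.
    rewrite mxE; case: eqP => // ij; move: ijk; rewrite ij addn0 ltnn //.
  rewrite exprS -mulmxE mxE big1 // => l _; case: (leqP l i) => li.
    by rewrite H ?mul0r.
  rewrite IH ?mulr0 // (leq_trans ijk) // addnS -addSn leq_add2r //.
apply/matrixP => i j; rewrite [RHS]mxE Hk //.
by rewrite (leq_trans (ltn_ord j)) ?leq_addl.
Qed.

Lemma strict_lower_nilpotent (K : comNzRingType) (n : nat) (X : 'M[K]_n) :
  strict_lower X -> X ^+ n = 0.
Proof.
move=> H.
apply: trmx_inj; rewrite trmx_exp trmx0; apply: strict_upper_nilpotent => i j ji.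
by rewrite mxE H.
Qed.

Section ExpLog.
Variables (K : numFieldType) (m : nat).

Let e : {poly K} := \sum_(k < m.+1) (k`!%:R)^-1 *: 'X^k.
Let l : {poly K} := \sum_(1 <= k < m.+1) ((-1) ^+ k.-1 / k%:R) *: 'X^k.

Lemma deriv_exp_trunc : e^`() = e - (m`!%:R)^-1 *: 'X^m.
Proof.
rewrite /e [in RHS]big_ord_recr /= addrK.
rewrite big_ord_recl /= linearD /= expr0 linearZ /= derivC scaler0 add0r.
rewrite linear_sum; apply: eq_bigr => k _; rewrite linearZ /= derivXn /=.
by rewrite -scaler_nat scalerA /bump /= add1n factS natrM invfM mulrAC mulVf ?mul1r ?pnatr_eq0.
Qed.

Lemma deriv_log_trunc : (1 + 'X) * l^`() = 1 - (- 'X) ^+ m.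
Proof.
have -> : l^`() = \sum_(k < m) (- 'X) ^+ k.
  rewrite /l big_add1 /= big_mkord linear_sum; apply: eq_bigr => k _.
  rewrite linearZ /= derivXn /= -scaler_nat scalerA mulfVK ?pnatr_eq0 //.
  by rewrite [RHS]exprNn -mul_polyC rmorphXn /= polyCN.
have -> : 1 + 'X = - (- 'X - 1) :> {poly K} by rewrite opprB opprK.
by rewrite mulNr -subrX1 opprB.
Qed.

Lemma exp_trunc0 : e`_0 = 1.
Proof.
rewrite /e big_ord_recl coefD coefZ expr0 coef1 eqxx mulr1 invr1 coef_sum.
by rewrite big1 ?addr0 // => k _; rewrite coefZ coefXn /= mulr0.
Qed.

Lemma exp_comp_log : exists Q, e \Po l = 1 + 'X + 'X^(m.+1) * Q.
Proof.
pose P := e \Po l.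
have [l2 lE] : exists l2, l = 'X * l2.
  exists (\sum_(1 <= k < m.+1) ((-1) ^+ k.-1 / k%:R) *: 'X^(k.-1)).
  rewrite /l mulr_sumr !big_add1; apply: eq_bigr => k _ /=.
  by rewrite -scalerAr -exprS.
have [Q PQ] : exists Q, (1 + 'X) * P^`() = P + 'X^m * Q.
  rewrite /P deriv_comp deriv_exp_trunc mulrCA deriv_log_trunc linearB /= linearZ /=.
  rewrite comp_Xn_poly [in l ^+ m]lE exprMn.
  set u := e \Po l; set c := _^-1.
  exists (- u * (-1) ^+ m - (c *: l2 ^+ m) * (1 - (- 'X) ^+ m)).
  rewrite -!mul_polyC (exprNn 'X); ring.
have P0 : P`_0 = 1.
  rewrite -horner_coef0 horner_comp lE hornerM hornerX mul0r horner_coef0.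
  exact: exp_trunc0.
have Pk k : (k < m)%N -> (k.+1)%:R * P`_k.+1 = (1 - k%:R) * P`_k.
  move=> km; move/(congr1 (fun p : {poly K} => p`_k)): PQ.
  rewrite mulrDl mul1r !coefD coefXM coefXnM km addr0 !coef_deriv.
  case: k km => [|k] km /=; first by rewrite addr0 mulr1n subr0 !mul1r.
  by move=> H; rewrite mulrBl mul1r -{1}H !mulr_natl addrK.
have Pk' k : (k <= m)%N -> P`_k = (k <= 1)%:R.
  elim: k => [|k IH] km; first by rewrite P0.
  have k0 : (k.+1)%:R != 0 :> K by rewrite pnatr_eq0.
  apply: (mulfI k0); rewrite Pk // IH ?(ltnW km) //.
  by case: k {IH km k0} => [|[|k]] /=; rewrite ?subr0 ?mulr1 ?subrr ?mulr0 ?mul0r.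
exists (drop_poly m.+1 (P - 1 - 'X)).
have -> : 'X^(m.+1) * drop_poly m.+1 (P - 1 - 'X) = P - 1 - 'X.
  rewrite -[RHS](poly_take_drop m.+1) [X in _ = X + _](_ : _ = 0) ?add0r 1?mulrC //.
  apply/polyP => k; rewrite coef_take_poly coef0; case: ifP => // km.
  rewrite !coefB coef1 coefX Pk' //.
  by case: k km => [|[|k]] km /=; rewrite ?subrr ?subr0 ?subrr.
by rewrite /P; ring.
Qed.

Lemma exp_mul_exp_opp : exists Q, e * (e \Po - 'X) = 1 + 'X^(m.+1) * Q.
Proof.
pose P := e * (e \Po - 'X).
have [Q PQ] : exists Q, P^`() = 'X^m * Q.
  have dE : e^`() \Po - 'X = (e \Po - 'X) - (m`!%:R)^-1 *: (- 'X) ^+ m.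
    by rewrite deriv_exp_trunc linearB /= linearZ /= comp_Xn_poly.
  rewrite /P derivM deriv_comp dE deriv_exp_trunc derivN derivX mulrN1.
  set u := e \Po _; set c := _^-1.
  exists (- c%:P * u + e * c%:P * (-1) ^+ m).
  rewrite -!mul_polyC (exprNn 'X); ring.
have P0 : P`_0 = 1.
  rewrite /P -horner_coef0 hornerM horner_comp hornerN hornerX oppr0 !horner_coef0.
  by rewrite exp_trunc0 mulr1.
have Pk k : (k < m.+1)%N -> P`_k = (k == 0%N)%:R.
  case: k => [|k] km; first by rewrite P0.
  move/(congr1 (fun p : {poly K} => p`_k)): PQ; rewrite coefXnM -ltnS km coef_deriv.
  by move/eqP; rewrite mulrn_eq0 /= => /eqP.
exists (drop_poly m.+1 (P - 1)).
have -> : 'X^(m.+1) * drop_poly m.+1 (P - 1) = P - 1.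
  rewrite -[RHS](poly_take_drop m.+1) [X in _ = X + _](_ : _ = 0) ?add0r 1?mulrC //.
  apply/polyP => k; rewrite coef_take_poly coef0; case: ifP => // km.
  by rewrite !coefB coef1 Pk // subrr.
by rewrite /P; ring.
Qed.

End ExpLog.

(** * Corresponding runs *)

Section Combinatorics.
Local Open Scope nat_scope.
Variables (n : nat) (T : BDtriple n).

(** The X-run of the indices [a, ..., a + m], counted from 0, corresponds to the
    Y-run [a', ..., a' + m], and gamma is decreasing on it if [d] holds. *)
Record corr (d : bool) (a a' m : nat) : Prop := Corr {
  corr_m : (0 < m)%N;
  corr_d : d -> (1 < m)%N;
  corr_n : (a + m < n)%N;
  corr_n' : (a' + m < n)%N;
  corr_a : ~~ Gam1 T a;
  corr_am : ~~ Gam1 T (a + m).+1;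
  corr_a' : ~~ Gam2 T a';
  corr_am' : ~~ Gam2 T (a' + m).+1;
  corr_Gam1 : forall k, (k < m)%N -> Gam1 T (a + k).+1;
  corr_gam : forall k, (k < m)%N ->
    gam T (a + k).+1 = if d then (a' + (m - k))%N else (a' + k).+1
}.

Lemma gam_inj a b : Gam1 T a -> Gam1 T b -> gam T a = gam T b -> a = b.
Proof. by move=> Ha Hb E; rewrite -(gamK Ha) E gamK. Qed.

Lemma gams_isometry a b : Gam2 T a -> Gam2 T b ->
  Defs.adjacent (gams T a) (gams T b) = Defs.adjacent a b.
Proof.
move=> Ha Hb.
by rewrite -(gam_isometry (gams_in Ha) (gams_in Hb)) !gamsK.
Qed.

Lemma Gam1_0 : ~~ Gam1 T 0.
Proof. by apply/negP => /Gam1_sub. Qed.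

Lemma Gam1_ge r : (n <= r)%N -> ~~ Gam1 T r.
Proof. by move=> nr; apply/negP => /Gam1_sub; lia. Qed.

Lemma Gam2_0 : ~~ Gam2 T 0.
Proof. by apply/negP => /Gam2_sub. Qed.

Lemma no_long_chain r : (0 < n)%N ->
  ~ (forall j, (j < n)%N -> Gam1 T (iter j (gam T) r)).
Proof.
move=> n0 H; pose s := [seq iter j (gam T) r | j <- iota 0 n].
have sz : size s = n by rewrite size_map size_iota.
have ss : {subset s <= iota 1 n.-1}.
  move=> x /mapP[j]; rewrite mem_iota => /andP[_ jn] ->.
  by have /Gam1_sub := H j jn; rewrite mem_iota; lia.
have : ~~ uniq s.
  by apply/negP => us; have := uniq_leq_size us ss; rewrite sz size_iota; lia.
case/(uniqPn 0) => i [j [ij]]; rewrite sz => jn.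
rewrite !(nth_map 0) ?size_iota ?nth_iota ?add0n //; try lia.
move=> E; set y := iter i (gam T) r.
have yp : iter (j - i) (gam T) y = y.
  by rewrite /y -iterD subnK ?E // ltnW.
have Hy t : (t < j - i)%N -> Gam1 T (iter t (gam T) y).
  by move=> tj; rewrite /y -iterD; apply: H; lia.
have [|k] := @gam_nilpotent _ T y; first by apply: (Hy 0%N); rewrite subn_gt0.
have -> : iter k (gam T) y = iter (k %% (j - i)) (gam T) y.
  rewrite [in LHS](divn_eq k (j - i)) addnC iterD; congr iter.
  by elim: (k %/ _)%N => // q IH; rewrite mulSn iterD IH.
by rewrite Hy // ltn_mod; lia.
Qed.

Lemma gams_nilpotent a : Gam2 T a -> exists m, ~~ Gam2 T (iter m (gams T) a).
Proof.
move=> Ga; apply: contrapT => H.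
have H2 k : Gam2 T (iter k (gams T) a).
  by apply: contrapT => /negP nk; apply: H; exists k.
have H1 k : Gam1 T (iter k.+1 (gams T) a) by exact: (gams_in (H2 k)).
apply: (@no_long_chain (iter n (gams T) a)); first by have := Gam2_sub Ga; lia.
move=> j jn; suff -> : iter j (gam T) (iter n (gams T) a) = iter (n - j).-1.+1 (gams T) a.
  exact: H1.
elim: j jn => [|j IH] jn; first by rewrite subn0 prednK //; lia.
rewrite iterS IH ?(ltnW jn) // iterS gamsK //.
by rewrite -subnS prednK //; lia.
Qed.

Definition op_triple : BDtriple n :=
  mkBDtriple (@Gam2_sub n T) (@Gam1_sub n T) (@gams_in n T) (@gam_in n T)
    (@gamsK n T) (@gamK n T) gams_isometry gams_nilpotent.

Fixpoint chain k r := if k is k'.+1 then Gam1 T r && chain k' (gam T r) else true.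

Lemma chain_empty r : 0 < n -> chain n r = false.
Proof.
move=> n0; apply/negP => H; apply: (no_long_chain n0 (r := r)).
suff K k r' : chain k r' -> forall j, (j < k)%N -> Gam1 T (iter j (gam T) r') by exact: K.
elim: k r' => // k IH r' /= /andP[G1 C] [|j] //= jk.
by rewrite -iterS iterSr; apply: IH.
Qed.

Lemma gam_line a m : (forall k, (k < m)%N -> Gam1 T (a + k)) ->
  (forall k, (k < m)%N -> gam T (a + k) = gam T a + k)%N \/
  ((1 < m)%N /\ forall k, (k < m)%N -> gam T (a + k) + k = gam T a)%N.
Proof.
move=> H.
have adj k : (k.+1 < m)%N ->
    (gam T (a + k.+1) = (gam T (a + k)).+1 \/ (gam T (a + k.+1)).+1 = gam T (a + k)).
  move=> km; have : Defs.adjacent (a + k) (a + k.+1) by rewrite /Defs.adjacent addnS eqxx.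
  rewrite -(gam_isometry (H k (ltnW km)) (H _ km)) /Defs.adjacent => /orP[/eqP<-|/eqP<-]; [by left|by right].
have inj k : (k.+2 < m)%N -> gam T (a + k.+2) <> gam T (a + k).
  move=> km E; have := gam_inj (H _ km) (H k _) E; lia.
case: (leqP m 1) => m1.
  left=> k km; have -> : k = 0%N by lia.
  by rewrite !addn0.
case: (adj 0%N m1); rewrite addn0 => E; [left|right; split=> //].
  suff Hk k : ((k < m)%N -> gam T (a + k) = gam T a + k)%N /\
      ((k.+1 < m)%N -> gam T (a + k.+1) = gam T a + k.+1)%N by move=> k; apply: (Hk k).1.
  elim: k => [|k [IH1 IH2]]; first by split=> _; rewrite ?addn0 // E addn1.
  split=> // km; have := IH1; have := IH2; have := adj _ km; have := inj k km; lia.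
suff Hk k : ((k < m)%N -> gam T (a + k) + k = gam T a)%N /\
    ((k.+1 < m)%N -> gam T (a + k.+1) + k.+1 = gam T a)%N by move=> k; apply: (Hk k).1.
elim: k => [|k [IH1 IH2]]; first by split=> _; rewrite ?addn0 // -E addn1.
split=> // km; have := IH1; have := IH2; have := adj _ km; have := inj k km; lia.
Qed.

Lemma maximal_line r : Gam1 T r -> exists a m,
  [/\ (a < r <= a + m)%N, (a + m < n)%N, ~~ Gam1 T a, ~~ Gam1 T (a + m).+1 &
    forall k, (k < m)%N -> Gam1 T (a + k).+1].
Proof.
move=> Gr.
have ex1 : exists j, ~~ Gam1 T (r - j) by exists r; rewrite subnn Gam1_0.
have ex2 : exists j, ~~ Gam1 T (r + j) by exists n; rewrite Gam1_ge // leq_addl.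
case: (ex_minnP ex1) => j1 Hj1 min1; case: (ex_minnP ex2) => j2 Hj2 min2.
have j10 : (0 < j1)%N by case: j1 Hj1 {min1}; rewrite ?subn0 ?Gr.
have j20 : (0 < j2)%N by case: j2 Hj2 {min2}; rewrite ?addn0 ?Gr.
have j1r : (j1 <= r)%N by apply: min1; rewrite subnn Gam1_0.
have Hk k : (r - j1 < k)%N -> (k < r + j2)%N -> Gam1 T k.
  move=> k1 k2; case: (leqP k r) => kr; apply: contrapT => /negP nk.
    by have := min1 (r - k)%N; rewrite subKn // => /(_ nk); lia.
  by have := min2 (k - r)%N; rewrite subnKC ?(ltnW kr) // => /(_ nk); lia.
exists (r - j1)%N, (j1 + j2).-1; split=> //; try lia.
- have := Gam1_sub (Hk (r + j2).-1 _ _); lia.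
- by have -> : (r - j1 + (j1 + j2).-1).+1 = (r + j2)%N by lia.
- by move=> k km; apply: Hk; lia.
Qed.

Lemma corr_exists r : Gam1 T r ->
  exists d a a' m, corr d a a' m /\ (a < r <= a + m)%N.
Proof.
move=> /maximal_line[a [m [arm amn Ga Gam Gk]]].
have m0 : (0 < m)%N by lia.
have Gk' k : (k < m)%N -> Gam1 T (a.+1 + k) by rewrite addSn; exact: Gk.
have m1m : (m.-1 < m)%N by rewrite prednK.
have G1 := Gk' 0%N m0; rewrite addn0 in G1.
have g2 k (km : (k < m)%N) := Gam2_sub (gam_in (Gk' k km)).
have adj x k : Gam2 T x -> (k < m)%N -> Defs.adjacent x (gam T (a.+1 + k)) ->
    [/\ Gam1 T (gams T x), gam T (gams T x) = x &
      gams T x = (a + k)%N \/ gams T x = (a + k).+2].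
  move=> Gx km; rewrite -{1}(gamsK Gx) (gam_isometry (gams_in Gx) (Gk' k km)).
  rewrite /Defs.adjacent => H; split; [exact: gams_in|exact: gamsK|lia].
case: (gam_line Gk') => [H|[m1 H]].
- exists false, a, (gam T a.+1).-1, m; split; last by [].
  have := g2 0%N m0; rewrite addn0 => g20.
  have := g2 m.-1 m1m; rewrite H // => gm'.
  split=> //; try lia.
  + apply/negP => Gx; have [|Gs Es] := adj _ 0%N Gx m0.
      by rewrite /Defs.adjacent addn0 prednK ?eqxx //; lia.
    move=> []; rewrite ?addn0 => Es2; first by move: Ga; rewrite -Es2 Gs.
    case: (leqP m 1) => m1.
      by move: Gam; rewrite (_ : (a + m).+1 = a.+2) -?Es2 ?Gs //; lia.
    move: Es (H 1%N m1); rewrite Es2 (_ : a.+2 = (a.+1 + 1)%N); last by lia.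
    lia.
  + apply/negP => Gx; have [|Gs Es] := adj _ m.-1 Gx m1m.
      by rewrite /Defs.adjacent H; lia.
    move=> [Es2|Es2]; last first.
      by move: Gam; rewrite (_ : (a + m).+1 = (a + m.-1).+2) -?Es2 ?Gs //; lia.
    case: (leqP m 1) => m1.
      by move: Ga; rewrite (_ : a = (a + m.-1)%N) -?Es2 ?Gs //; lia.
    have := H m.-2; move: Es; rewrite Es2 (_ : (a + m.-1)%N = (a.+1 + m.-2)%N); lia.
  + by move=> k km; rewrite -addSn H //; lia.
- exists true, a, (gam T a.+1 - m)%N, m; split; last by [].
  have := g2 0%N m0; rewrite addn0 => g20.
  have gm := H m.-1 m1m; have gm' := g2 m.-1 m1m.
  split=> //; try lia.
  + apply/negP => Gx; have [|Gs Es] := adj _ m.-1 Gx m1m.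
      by rewrite /Defs.adjacent; lia.
    move=> [Es2|Es2]; last first.
      by move: Gam; rewrite (_ : (a + m).+1 = (a + m.-1).+2) -?Es2 ?Gs //; lia.
    move: Es; rewrite Es2 (_ : (a + m.-1)%N = (a.+1 + m.-2)%N); last by lia.
    by have := H m.-2; lia.
  + apply/negP => Gx; have [|Gs Es] := adj _ 0%N Gx m0.
      by rewrite /Defs.adjacent addn0; lia.
    move=> []; rewrite ?addn0 => Es2; first by move: Ga; rewrite -Es2 Gs.
    move: Es; rewrite Es2 (_ : a.+2 = (a.+1 + 1)%N); last by lia.
    by have := H 1%N; lia.
  + by move=> k km; have := H _ km; rewrite addSn; lia.
Qed.

Lemma corr_op d a a' m : corr d a a' m ->
  (forall k, (k < m)%N -> Gam2 T (a' + k).+1 /\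
     gams T (a' + k).+1 = if d then (a + (m - k))%N else (a + k).+1).
Proof.
move=> c k km; have H j (jm : j < m) := And3 (corr_Gam1 c jm) (gam_in (corr_Gam1 c jm)) (corr_gam c jm).
case: d c H => c H.
  have [|G1 G2 E] := H (m - k).-1; first by have := corr_m c; lia.
  rewrite (_ : a' + (m - (m - k).-1) = (a' + k).+1)%N in E; last by lia.
  by rewrite -E; split=> //; rewrite gamK //; lia.
have [G1 G2 E] := H k km.
by rewrite -E; split=> //; rewrite gamK.
Qed.

Lemma corr_uniq d a a' m d0 a0 a0' m0 r :
  corr d a a' m -> corr d0 a0 a0' m0 -> (a < r <= a + m)%N -> (a0 < r <= a0 + m0)%N ->
  [/\ d = d0, a = a0, a' = a0' & m = m0].
Proof.
move=> c c0 ar a0r.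
have G1 x : (a < x <= a + m)%N -> Gam1 T x.
  by move=> ax; have := corr_Gam1 c (k := (x - a).-1); rewrite (_ : (a + (x - a).-1).+1 = x); [apply|]; lia.
have G2 x : (a0 < x <= a0 + m0)%N -> Gam1 T x.
  by move=> ax; have := corr_Gam1 c0 (k := (x - a0).-1); rewrite (_ : (a0 + (x - a0).-1).+1 = x); [apply|]; lia.
have E1 : a = a0.
  have := corr_a c; have := corr_a c0; case: (ltngtP a a0) => // aa.
    by rewrite G1 //; lia.
  by rewrite (G2 a) //; lia.
have E2 : m = m0.
  have := corr_am c; have := corr_am c0; case: (ltngtP m m0) => // aa.
    by rewrite (G2 (a + m).+1) //; lia.
  by rewrite (G1 (a0 + m0).+1) //; lia.
subst a0 m0; have m0 := corr_m c.
have := corr_gam c m0; have := corr_gam c0 m0.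
have m1 := corr_d c; have m1' := corr_d c0.
have := @corr_gam _ _ _ _ c 1%N; have := @corr_gam _ _ _ _ c0 1%N.
by case: d c m1 => c m1; case: d0 c0 m1' => c0 m1'; split=> //; lia.
Qed.

End Combinatorics.

Lemma corr_opP n (T : BDtriple n) d a a' m :
  corr T d a a' m -> corr (op_triple T) d a' a m.
Proof.
move=> c; have H := corr_op c; case: c => *.
by split=> //= k km; case: (H k km).
Qed.

Lemma corr_opK n (T : BDtriple n) d a a' m :
  corr (op_triple T) d a a' m -> corr T d a' a m.
Proof. by move=> /corr_opP[*]; split. Qed.

Lemma corr_uniq_img n (T : BDtriple n) d a a' m d0 a0 a0' m0 r :
  corr T d a a' m -> corr T d0 a0 a0' m0 ->
  (a' < r <= a' + m)%N -> (a0' < r <= a0' + m0)%N ->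
  [/\ d = d0, a = a0, a' = a0' & m = m0].
Proof.
move=> /corr_opP c /corr_opP c0 h h0.
by have [] := corr_uniq c c0 h h0.
Qed.

(** * The Lie algebra of the group D *)

Section W0.
Variables (R : realType) (m : nat).
Local Notation W := (w0 R m.+1).

Lemma w0E (p q : 'I_m.+1) : W p q = (-1) ^+ q * (p == rev_ord q)%:R.
Proof.
rewrite /w0 summxE (bigD1_seq q.+1) /=; first 1 last.
- by rewrite mem_index_iota; have := ltn_ord q; lia.
- exact: (iota_uniq 1 m.+1).
rewrite big1 ?addr0; last first.
  by move=> j /negbTE jq; rewrite !mxE (eq_sym q.+1) jq andbF mulr0.
by rewrite !mxE eqxx andbT /= eqSS -val_eqE.
Qed.

Lemma mulmx_w0 (M : 'M[R[i]]_m.+1) p q : (M *m W) p q = (-1) ^+ q * M p (rev_ord q).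
Proof.
rewrite mxE (bigD1 (rev_ord q)) //= w0E eqxx mulr1 big1 ?addr0 1?mulrC // => k /negbTE kq.
by rewrite w0E kq !mulr0.
Qed.

Lemma mul_w0_mx (M : 'M[R[i]]_m.+1) p q :
  (W *m M) p q = (-1) ^+ (rev_ord p) * M (rev_ord p) q.
Proof.
rewrite mxE (bigD1 (rev_ord p)) //= w0E rev_ordK eqxx mulr1 big1 ?addr0 // => k kp.
rewrite w0E (_ : (p == rev_ord k) = false) ?mulr0 ?mul0r //.
by apply: contraNF kp => /eqP ->; rewrite rev_ordK.
Qed.

Lemma w0_sq : W *m W = ((-1) ^+ m)%:M.
Proof.
apply/matrixP => p q; rewrite mul_w0_mx w0E mxE.
rewrite (inj_eq rev_ord_inj); case: (altP (p =P q)) => [->|]; last by rewrite !mulr0.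
by rewrite mulr1 -exprD /= subSS subnK // -ltnS.
Qed.

Lemma w0_unit : W \in unitmx.
Proof.
have := w0_sq; move/(congr1 (mulmx ((-1) ^+ m)%:M)); rewrite mulmxA -scalar_mxM.
by rewrite -expr2 sqrr_sign => /mulmx1_unit[].
Qed.

End W0.

Section Eij.
Variables (R : realType) (n : nat).

Lemma Eij_delta (x y : 'I_n) : Eij R n x.+1 y.+1 = delta_mx x y.
Proof. by apply/matrixP => i j; rewrite !mxE !eqSS !val_eqE. Qed.

Lemma EijM a b c d : (0 < b <= n)%N ->
  Eij R n a b *m Eij R n c d = (b == c)%:R *: Eij R n a d.
Proof.
move=> /andP[b0 bn]; have bn' : (b.-1 < n)%N by rewrite prednK.
apply/matrixP => i j; rewrite !mxE (bigD1 (Ordinal bn')) //= big1.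
  rewrite !mxE /= prednK // eqxx andbT addr0 -!natrM -!mulnb; congr (_%:R).
  by rewrite mulnCA mulnA.
move=> k kb; rewrite !mxE (_ : (k.+1 == b) = false) ?andbF ?mul0r //.
by apply: contraNF kb => /eqP kb; rewrite -val_eqE /= -kb.
Qed.

Lemma block_Eij m a x y (r s : 'I_m.+1) : (a + m < n)%N ->
  block m.+1 a.+1 (Eij R n x.+1 y.+1) r s = ((a + r == x)%N && (a + s == y)%N)%:R.
Proof.
move=> amn.
have lt (p : 'I_m.+1) : (a + p < n)%N.
  by apply: leq_ltn_trans amn; rewrite leq_add2l -ltnS.
by rewrite (@blockE _ _ _ _ _ r s (Ordinal (lt r)) (Ordinal (lt s))) // mxE /= !eqSS.
Qed.

Lemma upper_image_inc f a k : (0 < f a)%N -> (f a + k < n)%N ->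
  (forall t, (t <= k)%N -> f (a + t) = f a + t)%N ->
  upper_image R n f a k = Eij R n (f a) (f a + k).+1.
Proof.
elim: k a => [|k IH] a f0 fn H /=; first by rewrite addn0.
have fa1 : f a.+1 = (f a).+1 by rewrite -addn1 H // addn1.
rewrite IH; first 1 last.
- by rewrite fa1.
- by rewrite fa1 addSnnS.
- by move=> t tk; rewrite addSnnS H // fa1 addSnnS.
rewrite /lie fa1 addSnnS !EijM; try lia.
rewrite eqxx scale1r (_ : ((f a + k.+1).+1 == f a) = false) ?scale0r ?subr0 //.
by apply/negbTE; lia.
Qed.

Lemma upper_image_dec f a k : (k < f a < n)%N ->
  (forall t, (t <= k)%N -> f (a + t) + t = f a)%N ->
  upper_image R n f a k = (-1) ^+ k *: Eij R n (f a - k) (f a).+1.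
Proof.
elim: k a => [|k IH] a fn H /=; first by rewrite subn0 expr0 scale1r.
have fa1 : f a = (f a.+1).+1 by rewrite -(H 1%N) // !addn1.
rewrite IH; first 1 last.
- by lia.
- by move=> t tk; have := H t.+1; rewrite -(addSnnS a); lia.
rewrite /lie fa1 subSS -scalemxAr -scalemxAl !EijM; try lia.
rewrite eqxx scale1r (_ : ((f a.+1).+2 == _) = false); last by apply/negbTE; lia.
by rewrite scale0r scaler0 add0r exprS mulN1r scaleNr.
Qed.

Lemma lower_image_tr f a k : lower_image R n f a k = (upper_image R n f a k)^T.
Proof.
have trE x y : (Eij R n x y)^T = Eij R n y x by apply/matrixP => i j; rewrite !mxE andbC.
elim: k a => [|k IH] a /=; first by rewrite trE.
by rewrite /lie linearB /= !trmx_mul IH trE.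
Qed.

Lemma mxtrace_delta (Y : 'M[R[i]]_n) x y : \tr (Y *m delta_mx x y) = Y y x.
Proof.
rewrite /mxtrace (bigD1 y) //= mxE (bigD1 x) //= mxE !eqxx mulr1 big1 ?addr0.
  rewrite big1 ?addr0 // => k ky; rewrite mxE big1 // => l _.
  by rewrite mxE (negbTE ky) andbF mulr0.
by move=> k kx; rewrite mxE (negbTE kx) mulr0.
Qed.

Lemma mxtrace_delta_diag (i : 'I_n) : \tr (delta_mx i i : 'M[R[i]]_n) = 1.
Proof. by rewrite -[delta_mx i i]mul1mx mxtrace_delta mxE eqxx. Qed.

Lemma mxtrace_Eij (Y : 'M[R[i]]_n) (x y : 'I_n) : \tr (Y *m Eij R n x.+1 y.+1) = Y y x.
Proof. by rewrite Eij_delta mxtrace_delta. Qed.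

End Eij.

Section LieRelation.
Variables (R : realType) (n : nat) (T : BDtriple n).
Implicit Types X Y A B : 'M[R[i]]_n.

(** [(X, Y)] is in the Lie algebra of [D]. *)
Definition lie_rel X Y := [/\ upin (Gam1 T) X, loin (Gam2 T) Y &
  forall d a a' m, corr T d a a' m ->
    if d then block m.+1 a'.+1 Y *m w0 R m.+1 = - (w0 R m.+1 *m (block m.+1 a.+1 X)^T)
    else block m.+1 a'.+1 Y = block m.+1 a.+1 X].

Lemma lie_rel0 : lie_rel 0 0.
Proof.
split; [exact: upin0|by rewrite /loin trmx0; exact: upin0|].
by move=> [] a a' m _; rewrite !block0 ?trmx0 ?mul0mx ?mulmx0 ?oppr0.
Qed.

Lemma lie_relD X Y X' Y' : lie_rel X Y -> lie_rel X' Y' -> lie_rel (X + X') (Y + Y').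
Proof.
move=> [u l H] [u' l' H']; split; [exact: upinD|exact: loinD|].
move=> d a a' m c; have := H _ _ _ _ c; have := H' _ _ _ _ c.
case: d {c} => E E'; rewrite !blockD; last by rewrite E E'.
by rewrite linearD /= mulmxDl mulmxDr opprD E E'.
Qed.

Lemma lie_relZ k X Y : lie_rel X Y -> lie_rel (k *: X) (k *: Y).
Proof.
move=> [u l H]; split; [exact: upinZ|exact: loinZ|].
move=> d a a' m c; have := H _ _ _ _ c.
case: d {c} => E; rewrite !blockZ; last by rewrite E.
by rewrite linearZ /= -scalemxAl -scalemxAr E scalerN.
Qed.

Lemma lie_rel_sum (I : Type) (r : seq I) (P : pred I) (F G : I -> 'M[R[i]]_n) :
  (forall i, P i -> lie_rel (F i) (G i)) ->
  lie_rel (\sum_(i <- r | P i) F i) (\sum_(i <- r | P i) G i).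
Proof.
move=> H; elim: r => [|x r IH]; first by rewrite !big_nil; exact: lie_rel0.
by rewrite !big_cons; case Px: (P x) => //; apply: lie_relD => //; exact: H.
Qed.

Definition gamma_E (i j : 'I_n) : 'M[R[i]]_n :=
  if (i < j)%N && all (Gam1 T) (index_iota i.+1 j.+1)
  then upper_image R n (gam T) i.+1 (j - i).-1 else 0.

Lemma gamma_upE X : gamma_up T X = \sum_i \sum_j X i j *: gamma_E i j.
Proof.
rewrite /gamma_up; apply: eq_bigr => i _; rewrite big_mkcond; apply: eq_bigr => j _.
by rewrite /gamma_E; case: ifP => // _; rewrite scaler0.
Qed.

Lemma gamma_up_delta i j : gamma_up T (delta_mx i j) = gamma_E i j.
Proof.
rewrite gamma_upE (bigD1 i) //= (bigD1 j) //= mxE !eqxx scale1r.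
rewrite big1 ?addr0 => [|l /negbTE lj]; last by rewrite mxE lj andbF scale0r.
rewrite big1 ?addr0 // => k /negbTE ki; rewrite big1 // => l _.
by rewrite mxE ki scale0r.
Qed.

Lemma corr_interval d a a' m i j : corr T d a a' m -> (a <= i)%N -> (j <= a + m)%N ->
  all (Gam1 T) (index_iota i.+1 j.+1).
Proof.
move=> c ai jm; apply/allP => r; rewrite mem_index_iota => /andP[ir rj].
have := corr_Gam1 c (k := (r - a).-1).
by rewrite (_ : (a + (r - a).-1).+1 = r); [apply|]; lia.
Qed.

Lemma corr_exists_interval i j : (i < j)%N -> all (Gam1 T) (index_iota i.+1 j.+1) ->
  exists d a a' m, [/\ corr T d a a' m, (a <= i)%N & (j <= a + m)%N].
Proof.
move=> ij /allP H; have [|d [a [a' [m [c am]]]]] := @corr_exists _ T i.+1.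
  by apply: H; rewrite mem_index_iota; lia.
exists d, a, a', m; split=> //; first lia; rewrite leqNgt; apply: contra (corr_am c) => aj.
by apply: H; rewrite mem_index_iota; lia.
Qed.

Lemma gamma_E_corr d a a' m (p q : nat) (i j : 'I_n) : corr T d a a' m ->
  (p < q <= m)%N -> i = (a + p)%N :> nat -> j = (a + q)%N :> nat ->
  gamma_E i j = if d then (-1) ^+ (q - p).-1 *: Eij R n (a' + (m - q)).+1 (a' + (m - p)).+1
                else Eij R n (a' + p).+1 (a' + q).+1.
Proof.
move=> c pq ip jq; rewrite /gamma_E (@corr_interval d a a' m) //; try lia.
rewrite (_ : (i < j)%N) /=; last by lia.
have := corr_gam c (k := p); have := @corr_gam _ _ _ _ _ _ c.
have := corr_n' c; rewrite ip jq => cn.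
case: d c => c Hk Hp.
  have E0 : gam T (a + p).+1 = (a' + (m - p))%N by rewrite Hp; lia.
  rewrite upper_image_dec E0; first by congr (_ *: _); [congr (_ ^+ _)|congr (Eij _ _ _ _)]; lia.
    by lia.
  by move=> t tk; have := Hk (p + t)%N; rewrite addSn addnA; lia.
have E0 : gam T (a + p).+1 = (a' + p).+1 by rewrite Hp; lia.
rewrite upper_image_inc E0; first by congr (Eij _ _ _ _); lia.
- by lia.
- by lia.
- by move=> t tk; have := Hk (p + t)%N; rewrite addSn addnA; lia.
Qed.

Lemma gamma_E_strict (i j k l : 'I_n) : (l <= k)%N -> gamma_E i j k l = 0.
Proof.
move=> lk; case: (boolP ((i < j)%N && all (Gam1 T) (index_iota i.+1 j.+1))) => [/andP[ij H]|H];
  last by rewrite /gamma_E (negbTE H) mxE.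
have [d [a [a' [m [c ai jm]]]]] := corr_exists_interval ij H.
rewrite (@gamma_E_corr d a a' m (i - a) (j - a)) //; try lia.
case: d c => c; rewrite !mxE.
  by rewrite !eqSS (_ : (_ && _) = false) ?mulr0 //; apply/negbTE; lia.
by rewrite !eqSS (_ : (_ && _) = false) //; apply/negbTE; lia.
Qed.

Lemma lie_rel_gamma_E (i j : 'I_n) : (i < j)%N -> lie_rel (delta_mx i j) (gamma_E i j).
Proof.
move=> ij; split.
- apply: upper_upin => k l lk; rewrite mxE.
  by case: andP => // -[/eqP ki /eqP lj]; move: lk; rewrite ki lj; lia.
- case: (boolP ((i < j)%N && all (Gam1 T) (index_iota i.+1 j.+1))) => [/andP[_ H]|H];
    last by rewrite /gamma_E (negbTE H) /loin trmx0; exact: upin0.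
  have [d [a [a' [m [c ai jm]]]]] := corr_exists_interval ij H.
  rewrite (@gamma_E_corr d a a' m (i - a) (j - a)) //; try lia.
  have L x y : (a' <= x)%N -> (y <= a' + m)%N -> loin (Gam2 T) (Eij R n x.+1 y.+1).
    move=> ax ym; apply/loinP => r k l Gr kr rl; rewrite mxE !eqSS.
    case: andP => // -[/eqP kx /eqP ly]; case/negP: Gr.
    have [|+ _] := @corr_op _ _ _ _ _ _ c (r - a').-1; first lia.
    by rewrite (_ : (a' + (r - a').-1).+1 = r) //; lia.
  by case: d c => c; [apply: loinZ; apply: L|apply: L]; lia.
move=> d a a' m c.
have blkD (r s : 'I_m.+1) : block m.+1 a.+1 (delta_mx i j : 'M[R[i]]_n) r s =
    ((a + r == i)%N && (a + s == j)%N)%:R.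
  by rewrite -Eij_delta block_Eij // (corr_n c).
case: (boolP ((i < j)%N && all (Gam1 T) (index_iota i.+1 j.+1))) => [/andP[_ H]|H]; last first.
  rewrite /gamma_E (negbTE H) block0 mul0mx.
  have -> : block m.+1 a.+1 (delta_mx i j : 'M[R[i]]_n) = 0.
    apply/matrixP => r s; rewrite blkD mxE (_ : (_ && _) = false) //; apply/negbTE.
    apply: contra H => rs; rewrite ij (corr_interval c) //; first lia.
    by have := ltn_ord s; lia.
  by rewrite trmx0 mulmx0 oppr0; case: d c.
have [d0 [a0 [a0' [m0 [c0 ai jm]]]]] := corr_exists_interval ij H.
have E := @gamma_E_corr d0 a0 a0' m0 (i - a0) (j - a0) i j c0.
case: (boolP (a < i.+1 <= a + m)%N) => [im|im].
  have [|? ? ? ?] := corr_uniq c c0 im; first by lia.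
  subst d0 a0 a0' m0; rewrite {}E; try lia.
  case: d c {c0} => c; last first.
    apply/matrixP => r s; rewrite blkD block_Eij ?(corr_n' c) //.
    by congr (_%:R); congr (nat_of_bool _); lia.
  apply/matrixP => r s; rewrite blockZ -scalemxAl [LHS]mxE mulmx_w0 [RHS]mxE mul_w0_mx [trmx _ _ _]mxE blkD.
  rewrite block_Eij ?(corr_n' c) //=; have rm := ltn_ord r; have sm := ltn_ord s.
  have -> : ((a' + r == a' + (m - (j - a))) && (a' + (m.+1 - s.+1) == a' + (m - (i - a))))%N =
    ((a + s == i) && (a + (m.+1 - r.+1) == j))%N by lia.
  case: andP => [[si rj]|_]; last by rewrite !mulr0 oppr0.
  rewrite !mulr1 -exprD (_ : (m.+1 - r.+1 = ((j - a - (i - a)).-1 + s).+1)%N); last by lia.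
  by rewrite exprS mulN1r opprK.
have -> : block m.+1 a.+1 (delta_mx i j : 'M[R[i]]_n) = 0.
  apply/matrixP => r s; rewrite blkD mxE (_ : (_ && _) = false) //; apply/negbTE.
  by have := ltn_ord s; have := ltn_ord r; lia.
suff -> : block m.+1 a'.+1 (gamma_E i j) = 0.
  by rewrite mul0mx trmx0 mulmx0 oppr0; case: d c.
have Z x y : (x < y)%N -> (a0' <= x)%N -> (y <= a0' + m0)%N ->
    block m.+1 a'.+1 (Eij R n x.+1 y.+1) = 0.
  move=> xy ax ym; apply/matrixP => r s; rewrite block_Eij ?(corr_n' c) // mxE.
  case: andP => // -[/eqP rx /eqP sy].
  have [||_ ea _ em] := @corr_uniq_img _ T _ _ _ _ _ _ _ _ x.+1 c c0; try lia.
    by have := ltn_ord s; lia.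
rewrite {}E; try lia.
by case: d0 c0 => c0; rewrite ?blockZ Z ?scaler0 //; lia.
Qed.

Lemma lie_rel_gamma_up X : strict_upper X ->
  lie_rel X (gamma_up T X).
Proof.
move=> HX; rewrite gamma_upE {1}[X]matrix_sum_delta.
apply: lie_rel_sum => i _; apply: lie_rel_sum => j _.
case: (ltnP i j) => ij; first exact/lie_relZ/lie_rel_gamma_E.
by rewrite HX // !scale0r; exact: lie_rel0.
Qed.

Lemma gamma_up_strict X (i j : 'I_n) : (j <= i)%N -> gamma_up T X i j = 0.
Proof.
move=> ji; rewrite gamma_upE summxE big1 // => k _; rewrite summxE big1 // => l _.
by rewrite mxE gamma_E_strict ?mulr0.
Qed.

End LieRelation.

Section TruncatedExp.
Variable K : numFieldType.

Definition texp m N (X : 'M[K]_m) : 'M[K]_m := \sum_(k < N) (k`!%:R)^-1 *: X ^+ k.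

Lemma texpE m N (X : 'M[K]_m.+1) :
  texp N X = horner_mx X (\sum_(k < N) (k`!%:R)^-1 *: 'X^k).
Proof.
rewrite rmorph_sum /=; apply: eq_bigr => k _.
by rewrite horner_mxZ rmorphXn /= horner_mx_X.
Qed.

Lemma texp_opp m N (X : 'M[K]_m) : X ^+ N = 0 -> texp N X *m texp N (- X) = 1%:M.
Proof.
case: m X => [|m] X; first by move=> _; rewrite (flatmx0 (_ *m _)) -(flatmx0 1%:M).
case: N => [|N] XN; first by move/eqP: XN; rewrite expr0 oner_eq0.
have [Q E] := exp_mul_exp_opp K N.
have E1 : texp N.+1 X *m texp N.+1 (- X) = 1 :> 'M[K]_m.+1.
  move/(congr1 (horner_mx X)): E.
  rewrite rmorphM rmorphD rmorphM /= rmorph1 rmorphXn /= horner_mx_X XN mul0r addr0.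
  rewrite -texpE => <-; rewrite -mulmxE; congr (_ *m _).
  rewrite linear_sum rmorph_sum /=; apply: eq_bigr => k _.
  by rewrite linearZ /= comp_Xn_poly horner_mxZ rmorphXn rmorphN /= horner_mx_X.
exact: E1.
Qed.

Lemma texp_log m (X : 'M[K]_m) : X ^+ m = 0 ->
  texp m (\sum_(1 <= k < m) ((-1) ^+ k.-1 / k%:R) *: X ^+ k) = 1%:M + X.
Proof.
case: m X => [|m] X XN; first by apply/matrixP => -[].
have [Q E] := exp_comp_log K m.
suff : texp m.+1 (\sum_(1 <= k < m.+1) ((-1) ^+ k.-1 / k%:R) *: X ^+ k) = 1 + X by [].
move/(congr1 (horner_mx X)): E.
rewrite !rmorphD rmorphM /= rmorph1 rmorphXn /= horner_mx_X XN mul0r addr0 => <-.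
rewrite linear_sum rmorph_sum /=; apply: eq_bigr => k _.
rewrite linearZ /= comp_Xn_poly horner_mxZ rmorphXn /=; congr (_ *: (_ ^+ _)).
by rewrite rmorph_sum /=; apply: eq_bigr => j _; rewrite horner_mxZ rmorphXn /= horner_mx_X.
Qed.

Lemma texp_intertwine m N (W X Y : 'M[K]_m) :
  (forall k, Y ^+ k *m W = W *m (X ^+ k)^T) -> texp N Y *m W = W *m (texp N X)^T.
Proof.
move=> H; rewrite /texp mulmx_suml linear_sum mulmx_sumr; apply: eq_bigr => k _.
by rewrite -scalemxAl H linearZ /= -scalemxAr.
Qed.

End TruncatedExp.

Section UnipotentExp.
Variables (R : realType) (n : nat).
Implicit Types X V : 'M[R[i]]_n.

Lemma nilexpE X : nilexp X = texp n X. Proof. by []. Qed.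

Lemma nilexp_opp X : X ^+ n = 0 -> nilexp X *m nilexp (- X) = 1%:M.
Proof. exact: (@texp_opp R[i] n n X). Qed.

Lemma nilexp_unit X : X ^+ n = 0 -> nilexp X \in unitmx.
Proof. by move/nilexp_opp/mulmx1_unit => [uX _]; exact: uX. Qed.

Lemma unip_lower_sub1 V : unip_lower V ->
  forall i j : 'I_n, (i <= j)%N -> (V - 1%:M) i j = 0.
Proof.
move=> [lV dV] i j; rewrite leq_eqVlt => /orP[/eqP/val_inj<-|ij].
  by rewrite !mxE dV eqxx subrr.
by rewrite !mxE lV // -val_eqE ltn_eqF // subrr.
Qed.

Lemma nilexp_uniplog V : unip_lower V -> nilexp (uniplog V) = V.
Proof.
move=> uV; rewrite nilexpE -[RHS](subrK 1%:M) [RHS]addrC -(@texp_log R[i]) //.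
exact/strict_lower_nilpotent/unip_lower_sub1.
Qed.

Lemma strict_lower_exp X k : strict_lower X ->
  forall i j : 'I_n, (i <= j)%N -> (X ^+ k.+1) i j = 0.
Proof.
move=> H; elim: k => [|k IH] i j ij; first exact: H.
rewrite exprS -mulmxE mxE big1 // => l _; case: (leqP i l) => il; first by rewrite H ?mul0r.
by rewrite IH ?mulr0 // ltnW // (leq_trans il).
Qed.

Lemma uniplog_strict V : unip_lower V ->
  forall i j : 'I_n, (i <= j)%N -> uniplog V i j = 0.
Proof.
move=> uV i j ij; rewrite /uniplog summxE big_nat big1 // => -[|k] // _.
by rewrite mxE strict_lower_exp ?mulr0 //; exact: unip_lower_sub1.
Qed.

Lemma nilexp_unip_lower X : strict_lower X ->
  unip_lower (nilexp X).
Proof.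
move=> H; have E (i j : 'I_n) : (i <= j)%N -> nilexp X i j = (i == j)%:R.
  move=> ij; rewrite /nilexp -(big_mkord predT (fun k => (k`!%:R)^-1 *: X ^+ k)).
  rewrite big_ltn ?(leq_ltn_trans _ (ltn_ord i)) // mxE summxE big_nat big1 ?addr0.
    by rewrite expr0 mxE fact0 invr1 mul1r mxE.
  by move=> [|k] // _; rewrite mxE strict_lower_exp ?mulr0.
by split=> [i j ij|i]; rewrite E ?eqxx // 1?ltnW // -val_eqE ltn_eqF.
Qed.

Lemma upin_nilexp S X : upin S X -> upin S (nilexp X).
Proof. by move=> iX; apply: upin_sum => k _; apply: upinZ; exact: upinX. Qed.

Lemma loin_nilexp S X : loin S X -> loin S (nilexp X).
Proof. by move=> iX; apply: loin_sum => k _; apply: loinZ; exact: loinX. Qed.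

Lemma block_nilexp m a S X : (a + m < n)%N -> ~~ S a -> ~~ S (a + m).+1 ->
  upin S X \/ loin S X -> block m.+1 a.+1 (nilexp X) = texp n (block m.+1 a.+1 X).
Proof.
move=> amn Sa Sam iX; rewrite /nilexp block_sum; apply: eq_bigr => k _.
by rewrite blockZ (block_exp k amn Sa Sam iX).
Qed.

Lemma nilexp_tr X : (nilexp X)^T = nilexp X^T.
Proof.
rewrite /nilexp linear_sum; apply: eq_bigr => k _; by rewrite linearZ /= trmx_exp.
Qed.

Lemma nilexp_unip_upper X : strict_upper X ->
  unip_upper (nilexp X).
Proof.
move=> H; have [lX dX] : unip_lower (nilexp X^T).
  by apply: nilexp_unip_lower => i j ij; rewrite mxE H.
by rewrite -nilexp_tr in lX dX; split=> [i j ij|i]; [have := lX j i ij|have := dX i]; rewrite mxE.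
Qed.

End UnipotentExp.

Section OppositeRelation.
Variables (R : realType) (n : nat) (T : BDtriple n).
Implicit Types X Y A B : 'M[R[i]]_n.

Lemma w0_anti_swap m (A B : 'M[R[i]]_m.+1) :
  B *m w0 R m.+1 = - (w0 R m.+1 *m A^T) -> A^T *m w0 R m.+1 = - (w0 R m.+1 *m B).
Proof.
move=> E; have s0 : (-1) ^+ m != 0 :> R[i] by rewrite signr_eq0.
apply: (scalerI s0); rewrite scalerN -mul_scalar_mx -w0_sq -mulmxA.
have -> : w0 R m.+1 *m (A^T *m w0 R m.+1) = - (B *m w0 R m.+1 *m w0 R m.+1).
  by rewrite E mulNmx opprK mulmxA.
by rewrite -mulmxA w0_sq mul_mx_scalar mulmxN -scalemxAr.
Qed.

Lemma lie_rel_op X Y : lie_rel T X Y -> lie_rel (op_triple T) Y^T X^T.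
Proof.
move=> [u l H]; split; [exact: l|by rewrite /loin trmxK|].
move=> d a a' m /corr_opK c; have := H _ _ _ _ c.
case: d c => c; rewrite !block_tr => E; last by rewrite E.
rewrite trmxK; exact: w0_anti_swap.
Qed.

End OppositeRelation.

Section GammaLower.
Variables (R : realType) (n : nat) (T : BDtriple n).
Implicit Types X Y A B : 'M[R[i]]_n.

Lemma lie_rel_opK X Y : lie_rel (op_triple (op_triple T)) X Y -> lie_rel T X Y.
Proof.
by move=> [u l H]; split=> // d a a' m c; apply: H; apply: corr_opP; exact: corr_opP.
Qed.

Lemma gammas_lowE X : gammas_low T X = (gamma_up (op_triple T) X^T)^T.
Proof.
rewrite /gammas_low /gamma_up !linear_sum (exchange_big_dep predT) //=.
apply: eq_bigr => i _; rewrite linear_sum; apply: eq_bigr => j _.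
by rewrite linearZ /= lower_image_tr mxE.
Qed.

Lemma gammas_low_strict X (i j : 'I_n) : (i <= j)%N -> gammas_low T X i j = 0.
Proof. by move=> ij; rewrite gammas_lowE mxE gamma_up_strict. Qed.

Lemma lie_rel_gammas_low X : strict_lower X ->
  lie_rel T (gammas_low T X) X.
Proof.
move=> H; apply: lie_rel_opK; rewrite gammas_lowE -{2}[X]trmxK.
apply: lie_rel_op; apply: lie_rel_gamma_up => i j ji.
by rewrite mxE H.
Qed.

(** If along each pair of corresponding runs the vanishing of the entries of
    [B] forces that of the entries of [A], then the roots that [A] moves are
    pulled back by gamma. *)
Lemma upin_chain k A (B : bool -> 'M[R[i]]_n) : upin (Gam1 T) A ->
  (forall d a a' m, corr T d a a' m -> forall p q : 'I_m.+1,
     (if d then block m.+1 a'.+1 (B d) (rev_ord q) (rev_ord p)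
      else block m.+1 a'.+1 (B d) p q) = 0 -> block m.+1 a.+1 A p q = 0) ->
  (forall d, upin (chain T k) (B d)) -> upin (chain T k.+1) A.
Proof.
move=> uA H uB; apply/upinP => r i j Cr jr ri.
case: (boolP (all (Gam1 T) (index_iota j.+1 i.+1))) => [G|/uA]; last first.
  by apply; exact: leq_trans jr ri.
have [d [a [a' [m [c aj im]]]]] := corr_exists_interval (leq_trans jr ri) G.
have Gr : Gam1 T r by move/allP: G; apply; rewrite mem_index_iota; lia.
have nC : ~~ chain T k (gam T r) by move: Cr => /=; rewrite Gr.
have pm : (i - a < m.+1)%N by lia.
have qm : (j - a < m.+1)%N by lia.
have an' := corr_n' c.
have lt (p : 'I_m.+1) : (a' + p < n)%N by have := ltn_ord p; lia.
have := H _ _ _ _ c (Ordinal pm) (Ordinal qm).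
rewrite (@blockE _ _ _ a A (Ordinal pm) (Ordinal qm) i j) /=; try lia; apply.
have := corr_gam c (k := (r - a).-1).
rewrite (_ : (a + (r - a).-1).+1 = r); last by lia.
move=> E.
case: d c {H} E => c E.
  set p := rev_ord _; set q := rev_ord _.
  rewrite (@blockE _ _ _ a' _ p q (Ordinal (lt p)) (Ordinal (lt q))) //.
  by move/upinP: (uB true) => /(_ _ _ _ nC) -> //=; rewrite E; lia.
set p := Ordinal pm; set q := Ordinal qm.
rewrite (@blockE _ _ _ a' _ p q (Ordinal (lt p)) (Ordinal (lt q))) //.
by move/upinP: (uB false) => /(_ _ _ _ nC) -> //=; rewrite E; lia.
Qed.

Lemma lie_rel_chain k X Y : lie_rel T X Y -> upin (chain T k) Y -> upin (chain T k.+1) X.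
Proof.
move=> [u l H] uY; apply: (@upin_chain k X (fun=> Y)) => // d a a' m c p q.
have := H _ _ _ _ c; case: d {c} => E; last by rewrite E.
move/(congr1 (fun M : 'M[R[i]]_m.+1 => M (rev_ord q) p)): E.
rewrite mulmx_w0 [RHS]mxE mul_w0_mx [trmx _ _ _]mxE rev_ordK => + Y0.
rewrite Y0 mulr0 => /esym/eqP; rewrite oppr_eq0 mulf_eq0 signr_eq0 /=.
by move/eqP.
Qed.

End GammaLower.

Section Nilpotency.
Variables (R : realType) (n : nat) (T : BDtriple n).
Implicit Types X Y A B : 'M[R[i]]_n.

Lemma gamma_up_nilpotent X : strict_upper X ->
  iter n (gamma_up T) X = 0.
Proof.
move=> HX.
have Hs k (i j : 'I_n) : (j <= i)%N -> iter k (gamma_up T) X i j = 0.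
  by case: k => [|k] ji; [exact: HX|exact: gamma_up_strict].
have Hk k : upin (chain (op_triple T) k) (iter k (gamma_up T) X)^T.
  elim: k => [|k IH] /=; first by move=> i j ji; rewrite all_predT.
  apply: lie_rel_chain IH; apply: lie_rel_op; exact/lie_rel_gamma_up/Hs.
apply/matrixP => i j; rewrite [RHS]mxE; case: (leqP j i) => ij; first exact: Hs.
have /upinP/(_ j j i) := Hk n; rewrite mxE; apply => //.
by rewrite chain_empty // (leq_ltn_trans _ (ltn_ord i)).
Qed.

Lemma mxtrace_gamma_adj X Y : strict_upper X ->
  \tr (gamma_adj T Y *m X) = \tr (Y *m gamma_up T X).
Proof.
move=> HX; rewrite gamma_upE mulmx_sumr linear_sum /=.
have -> : \tr (gamma_adj T Y *m X) = \sum_i \sum_j gamma_adj T Y j i * X i j.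
  by rewrite exchange_big; apply: eq_bigr => i _; rewrite mxE.
apply: eq_bigr => i _; rewrite mulmx_sumr linear_sum; apply: eq_bigr => j _.
rewrite -scalemxAr linearZ /= mxE gamma_up_delta mulrC.
by case: ltnP => // ij; rewrite HX // !mul0r.
Qed.

Lemma gamma_adj_strict Y (i j : 'I_n) : (i <= j)%N -> gamma_adj T Y i j = 0.
Proof. by move=> ij; rewrite mxE ltnNge ij. Qed.

Lemma lie_rel_gamma_adj Y : strict_lower Y ->
  lie_rel T (gamma_adj T Y) Y.
Proof.
move=> HY; split.
- move=> i j ji H; rewrite mxE ji gamma_up_delta /gamma_E (negbTE H) andbF.
  by rewrite mulmx0 mxtrace0.
- by apply: lower_loin => i j /ltnW; exact: HY.
move=> d a a' m c.
have an' := corr_n' c; have an := corr_n c.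
have lt (p : 'I_m.+1) : (a + p < n)%N by have := ltn_ord p; lia.
have lt' (p : 'I_m.+1) : (a' + p < n)%N by have := ltn_ord p; lia.
case: d c => c.
  apply/matrixP => p q; rewrite mulmx_w0 [RHS]mxE mul_w0_mx [trmx _ _ _]mxE.
  rewrite (@blockE _ _ _ a' _ _ _ (Ordinal (lt' p)) (Ordinal (lt' (rev_ord q)))) //.
  rewrite (@blockE _ _ _ a _ _ _ (Ordinal (lt q)) (Ordinal (lt (rev_ord p)))) //.
  rewrite [gamma_adj _ _ _ _]mxE gamma_up_delta /=.
  have pm := ltn_ord p; have qm := ltn_ord q.
  case: ltnP => pq; last by rewrite HY ?mulr0 ?oppr0 //=; lia.
  rewrite (@gamma_E_corr _ _ _ _ _ _ _ (m - p) q _ _ c) /=; try lia.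
  rewrite -scalemxAr mxtraceZ (_ : (m - (m - p) = p)%N); last by lia.
  have -> : (m - q = rev_ord q)%N by [].
  rewrite (mxtrace_Eij _ (Ordinal (lt' (rev_ord q))) (Ordinal (lt' p))) mulrA -exprD.
  rewrite -mulNr -[in RHS]mulN1r -exprS; congr (_ * _).
  by congr (_ ^+ _); lia.
apply/matrixP => p q.
rewrite (@blockE _ _ _ a' _ _ _ (Ordinal (lt' p)) (Ordinal (lt' q))) //.
rewrite (@blockE _ _ _ a _ _ _ (Ordinal (lt p)) (Ordinal (lt q))) //.
rewrite [RHS]mxE gamma_up_delta /=.
have pm := ltn_ord p; have qm := ltn_ord q.
case: ltnP => pq; last by rewrite HY //=; lia.
rewrite (@gamma_E_corr _ _ _ _ _ _ _ q p _ _ c) /=; try lia.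
by rewrite (mxtrace_Eij _ (Ordinal (lt' q)) (Ordinal (lt' p))).
Qed.

Lemma mxtrace_iter_gamma_adj k X Y : strict_upper X ->
  \tr (iter k (gamma_adj T) Y *m X) = \tr (Y *m iter k (gamma_up T) X).
Proof.
elim: k X => // k IH X HX; rewrite iterS mxtrace_gamma_adj // IH ?iterSr //.
by move=> i j; exact: gamma_up_strict.
Qed.

Lemma gamma_adj_nilpotent Y : strict_lower Y ->
  iter n (gamma_adj T) Y = 0.
Proof.
move=> HY.
have Hs k (i j : 'I_n) : (i <= j)%N -> iter k (gamma_adj T) Y i j = 0.
  by case: k => [|k] ji /=; [exact: HY|exact: gamma_adj_strict].
apply/matrixP => i j; rewrite [RHS]mxE; case: (leqP i j) => ij; first exact: Hs.
rewrite -mxtrace_delta mxtrace_iter_gamma_adj.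
  rewrite gamma_up_nilpotent ?mulmx0 ?mxtrace0 // => k l lk; rewrite mxE.
  by case: andP => // -[/eqP kj /eqP li]; move: lk; rewrite kj li leqNgt ij.
move=> k l lk; rewrite mxE.
by case: andP => // -[/eqP kj /eqP li]; move: lk; rewrite kj li leqNgt ij.
Qed.

End Nilpotency.

Section RationalExp.
Variables (R : realType) (n : nat) (T : BDtriple n).
Implicit Types A : 'M[R[i]]_n -> 'M[R[i]]_n.

Lemma rational_mx_nilexp A : @rational_mx R[i] n A ->
  @rational_mx R[i] n (fun U => nilexp (A U)).
Proof.
move=> rA; apply: rational_mx_sum => k _; apply: rational_mx_cscale.
exact: rational_mx_exp.
Qed.

Lemma rational_mx_uniplog A : @rational_mx R[i] n A ->
  @rational_mx R[i] n (fun U => uniplog (A U)).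
Proof.
move=> rA; apply: rational_mx_sum => k _; apply: rational_mx_cscale.
apply: rational_mx_exp; apply: rational_mx_add rA _.
exact: rational_mx_const.
Qed.

Lemma rational_mx_gammas_low A : @rational_mx R[i] n A ->
  @rational_mx R[i] n (fun U => gammas_low T (A U)).
Proof.
move=> rA; apply: rational_mx_sum => k _; apply: rational_mx_sum => j _.
by apply: rational_mx_scale; [exact: rA|exact: rational_mx_const].
Qed.

Lemma uniplog1 : uniplog 1%:M = 0 :> 'M[R[i]]_n.
Proof.
rewrite /uniplog big_nat big1 // => -[|k] // _.
by rewrite subrr expr0n scaler0.
Qed.

Lemma gammas_low0 : gammas_low T 0 = 0 :> 'M[R[i]]_n.
Proof.
rewrite /gammas_low big1 // => i _; rewrite big1 // => j _.
by rewrite mxE scale0r.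
Qed.

Lemma unip_lower1 : unip_lower (1%:M : 'M[R[i]]_n).
Proof. by split=> [i j ij|i]; rewrite mxE ?eqxx // -val_eqE ltn_eqF. Qed.

End RationalExp.

(* Otherwise unification unfolds distinct exponentials before failing. *)
Opaque nilexp texp.

(** * The group D up to scalars *)

Definition scalars (R : realType) := bool -> nat -> nat -> nat -> R[i].

Section GroupRelation.
Variables (R : realType) (n : nat) (T : BDtriple n).
Implicit Types (X Y A B L U : 'M[R[i]]_n) (c : scalars R).

(** The group [D], except that the blocks over corresponding runs only have to
    correspond up to a scalar, given by [c]. The torus generated by the diagonal
    part of [R_+] needs these scalars. *)
Definition group_rel c A B := [/\ A \in unitmx, B \in unitmx,
  upin (Gam1 T) A, loin (Gam2 T) B &
  forall d a a' m, corr T d a a' m ->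
    if d then block m.+1 a'.+1 B *m w0 R m.+1 *m (block m.+1 a.+1 A)^T =
              c d a a' m *: w0 R m.+1
    else block m.+1 a'.+1 B = c d a a' m *: block m.+1 a.+1 A].

Definition nz_scalars c := forall d a a' m, c d a a' m != 0.

Definition cst1 : scalars R := fun _ _ _ _ => 1.

Definition mul_scalars c c' : scalars R :=
  fun d a a' m => c d a a' m * c' d a a' m.

Definition inv_scalars c : scalars R :=
  fun d a a' m => (c d a a' m)^-1.

Lemma corr_blockM1 d a a' m A B : corr T d a a' m -> upin (Gam1 T) A -> upin (Gam1 T) B ->
  block m.+1 a.+1 (A *m B) = block m.+1 a.+1 A *m block m.+1 a.+1 B.
Proof. by case=> *; apply: (@block_mul _ _ _ _ (Gam1 T)) => //; left. Qed.

Lemma corr_blockM2 d a a' m A B : corr T d a a' m -> loin (Gam2 T) A -> loin (Gam2 T) B ->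
  block m.+1 a'.+1 (A *m B) = block m.+1 a'.+1 A *m block m.+1 a'.+1 B.
Proof. by case=> *; apply: (@block_mul _ _ _ _ (Gam2 T)) => //; right. Qed.

Lemma corr_blockV1 d a a' m A : corr T d a a' m -> upin (Gam1 T) A -> A \in unitmx ->
  block m.+1 a.+1 A \in unitmx /\ block m.+1 a.+1 (invmx A) = invmx (block m.+1 a.+1 A).
Proof. by case=> *; apply: (@block_inv _ _ _ _ (Gam1 T)) => //; left. Qed.

Lemma corr_blockV2 d a a' m A : corr T d a a' m -> loin (Gam2 T) A -> A \in unitmx ->
  block m.+1 a'.+1 A \in unitmx /\ block m.+1 a'.+1 (invmx A) = invmx (block m.+1 a'.+1 A).
Proof. by case=> *; apply: (@block_inv _ _ _ _ (Gam2 T)) => //; right. Qed.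

Lemma group_relM c c' A B A' B' : group_rel c A B -> group_rel c' A' B' ->
  group_rel (mul_scalars c c') (A *m A') (B *m B').
Proof.
move=> [uA uB iA iB H] [uA' uB' iA' iB' H'].
split; rewrite ?unitmx_mul ?uA ?uB //; [exact: upinM|exact: loinM|].
move=> d a a' m r; have := H _ _ _ _ r; have := H' _ _ _ _ r.
case: d r => r E' E; rewrite (corr_blockM1 r) // (corr_blockM2 r) // /mul_scalars.
  set b := block _ _ B; set b' := block _ _ B'; set x := block _ _ A; set x' := block _ _ A'.
  have -> : b *m b' *m w0 R m.+1 *m (x *m x')^T = b *m (b' *m w0 R m.+1 *m x'^T) *m x^T.
    by rewrite trmx_mul !mulmxA.
  by rewrite E' -scalemxAr -scalemxAl E scalerA mulrC.
by rewrite E E' -scalemxAl -scalemxAr scalerA.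
Qed.

Lemma group_relV c A B : nz_scalars c -> group_rel c A B ->
  group_rel (inv_scalars c) (invmx A) (invmx B).
Proof.
move=> c0 [uA uB iA iB H]; split; rewrite ?unitmx_inv //; [exact: upinV|exact: loinV|].
move=> d a a' m r; have := H _ _ _ _ r.
have [ubA EA] := corr_blockV1 r iA uA; have [ubB EB] := corr_blockV2 r iB uB.
rewrite /inv_scalars EA EB.
case: d r => r E; last first.
  by rewrite E invmxZ; [exact: erefl|rewrite -E].
have E2 : w0 R m.+1 *m (block m.+1 a.+1 A)^T = c true a a' m *: (invmx (block m.+1 a'.+1 B) *m w0 R m.+1).
  by rewrite scalemxAr -E -mulmxA mulKmx.
apply: (scalerI (c0 true a a' m)).
rewrite scalerA (mulfV (c0 _ _ _ _)) scale1r scalemxAl -E2 -mulmxA -trmx_mul mulVmx // trmx1.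
by rewrite mulmx1.
Qed.

Lemma group_rel_nilexp X Y : X ^+ n = 0 -> Y ^+ n = 0 -> lie_rel T X Y ->
  group_rel cst1 (nilexp X) (nilexp Y).
Proof.
move=> Xn Yn [iX iY H]; split; [exact: nilexp_unit|exact: nilexp_unit| | |].
- exact: upin_nilexp.
- exact: loin_nilexp.
move=> d a a' m c; have := H _ _ _ _ c; rewrite /cst1 !scale1r.
have EX : block m.+1 a.+1 (nilexp X) = texp n (block m.+1 a.+1 X).
  by case: c => *; apply: (@block_nilexp _ _ _ _ (Gam1 T)) => //; left.
have EY : block m.+1 a'.+1 (nilexp Y) = texp n (block m.+1 a'.+1 Y).
  by case: c => *; apply: (@block_nilexp _ _ _ _ (Gam2 T)) => //; right.
have xn : (block m.+1 a.+1 X) ^+ n = 0.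
  rewrite -(@block_exp _ _ _ _ (Gam1 T)) ?Xn ?block0 //; try by case: c.
  by left.
rewrite EX EY; case: d {c} => E; last by rewrite E; exact: erefl.
set x := block m.+1 a.+1 X in E xn *; set y := block m.+1 a'.+1 Y in E *.
have yW k : y ^+ k *m w0 R m.+1 = w0 R m.+1 *m ((- x) ^+ k)^T.
  elim: k => [|k IH]; first by rewrite !expr0 tr_scalar_mx mulmx1 mul1mx.
  rewrite exprS -mulmxE -mulmxA IH mulmxA E exprSr -mulmxE trmx_mul mulmxA.
  by congr (_ *m _); rewrite linearN mulmxN.
rewrite (@texp_intertwine R[i] m.+1 n _ (- x) y yW).
by rewrite -mulmxA -trmx_mul (@texp_opp R[i] _ n x xn) trmx1 mulmx1.
Qed.

Lemma group_rel_tgammas L : unip_lower L -> group_rel cst1 (tgammas T L) L.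
Proof.
move=> uL; rewrite -[L in group_rel _ _ L](nilexp_uniplog uL).
apply: group_rel_nilexp.
- by apply: strict_lower_nilpotent => i j; exact: gammas_low_strict.
- by apply: strict_lower_nilpotent; exact: uniplog_strict.
- by apply: lie_rel_gammas_low; exact: uniplog_strict.
Qed.

Lemma tgammas_unip L : unip_lower L -> unip_lower (tgammas T L).
Proof. by move=> uL; apply: nilexp_unip_lower => i j; exact: gammas_low_strict. Qed.

Lemma rational_mx_tgammas (A : 'M[R[i]]_n -> 'M[R[i]]_n) : @rational_mx R[i] n A ->
  @rational_mx R[i] n (fun U => tgammas T (A U)).
Proof. by move=> rA; exact/rational_mx_nilexp/rational_mx_gammas_low/rational_mx_uniplog. Qed.

Lemma tgammas1 : tgammas T 1%:M = 1%:M :> 'M[R[i]]_n.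
Proof.
rewrite /tgammas uniplog1 gammas_low0 -{1}(uniplog1 R n) nilexp_uniplog //.
exact: unip_lower1.
Qed.

Lemma tgammas_op L : (tgammas T L)^T = tgamma (op_triple T) L^T.
Proof.
rewrite /tgammas /tgamma nilexp_tr gammas_lowE trmxK; congr (nilexp (gamma_up _ _)).
rewrite /uniplog linear_sum; apply: eq_bigr => k _; by rewrite linearZ /= trmx_exp linearB /= tr_scalar_mx.
Qed.

Opaque tgammas.

Lemma group_rel_entry c A B d a a' m (p q : 'I_m.+1) : group_rel c A B -> corr T d a a' m ->
  if d then (-1) ^+ (rev_ord p) * block m.+1 a.+1 A q (rev_ord p) =
    c d a a' m * ((-1) ^+ q * block m.+1 a'.+1 (invmx B) p (rev_ord q))
  else block m.+1 a'.+1 B p q = c d a a' m * block m.+1 a.+1 A p q.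
Proof.
move=> [uA uB iA iB H] r; have := H _ _ _ _ r.
case: d r => r; last by move=> ->; rewrite [LHS]mxE.
have [ubB ->] := corr_blockV2 r iB uB.
move=> E; have : w0 R m.+1 *m (block m.+1 a.+1 A)^T =
    c true a a' m *: (invmx (block m.+1 a'.+1 B) *m w0 R m.+1).
  by rewrite scalemxAr -E -mulmxA mulKmx.
move/(congr1 (fun M : 'M[R[i]]_m.+1 => M p q)).
by rewrite mul_w0_mx [trmx _ _ _]mxE [RHS]mxE mulmx_w0.
Qed.

Lemma group_rel_chain k c A B : nz_scalars c -> group_rel c A B ->
  upin (chain T k) B -> upin (chain T k.+1) A.
Proof.
move=> c0 G uB; have [_ _ iA _ _] := G.
apply: (@upin_chain _ _ _ k A (fun d => if d then invmx B else B)) => //; last first.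
  by case=> //; exact: upinV.
move=> d a a' m r p q; case: d r => r /= Z.
  have := group_rel_entry (rev_ord q) p G r; rewrite Z rev_ordK !mulr0.
  by move/eqP; rewrite mulf_eq0 signr_eq0 => /eqP.
have := group_rel_entry p q G r; rewrite Z => /esym/eqP.
by rewrite mulf_eq0 (negbTE (c0 _ _ _ _)) => /eqP.
Qed.

(** [B * L] is the value of [F] at [U], with its factorization. *)
Definition solves U B L :=
  [/\ upper_tri B, unip_lower L & B *m L = tgammas T L *m U].

Lemma unip_lower_unit L : unip_lower L -> L \in unitmx.
Proof.
move=> [lL dL]; rewrite unitmxE det_trig; first by rewrite big1 ?unitr1.
exact/is_trig_mxP.
Qed.

Lemma solves_rel c g' g U B L B' L' : nz_scalars c -> group_rel c g' g -> U \in unitmx ->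
  solves U B L -> solves (g' *m U *m invmx g) B' L' ->
  exists A b, [/\ group_rel c A b, upper_tri A, upper_tri b, B' *m b = A *m B &
    forall r, trailing_minor r A =
       trailing_minor r (tgammas T L' *m g' *m invmx (tgammas T L)) /\
      trailing_minor r b = trailing_minor r (L' *m g *m invmx L)].
Proof.
move=> c0 G uU [uB uL E] [uB' uL' E'].
pose t := tgammas T L; pose t' := tgammas T L'.
have ut : t \in unitmx by exact/unip_lower_unit/tgammas_unip.
have ut' : t' \in unitmx by exact/unip_lower_unit/tgammas_unip.
have uuL := unip_lower_unit uL; have uuL' := unip_lower_unit uL'.
have [ug' ug _ _ _] := G.
pose A := t' *m g' *m invmx t; pose b := L' *m g *m invmx L.
have GA : group_rel c A b.
  have G1 := group_relM (group_relM (group_rel_tgammas uL') G)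
    (group_relV (fun _ _ _ _ => oner_neq0 _) (group_rel_tgammas uL)).
  have E1 : mul_scalars (mul_scalars cst1 c) (inv_scalars cst1) = c.
    apply/funext => d; apply/funext => a; apply/funext => a'; apply/funext => m.
    by rewrite /mul_scalars /inv_scalars /cst1 mul1r invr1 mulr1.
  by rewrite E1 in G1.
have BE : B' *m b = A *m B by exact: (conj_factor ut ug uuL E E').
have uB'' : B' \in unitmx.
  have : B' *m L' \in unitmx by rewrite E' !unitmx_mul ut' ug' uU unitmx_inv.
  by rewrite unitmx_mul => /andP[].
have uBB : B \in unitmx.
  have : B *m L \in unitmx by rewrite E unitmx_mul ut.
  by rewrite unitmx_mul => /andP[].
have bE : b = invmx B' *m A *m B by rewrite -mulmxA -BE mulKmx.
have Hb k : upin (chain T k) b.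
  elim: k => [|k IH]; first by move=> i j ji; rewrite all_predT.
  rewrite bE; apply: upinM; [apply: upinM|]; last exact: upper_upin.
    by apply: upinV; exact: upper_upin.
  exact: group_rel_chain GA IH.
have HA k : upin (chain T k.+1) A by exact: group_rel_chain GA (Hb k).
exists A, b; split=> // i j ji.
  have /upinP/(_ i i j) := HA n; apply=> //=.
  by rewrite chain_empty ?andbF // (leq_ltn_trans _ (ltn_ord i)).
have /upinP/(_ i i j) := Hb n; apply=> //=.
by rewrite chain_empty ?andbF // (leq_ltn_trans _ (ltn_ord i)).
Qed.

End GroupRelation.

Section Strings.
Variables (R : realType) (n : nat) (T : BDtriple n).
Implicit Types (A B b L U g : 'M[R[i]]_n) (c : scalars R).

Definition diag_entry A (x : nat) : R[i] :=
  if insub x is Some i then A i i else 1.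

Lemma diag_entryE A (i : 'I_n) : diag_entry A i = A i i.
Proof. by rewrite /diag_entry valK. Qed.

Lemma trailing_minor_diag r A : (upper_tri A \/ lower_tri A) -> (r <= n)%N ->
  trailing_minor r A = \prod_(r <= x < n) diag_entry A x.
Proof.
move=> H rn; rewrite trailing_minor_tri; last by case: H => H; [left|right].
rewrite (eq_bigr (fun i : 'I_n => diag_entry A i)); last by move=> i _; rewrite diag_entryE.
rewrite -(big_mkord (fun x => r <= x)%N (diag_entry A)).
by rewrite (big_nat_widenl r 0).
Qed.

Lemma block_diag m a A (p : 'I_m.+1) : (a + m < n)%N ->
  block m.+1 a.+1 A p p = diag_entry A (a + p).
Proof.
move=> amn; have lt : (a + p < n)%N by have := ltn_ord p; lia.
by rewrite (@blockE _ _ _ _ A p p (Ordinal lt) (Ordinal lt)) // -diag_entryE.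
Qed.

Lemma invmx_upper_diag A (i : 'I_n) : A \in unitmx -> upper_tri A ->
  A i i * invmx A i i = 1.
Proof.
move=> uA tA; have tV : upper_tri (invmx A).
  by apply/upin_pred0/upinV/upin_pred0.
have := congr1 (fun M : 'M[R[i]]_n => M i i) (mulmxV uA); rewrite !mxE eqxx (bigD1 i) //=.
rewrite big1 ?addr0 // => k; rewrite -val_eqE neq_ltn => /orP[ki|ik].
  by rewrite tA ?mul0r.
by rewrite tV ?mulr0.
Qed.

Lemma group_rel_diag c A b d a a' m k : group_rel T c A b -> upper_tri A -> upper_tri b ->
  corr T d a a' m -> (k <= m)%N ->
  if d then diag_entry b (a' + (m - k)) * diag_entry A (a + k) = c d a a' m
  else diag_entry b (a' + k) = c d a a' m * diag_entry A (a + k).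
Proof.
move=> G tA tb r km; pose p : 'I_m.+1 := Ordinal (km : (k < m.+1)%N).
have [uA ub _ _ _] := G; have an := corr_n r; have an' := corr_n' r.
case: d r => r.
  have := group_rel_entry (rev_ord p) p G r; rewrite rev_ordK !block_diag //= subSS.
  have lt : (a' + (m - k) < n)%N by lia.
  have V := invmx_upper_diag (Ordinal lt) ub tb.
  rewrite -!diag_entryE /= in V.
  have s0 : (-1) ^+ k != 0 :> R[i] by rewrite signr_eq0.
  rewrite mulrCA => /(mulfI s0) ->.
  by rewrite mulrCA V mulr1.
have := group_rel_entry p p G r.
by rewrite !block_diag.
Qed.

Lemma big_nat_shift (F : nat -> R[i]) a x y :
  \prod_(a + x <= i < a + y) F i = \prod_(x <= i < y) F (a + i)%N.
Proof. by rewrite addnC big_addn addKn; apply: eq_bigr => i _; rewrite addnC. Qed.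

Lemma big_nat_reflect (F : nat -> R[i]) a m k : (k <= m)%N ->
  \prod_(a + (m - k) <= i < (a + m).+1) F i = \prod_(0 <= i < k.+1) F (a + (m - i))%N.
Proof.
move=> km; rewrite -addnS big_nat_shift [RHS]big_nat_rev add0n.
rewrite -{1}[(m - k)%N]add0n big_addn subSn ?leq_subr // subKn //.
by rewrite big_nat [RHS]big_nat; apply: eq_bigr => i ik; congr (F _); lia.
Qed.

Lemma trailing_minor_gam r : Gam1 T r -> exists r1 r2, [/\ ~~ Gam1 T r1, ~~ Gam2 T r2 &
  forall c, nz_scalars c -> exists k, [/\ k != 0, c = cst1 R -> k = 1 &
    forall A b, group_rel T c A b -> upper_tri A -> upper_tri b ->
    k * trailing_minor r A * trailing_minor r2 b =
    trailing_minor (gam T r) b * trailing_minor r1 A]].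
Proof.
move=> Gr; have [d [a [a' [m [cr arm]]]]] := corr_exists Gr.
have an := corr_n cr; have an' := corr_n' cr.
have Er := corr_gam cr (k := (r - a).-1).
rewrite (_ : (a + (r - a).-1).+1 = r) in Er; last by lia.
have {}Er := Er (_ : _ < _)%N.
pose k := (r - a).-1; have rE : r = (a + k.+1)%N by lia.
have km : (k < m)%N by lia.
have {}Er : gam T r = if d then (a' + (m - k))%N else (a' + k.+1)%N.
  by rewrite Er; [case: (d); rewrite ?addnS|lia].
case: d cr Er => cr ->.
  exists a, (a' + m).+1; split; [exact: corr_a cr|exact: corr_am' cr|].
  move=> c c0; exists (c true a a' m ^+ k.+1); split.
  - by rewrite expf_neq0.
  - by move=> ->; rewrite /cst1 expr1n.
  move=> A b G tA tb.
  rewrite !trailing_minor_diag; try lia; try by left.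
  rewrite rE.
  rewrite (big_cat_nat (n := (a' + m).+1) (m := (a' + (m - k))%N)) //=; try lia.
  rewrite (big_cat_nat (n := (a + k.+1)%N) (m := a)) //=; try lia.
  rewrite (big_cat_nat (n := (a + m.+1)%N) (m := (a + k.+1)%N)) //=; try lia.
  have E : (\prod_(a' + (m - k) <= i < (a' + m).+1) diag_entry b i) *
      (\prod_(a <= i < a + k.+1) diag_entry A i) = c true a a' m ^+ k.+1.
    rewrite big_nat_reflect ?(ltnW km) // -{1}[a]addn0 big_nat_shift -big_split /=.
    rewrite big_nat (eq_bigr (fun=> c true a a' m)); last first.
      by move=> i /andP[_ ik]; rewrite (group_rel_diag G tA tb cr) //; lia.
    by rewrite -big_nat prodr_const_nat subn0.
  by rewrite -E; ring.
exists (a + m).+1, (a' + m).+1; split; [exact: corr_am cr|exact: corr_am' cr|].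
move=> c c0; exists (c false a a' m ^+ (m - k)); split.
- by rewrite expf_neq0.
- by move=> ->; rewrite /cst1 expr1n.
move=> A b G tA tb.
rewrite !trailing_minor_diag; try lia; try by left.
rewrite rE (big_cat_nat (n := (a + m).+1) (m := (a + k.+1)%N)) //=; try lia.
rewrite (big_cat_nat (n := (a' + m).+1) (m := (a' + k.+1)%N)) //=; try lia.
have E : \prod_(a' + k.+1 <= i < (a' + m).+1) diag_entry b i =
    c false a a' m ^+ (m - k) * \prod_(a + k.+1 <= i < (a + m).+1) diag_entry A i.
  rewrite -!addnS !big_nat_shift -[(m - k)%N]subSS -prodr_const_nat -big_split /=.
  rewrite big_nat [RHS]big_nat; apply: eq_bigr => i /andP[_ im].
  by rewrite (group_rel_diag G tA tb cr) //.
by rewrite E; ring.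
Qed.

Lemma string_minors a0 s : is_string (Gam1 T) (gam T) a0 s -> ~~ Gam2 T a0 ->
  exists rs : seq (nat * nat), [/\ forall r, r \in rs -> ~~ Gam1 T r.1 /\ ~~ Gam2 T r.2 &
  forall c, nz_scalars c -> exists k, [/\ k != 0, c = cst1 R -> k = 1 &
    forall A b, group_rel T c A b -> upper_tri A -> upper_tri b ->
    k * (\prod_(a <- a0 :: s) trailing_minor a A) * \prod_(r <- rs) trailing_minor r.2 b =
    (\prod_(a <- a0 :: s) trailing_minor a b) * \prod_(r <- rs) trailing_minor r.1 A]].
Proof.
move=> /andP[pth nl] na0.
suff [rs [Hrs H]] : exists rs : seq (nat * nat),
  [/\ forall r, r \in rs -> ~~ Gam1 T r.1 /\ ~~ Gam2 T r.2 &
  forall c, nz_scalars c -> exists k, [/\ k != 0, c = cst1 R -> k = 1 &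
    forall A b, group_rel T c A b -> upper_tri A -> upper_tri b ->
    k * (\prod_(a <- a0 :: s) trailing_minor a A) * \prod_(r <- rs) trailing_minor r.2 b =
    (\prod_(a <- s) trailing_minor a b) * \prod_(r <- rs) trailing_minor r.1 A *
    trailing_minor (last a0 s) A]].
  exists ((last a0 s, a0) :: rs); split.
    by move=> r; rewrite inE => /orP[/eqP->|/Hrs].
  move=> c c0; have [k [k0 k1 Hk]] := H c c0; exists k; split=> // A b G tA tb.
  have := Hk A b G tA tb; rewrite !big_cons /= => E.
  rewrite [k * _ * _](_ : _ = k * (trailing_minor a0 A * \prod_(j <- s) trailing_minor j A) *
    (\prod_(j <- rs) trailing_minor j.2 b) * trailing_minor a0 b); last by ring.
  by rewrite E; ring.
elim: s a0 {na0} pth nl => [|a1 s IH] a0 /=.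
  move=> _ _; exists [::]; split=> // c c0; exists 1; split; rewrite ?oner_neq0 // => A b *.
  by rewrite !big_cons !big_nil; ring.
move=> /andP[/andP[G0 /eqP ->] pth] nl.
have [rs [Hrs H]] := IH _ pth nl.
have [r1 [r2 [nr1 nr2 H0]]] := trailing_minor_gam G0.
exists ((r1, r2) :: rs); split.
  by move=> r; rewrite inE => /orP[/eqP->|/Hrs].
move=> c c0; have [k [k0 k1 Hk]] := H c c0; have [k' [k0' k1' Hk']] := H0 c c0.
exists (k * k'); split; first exact: mulf_neq0.
  by move=> c1; rewrite k1 // k1' // mulr1.
move=> A b G tA tb; have E := Hk A b G tA tb; have E' := Hk' A b G tA tb.
rewrite !big_cons /= in E *.
rewrite [LHS](_ : _ = (k' * trailing_minor a0 A * trailing_minor r2 b) *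
  (k * (trailing_minor (gam T a0) A * \prod_(j <- s) trailing_minor j A) *
    \prod_(j <- rs) trailing_minor j.2 b)); last by ring.
by rewrite E E'; ring.
Qed.

End Strings.

(** * Semi-invariance of the minors *)

Section GenericDomain.
Variables (R : realType) (n : nat) (T : BDtriple n).
Implicit Types (A B b L U g : 'M[R[i]]_n).

Lemma upper_unip_lower_eq1 A L L' : unip_lower L -> unip_lower L' -> A *m L = L' ->
  upper_tri A -> A = 1%:M.
Proof.
move=> uL [l1 d1] E uA; have [l0 d0] := uL.
have lA : lower_tri A.
  have -> : A = L' *m invmx L by rewrite -E mulmxK // unip_lower_unit.
  by apply/loin_pred0/loinM; [exact/loin_pred0|exact/loinV/loin_pred0].
apply/matrixP => i j; rewrite [RHS]mxE; case: (ltngtP i j) => ij.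
- by rewrite lA // -val_eqE ltn_eqF.
- by rewrite uA // -val_eqE gtn_eqF.
have {ij} -> : j = i by exact/val_inj.
have := congr1 (fun M : 'M[R[i]]_n => M i i) E; rewrite mxE (bigD1 i) //= big1.
  by rewrite d0 d1 mulr1 addr0 eqxx.
move=> k; rewrite -val_eqE neq_ltn => /orP[ki|ik]; first by rewrite uA ?mul0r.
by rewrite lA ?mul0r.
Qed.

Fixpoint F_seq k U : 'M[R[i]]_n :=
  if k is k'.+1 then tgammas T (UL_elim n (F_seq k' U)).2 *m U else U.

Definition F_up k U := (UL_elim n (F_seq k U)).1.
Definition F_low k U := (UL_elim n (F_seq k U)).2.

Lemma F_seq1 k : F_seq k 1%:M = 1%:M.
Proof. by elim: k => //= k ->; rewrite UL_elim1 tgammas1 mulmx1. Qed.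

Lemma rational_F_seq k : @rational_mx R[i] n (F_seq k).
Proof.
elim: k => [|k IH] /=; first exact: rational_mx_id.
apply: rational_mx_mul; last exact: rational_mx_id.
apply: rational_mx_tgammas.
by have [] := rational_UL_elim n IH (F_seq1 k).
Qed.

Lemma F_seqE k U : F_up k U *m F_low k U = F_seq k U.
Proof. exact: UL_elim_mul. Qed.

Lemma F_low_unip k U : unip_lower (F_low k U).
Proof. by have [] := UL_elim_lower n (F_seq k U). Qed.

Lemma generic_F_up N : @generic R[i] n (fun U => forall k, (k < N)%N -> upper_tri (F_up k U)).
Proof.
elim: N => [|N IH]; first exact: genericT.
have H := generic_UL_elim n (rational_F_seq N) (F_seq1 N).
apply: generic_sub (genericI IH H) => U [HU HN] k.
rewrite ltnS leq_eqVlt => /orP[/eqP->|]; last exact: HU.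
by move=> i j ji; apply: HN; rewrite ?subnn.
Qed.

Lemma F_iter_seq N U : (forall k, (k < N)%N -> upper_tri (F_up k U)) ->
  forall k, (k <= N)%N -> F_iter T U k (F_seq k U).
Proof.
move=> H; elim=> [|k IH] kN; first exact: F_iter0.
apply: (@F_iterS _ _ _ _ k (F_up k U)); last exact: F_low_unip.
  by rewrite F_seqE; apply: IH; exact: ltnW.
exact: H.
Qed.

Lemma F_seq_stable U : U \in unitmx ->
  (forall k, (k < n.+2)%N -> upper_tri (F_up k U)) -> F_seq n.+2 U = F_seq n.+1 U.
Proof.
move=> uU H; pose t k := tgammas T (F_low k U).
have ut k : t k \in unitmx by exact/unip_lower_unit/tgammas_unip/F_low_unip.
have uL k := unip_lower_unit (F_low_unip k U).
have uF k : F_seq k U \in unitmx by case: k => [|k] //=; rewrite unitmx_mul uU -/(t k) ut.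
have uB k : F_up k U \in unitmx.
  have := uF k; rewrite -F_seqE unitmx_mul => /andP[uk _]; exact: uk.
pose a k := t k.+1 *m invmx (t k).
have G k : group_rel T (mul_scalars (cst1 R) (inv_scalars (cst1 R))) (a k) (F_low k.+1 U *m invmx (F_low k U)).
  apply: group_relM; first exact/group_rel_tgammas/F_low_unip.
  apply: group_relV; last exact/group_rel_tgammas/F_low_unip.
  by move=> *; exact: oner_neq0.
have nz : nz_scalars (mul_scalars (cst1 R) (inv_scalars (cst1 R))).
  by move=> *; rewrite /mul_scalars /inv_scalars /cst1 invr1 mulr1 oner_neq0.
have aF k : F_seq k.+2 U = a k *m F_seq k.+1 U.
  by rewrite /= -/(t k) -/(F_low k.+1 U) -/(t k.+1) /a !mulmxA mulmxKV.
have Ha k : (k <= n)%N -> upin (chain T k.+1) (a k).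
  elim: k => [|k IH] kn.
    by apply: (group_rel_chain nz (G 0%N)) => i j ji; rewrite all_predT.
  apply: (group_rel_chain nz (G k.+1)).
  have -> : F_low k.+2 U *m invmx (F_low k.+1 U) = invmx (F_up k.+2 U) *m a k *m F_up k.+1 U.
    rewrite -(mulKmx (uB k.+2) (F_low k.+2 U)) F_seqE aF -F_seqE !mulmxA.
    by rewrite mulmxK.
  apply: upinM; [apply: upinM|].
  - by apply: upinV; apply: upper_upin; apply: H; lia.
  - by apply: IH; exact: ltnW.
  - by apply: upper_upin; apply: H; lia.
have an1 : a n = 1%:M.
  apply: (upper_unip_lower_eq1 (tgammas_unip T (F_low_unip n U))
    (tgammas_unip T (F_low_unip n.+1 U))); first exact: (mulmxKV (ut n) (t n.+1)).
  move=> i j ji; have /upinP/(_ i i j) := Ha n (leqnn n); apply=> //.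
  by rewrite /= chain_empty ?andbF // (leq_ltn_trans _ (ltn_ord i)).
by rewrite aF an1 mul1mx.
Qed.

Lemma generic_F_value : @generic R[i] n (fun U => U \in unitmx ->
  exists B L, F_value T U (B *m L) /\ solves T U B L).
Proof.
apply: generic_sub (generic_F_up n.+2) => U H uU.
have it := F_iter_seq H.
have st : F_up n.+1 U *m F_low n.+1 U = tgammas T (F_low n.+1 U) *m U.
  exact: (etrans (F_seqE n.+1 U) (esym (F_seq_stable uU H))).
have uB : upper_tri (F_up n.+1 U) by exact: H.
have uL := F_low_unip n.+1 U.
exists (F_up n.+1 U), (F_low n.+1 U); split; last by split.
have i0 : F_iter T U n.+1 (F_up n.+1 U *m F_low n.+1 U).
  by rewrite F_seqE; apply: it.
move: (F_up n.+1 U) (F_low n.+1 U) uB uL st i0 => B L uB uL st i0.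
exists n.+1 => k /subnK <-; elim: (k - n.+1)%N => [|j IH]; first exact: i0.
by rewrite st; apply: F_iterS IH uB uL.
Qed.

End GenericDomain.

Section SemiInvariance.
Variables (R : realType) (n : nat).
Implicit Types (A B b L U g : 'M[R[i]]_n).

Lemma generated_polyfun (f : 'M[R[i]]_n -> R[i]) : generated (@GL_coord R n) f ->
  exists e p, @polyfun R[i] n p /\ forall U, U \in unitmx -> f U * \det U ^+ e = p U.
Proof.
have pdet := @polyfun_det R[i] n.
elim=> {f} [f|k|f g _ [e [p [pp Hp]]] _ [e' [p' [pp' Hp']]]|f g _ [e [p [pp Hp]]] _ [e' [p' [pp' Hp']]]].
- case=> [[i [j ->]]|->].
    exists 0%N, (fun U => U i j); split; first exact: polyfun_coord.
    by move=> U _; rewrite mulr1.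
  exists 1%N, (fun=> 1); split; first exact: polyfun_const.
  by move=> U; rewrite unitmxE unitfE => dU; rewrite mulVf.
- exists 0%N, (fun=> k); split; first exact: polyfun_const.
  by move=> U _; rewrite mulr1.
- exists (e + e')%N, (fun U => p U * \det U ^+ e' + p' U * \det U ^+ e); split.
    by apply: polyfun_add; apply: polyfun_mul => //; exact: (falg_exp (@polyfun_alg _ _)).
  by move=> U uU; rewrite -Hp // -Hp' // exprD; ring.
- exists (e + e')%N, (fun U => p U * p' U); split; first exact: polyfun_mul.
  by move=> U uU; rewrite -Hp // -Hp' // exprD; ring.
Qed.

Lemma generated_tr (f : 'M[R[i]]_n -> R[i]) : generated (@GL_coord R n) f ->
  generated (@GL_coord R n) (fun U => f U^T).
Proof.
elim=> {f} [f|k|f g _ IHf _ IHg|f g _ IHf _ IHg].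
- case=> [[i [j ->]]|->]; apply: generated_gen.
    by left; exists j, i; apply/funext => U; rewrite mxE.
  by right; apply/funext => U; rewrite det_tr.
- exact: generated_const.
- exact: generated_add.
- exact: generated_mul.
Qed.

Lemma regular_tr (f : 'M[R[i]]_n -> R[i]) : regular f -> regular (fun U => f U^T).
Proof.
move=> [g gg fg]; exists (fun U => g U^T); first exact: generated_tr.
by move=> U uU; rewrite fg // unitmx_tr.
Qed.

Lemma regular_semi_generic (f : 'M[R[i]]_n -> R[i]) (P Q : 'M[R[i]]_n) k
    (S : 'M[R[i]]_n -> Prop) : regular f -> P \in unitmx -> Q \in unitmx ->
  @generic R[i] n S ->
  (forall U, U \in unitmx -> S U -> S (P *m U *m invmx Q) ->
     f (P *m U *m invmx Q) = k * f U) ->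
  forall U, U \in unitmx -> f (P *m U *m invmx Q) = k * f U.
Proof.
move=> [g gg fg] uP uQ [q [pq q1 qS]] H.
have [e [p [pp Hp]]] := generated_polyfun gg.
pose t U := P *m U *m invmx Q.
have ut U : U \in unitmx -> t U \in unitmx by move=> uU; rewrite !unitmx_mul uP uU unitmx_inv.
have dt U : \det (t U) = \det P / \det Q * \det U by rewrite !det_mulmx det_inv; ring.
pose D := \det P / \det Q.
pose psi U := p (t U) - k * D ^+ e * p U.
have psiE U : U \in unitmx -> psi U = (f (t U) - k * f U) * (\det (t U)) ^+ e.
  move=> uU; rewrite /psi -!Hp ?ut // !fg ?ut // dt exprMn -/D; ring.
have ppsi : @polyfun R[i] n psi.
  apply: polyfun_add; first exact: polyfun_conj.
  apply: (@falg_ext _ _ (@polyfun R[i] n) (fun U => (- (k * D ^+ e)) * p U)).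
    by move=> U; rewrite mulNr.
  by apply: polyfun_mul => //; exact: polyfun_const.
have pqt : @polyfun R[i] n (fun U => q (t U)) by exact: polyfun_conj.
have Z U : psi U * q U * q (t U) * \det U = 0.
  have [uU|nU] := boolP (U \in unitmx); last first.
    by move: nU; rewrite unitmxE unitfE negbK => /eqP ->; rewrite mulr0.
  have [->|q0] := eqVneq (q U) 0; first by rewrite mulr0 !mul0r.
  have [->|qt0] := eqVneq (q (t U)) 0; first by rewrite mulr0 mul0r.
  rewrite psiE // H ?subrr ?mul0r //; exact: qS.
have Z1 : forall U, psi U * q U * q (t U) = 0.
  apply: (polyfun_mul_eq0 _ (@polyfun_det R[i] n) Z).
    by apply: polyfun_mul => //; apply: polyfun_mul.
  by exists 1%:M; rewrite det1 oner_neq0.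
have Z2 : forall U, psi U * q U = 0.
  apply: (polyfun_mul_eq0 _ pqt Z1); first exact: polyfun_mul.
  by exists (invmx P *m Q); rewrite /t mulKVmx // mulmxV.
have Z3 : forall U, psi U = 0.
  by apply: (polyfun_mul_eq0 ppsi pq Z2); exists 1%:M.
move=> U uU; apply/eqP; rewrite -subr_eq0; apply/eqP.
have := Z3 U; rewrite psiE // => /eqP; rewrite mulf_eq0 => /orP[/eqP //|].
rewrite expf_eq0 => /andP[_]; have := ut U uU.
by rewrite unitmxE unitfE => /negbTE ->.
Qed.

Section Trailing.
Variable T : BDtriple n.

Lemma trailing_minorM1 r A B : ~~ Gam1 T r -> upin (Gam1 T) A ->
  trailing_minor r (A *m B) = trailing_minor r A * trailing_minor r B.
Proof.
move=> nr /upinP iA; apply: trailing_minorM; left=> i j jr ri; exact: (iA r).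
Qed.

Lemma trailing_minorM2 r A B : ~~ Gam2 T r -> loin (Gam2 T) B ->
  trailing_minor r (A *m B) = trailing_minor r A * trailing_minor r B.
Proof.
move=> nr /loinP iB; apply: trailing_minorM; right=> i j ir rj; exact: (iB r).
Qed.

Lemma trailing_minorV1 r A : ~~ Gam1 T r -> upin (Gam1 T) A -> A \in unitmx ->
  trailing_minor r (invmx A) = (trailing_minor r A)^-1 /\ trailing_minor r A != 0.
Proof.
move=> nr iA uA; have E : trailing_minor r A * trailing_minor r (invmx A) = 1.
  by rewrite -trailing_minorM1 // mulmxV // trailing_minor1.
have tA : trailing_minor r A != 0.
  by apply: contra_eq_neq E => ->; rewrite mul0r eq_sym oner_neq0.
by split=> //; rewrite -[LHS](mulKf tA) E mulr1.
Qed.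

Lemma trailing_minorV2 r A : ~~ Gam2 T r -> loin (Gam2 T) A -> A \in unitmx ->
  trailing_minor r (invmx A) = (trailing_minor r A)^-1 /\ trailing_minor r A != 0.
Proof.
move=> nr iA uA; have E : trailing_minor r A * trailing_minor r (invmx A) = 1.
  by rewrite -trailing_minorM2 ?mulmxV ?trailing_minor1 //; exact: loinV.
have tA : trailing_minor r A != 0.
  by apply: contra_eq_neq E => ->; rewrite mul0r eq_sym oner_neq0.
by split=> //; rewrite -[LHS](mulKf tA) E mulr1.
Qed.

Lemma trailing_minor_unip r L : unip_lower L -> trailing_minor r L = 1.
Proof.
move=> [lL dL]; rewrite trailing_minor_tri; last by right.
by rewrite big1.
Qed.

Lemma trailing_minor_conj1 r A t t' : ~~ Gam1 T r -> upin (Gam1 T) A ->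
  unip_lower t -> unip_lower t' -> upin (Gam1 T) t -> upin (Gam1 T) t' ->
  trailing_minor r (t' *m A *m invmx t) = trailing_minor r A.
Proof.
move=> nr iA ut ut' it it'.
rewrite (trailing_minorM1 _ nr); last exact: upinM.
rewrite (trailing_minorM1 _ nr) //.
rewrite (trailing_minorV1 nr it (unip_lower_unit ut)).1.
by rewrite (trailing_minor_unip r ut') (trailing_minor_unip r ut) invr1 mulr1 mul1r.
Qed.

Lemma trailing_minor_conj2 r A t t' : ~~ Gam2 T r -> loin (Gam2 T) A ->
  unip_lower t -> unip_lower t' -> trailing_minor r (t' *m A *m invmx t) = trailing_minor r A.
Proof.
move=> nr iA ut ut'; have it : loin (Gam2 T) t by case: ut => lL _; exact: lower_loin.
rewrite (trailing_minorM2 _ nr); last exact: loinV.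
rewrite (trailing_minorM2 _ nr) //.
rewrite (trailing_minorV2 nr it (unip_lower_unit ut)).1.
by rewrite (trailing_minor_unip r ut') (trailing_minor_unip r ut) invr1 mulr1 mul1r.
Qed.

(** Semi-invariance under the pairs of [group_rel]. Only at trivial scalars is
    the character required to be explicit: it is then regular on [D], and
    trivial on unipotent elements. *)
Definition ext_semi_invariant (psi : 'M[R[i]]_n -> R[i]) :=
  exists rs : seq (nat * nat), [/\ forall r, r \in rs -> ~~ Gam1 T r.1 /\ ~~ Gam2 T r.2 &
  forall c, nz_scalars c -> exists k, (c = cst1 R -> k = 1) /\
    forall P Q U, group_rel T c P Q -> U \in unitmx ->
    psi (P *m U *m invmx Q) =
    k * \prod_(r <- rs) (trailing_minor r.1 P / trailing_minor r.2 Q) * psi U].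

Lemma trailing_minor_upper_unit r A : A \in unitmx -> upper_tri A -> trailing_minor r A != 0.
Proof.
move=> uA tA; rewrite trailing_minor_tri; last by left.
apply/prodf_neq0 => i _; have := invmx_upper_diag i uA tA.
by apply: contra_eq_neq => ->; rewrite mul0r eq_sym oner_neq0.
Qed.

Lemma ext_semi_invariant_h a0 s (psi : 'M[R[i]]_n -> R[i]) :
  ~~ Gam2 T a0 -> is_string (Gam1 T) (gam T) a0 s -> regular psi ->
  (forall U V, U \in unitmx -> F_value T U V -> psi U = \prod_(a <- a0 :: s) trailing_minor a V) ->
  ext_semi_invariant psi.
Proof.
move=> na0 st rpsi Hpsi; have [rs [Hrs H]] := string_minors R st na0.
exists rs; split=> // c c0; have [k [k0 k1 Hk]] := H c c0.
exists k^-1; split; first by move=> /k1 ->; rewrite invr1.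
move=> P Q U0 G; have [uP uQ iP iQ _] := G.
apply: (regular_semi_generic rpsi uP uQ (generic_F_value R T)) => // U uU HU HU'.
have uU' : P *m U *m invmx Q \in unitmx by rewrite !unitmx_mul uP uU unitmx_inv.
have [B [L [FV S]]] := HU uU; have [B' [L' [FV' S']]] := HU' uU'.
rewrite (Hpsi _ _ uU FV) (Hpsi _ _ uU' FV').
have [A [b [GA tA tb BE tmE]]] := solves_rel c0 G uU S S'.
have [tB uL _] := S; have [tB' uL' _] := S'.
have tmBL r (X Y : 'M[R[i]]_n) : upper_tri X -> unip_lower Y -> trailing_minor r (X *m Y) = trailing_minor r X.
  move=> tX uY; rewrite trailing_minorM; last first.
    by left=> i j jr ri; apply: tX; exact: leq_trans ri.
  by rewrite (trailing_minor_unip r uY) mulr1.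
have tmUU r (X Y : 'M[R[i]]_n) : upper_tri X -> trailing_minor r (X *m Y) = trailing_minor r X * trailing_minor r Y.
  move=> tX; apply: trailing_minorM.
  by left=> i j jr ri; apply: tX; exact: leq_trans ri.
pose M X := \prod_(a <- a0 :: s) trailing_minor a (X : 'M[R[i]]_n).
rewrite -!/(M _).
have ML (X Y : 'M[R[i]]_n) : upper_tri X -> unip_lower Y -> M (X *m Y) = M X.
  by move=> tX uY; apply: eq_bigr => a _; exact: tmBL.
have MU (X Y : 'M[R[i]]_n) : upper_tri X -> M (X *m Y) = M X * M Y.
  by move=> tX; rewrite /M -big_split; apply: eq_bigr => a _; exact: tmUU.
rewrite !ML //.
have [_ ub _ _ _] := GA.
have tb0 : M b != 0.
  rewrite prodf_seq_neq0; apply/allP => a _ /=; exact: trailing_minor_upper_unit.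
apply: (mulIf tb0); rewrite -MU // BE MU //.
have E : k * M A * _ = M b * _ := Hk A b GA tA tb.
have E1 : \prod_(r <- rs) trailing_minor r.1 A = \prod_(r <- rs) trailing_minor r.1 P.
  rewrite !big_seq; apply: eq_bigr => r /Hrs[nr1 nr2]; rewrite (tmE r.1).1.
  have ut := tgammas_unip T uL; have ut' := tgammas_unip T uL'.
  have [_ _ i1 _ _] := group_rel_tgammas T uL'; have [_ _ i2 _ _] := group_rel_tgammas T uL.
  exact: (trailing_minor_conj1 nr1 iP ut ut' i2 i1).
have E2 : \prod_(r <- rs) trailing_minor r.2 b = \prod_(r <- rs) trailing_minor r.2 Q.
  rewrite !big_seq; apply: eq_bigr => r /Hrs[nr1 nr2]; rewrite (tmE r.2).2.
  exact: (trailing_minor_conj2 nr2 iQ uL uL').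
rewrite E1 E2 in E.
have Q0 : \prod_(r <- rs) trailing_minor r.2 Q != 0.
  rewrite prodf_seq_neq0; apply/allP => r /Hrs[_ nr2] /=.
  by have [] := trailing_minorV2 nr2 iQ uQ.
rewrite prodf_div.
set u := \prod_(r <- rs) trailing_minor r.1 P in E *; set v := \prod_(r <- rs) trailing_minor r.2 Q in E Q0 *.
have -> : M A = k^-1 * (M b * u) / v by rewrite -E; field; rewrite k0 Q0.
by ring.
Qed.

Lemma ext_semi_invariant_det : ext_semi_invariant (fun U => \det U).
Proof.
exists [:: (0%N, 0%N)]; split.
  by move=> r; rewrite inE => /eqP ->; split; [exact: Gam1_0|exact: Gam2_0].
move=> c _; exists 1; split=> // P Q U _ _.
by rewrite big_seq1 /= !trailing_minor0 !det_mulmx det_inv; ring.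
Qed.

End Trailing.
End SemiInvariance.

Section Opposite.
Variables (R : realType) (n : nat) (T : BDtriple n).
Implicit Types (A B b L U V g : 'M[R[i]]_n) (c : scalars R).

Definition op_scalars c : scalars R :=
  fun d a a' m => if d then (c d a' a m)^-1 else c d a' a m.

Lemma group_rel_op c A B : nz_scalars c -> group_rel T c A B ->
  group_rel (op_triple T) (op_scalars c) (invmx B)^T (invmx A)^T.
Proof.
move=> c0 [uA uB iA iB H]; split; rewrite ?unitmx_tr ?unitmx_inv //.
- exact: loinV.
- by rewrite /loin trmxK; exact: upinV.
move=> d a a' m /corr_opK r; have := H _ _ _ _ r.
have [ubA EA] := corr_blockV1 r iA uA; have [ubB EB] := corr_blockV2 r iB uB.
rewrite !block_tr EA EB /op_scalars.
move: (block m.+1 a'.+1 A) (block m.+1 a.+1 B) ubA ubB => x y ux uy {EA EB}.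
case: d r => r; last first.
  move=> E; have := congr1 invmx E; rewrite invmxZ -?E // => ->.
  by rewrite linearZ /= scalerA mulfV ?scale1r.
move=> E; rewrite trmxK.
have s0 : (-1) ^+ m != 0 :> R[i] by rewrite signr_eq0.
have E1 : w0 R m.+1 *m x^T = c true a' a m *: (invmx y *m w0 R m.+1).
  by rewrite scalemxAr -E -mulmxA mulKmx.
have E2 : x^T *m w0 R m.+1 = c true a' a m *: (w0 R m.+1 *m invmx y).
  apply: (scalerI s0); rewrite -[LHS]mul_scalar_mx -w0_sq -mulmxA.
  rewrite [w0 R m.+1 *m (x^T *m _)]mulmxA E1 -scalemxAl -scalemxAr -mulmxA w0_sq.
  by rewrite mul_mx_scalar -scalemxAr scalerA scalerA mulrC.
apply: (scalerI (c0 true a' a m)); rewrite -mulmxA scalemxAr -E2.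
by rewrite scalerA mulfV // scale1r trmx_inv mulKmx // unitmx_tr.
Qed.

Lemma op_scalars_nz c : nz_scalars c -> nz_scalars (op_scalars c).
Proof. by move=> c0 [] a a' m; rewrite /op_scalars ?invr_eq0. Qed.

Lemma op_scalars1 : op_scalars (cst1 R) = cst1 R.
Proof.
apply/funext => d; apply/funext => a; apply/funext => a'; apply/funext => m.
by rewrite /op_scalars /cst1 invr1 if_same.
Qed.

Lemma ext_semi_invariant_op (psi : 'M[R[i]]_n -> R[i]) :
  ext_semi_invariant (op_triple T) (fun U => psi U^T) -> ext_semi_invariant T psi.
Proof.
move=> [rs [Hrs H]]; exists [seq (r.2, r.1) | r <- rs]; split.
  by move=> r /mapP[x /Hrs[n1 n2] ->].
move=> c c0; have [k [k1 Hk]] := H _ (op_scalars_nz c0); exists k; split.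
  by move=> c1; apply: k1; rewrite c1 op_scalars1.
move=> P Q U G uU; have [uP uQ iP iQ _] := G.
have uUT : U^T \in unitmx by rewrite unitmx_tr.
have E : ((invmx Q)^T *m U^T *m invmx (invmx P)^T)^T = P *m U *m invmx Q.
  by rewrite -trmx_inv invmxK !trmx_mul !trmxK mulmxA.
have := Hk _ _ _ (group_rel_op c0 G) uUT; rewrite E trmxK => ->.
congr (k * _ * psi U).
rewrite big_map !big_seq; apply: eq_bigr => r /Hrs[n2 n1].
rewrite !trailing_minor_tr (trailing_minorV1 n1 iP uP).1 (trailing_minorV2 n2 iQ uQ).1.
by rewrite invrK mulrC.
Qed.

Lemma F_iter_op U k V : F_iter (op_triple T) U k V -> Fop_iter T U^T k V^T.
Proof.
elim=> [|j B L _ IH uB uL]; first exact: Fop_iter0.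
rewrite trmx_mul tgammas_op.
have -> : tgamma (op_triple (op_triple T)) L^T = tgamma T L^T by [].
rewrite trmx_mul in IH; apply: Fop_iterS IH _ _.
  by case: uL => lL dL; split=> [i l li|i]; rewrite mxE // lL.
by move=> i l il; rewrite mxE uB.
Qed.

Lemma F_value_op U V : F_value (op_triple T) U V -> Fop_value T U^T V^T.
Proof. by move=> [K H]; exists K => k /H; exact: F_iter_op. Qed.

End Opposite.

Section Frozen.
Variables (R : realType) (n : nat) (T : BDtriple n).
Implicit Types (A B U V : 'M[R[i]]_n).

Lemma minor_frozen_ext cv G (psi : 'M[R[i]]_n -> R[i]) :
  minor_frozen cv G T psi -> ext_semi_invariant T psi.
Proof.
case=> [a0 s f _ _ na0 st rf Hf|a0 s f _ _ na0 st rf Hf|_].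
- exact: ext_semi_invariant_h na0 st rf Hf.
- apply: ext_semi_invariant_op.
  apply: (@ext_semi_invariant_h _ _ (op_triple T) a0 s) => //; first exact: regular_tr.
  move=> U V uU /F_value_op FV; rewrite (Hf _ _ _ FV) ?unitmx_tr //.
  by apply: eq_bigr => a _; rewrite trailing_minor_tr.
exact: ext_semi_invariant_det.
Qed.

End Frozen.

Section InD.
Variables (R : realType) (n : nat) (T : BDtriple n).
Implicit Types (A B U V : 'M[R[i]]_n).

Lemma run_exists (S : pred nat) x : (0 < x <= n)%N ->
  exists a b, is_run n S a b /\ (a <= x <= b)%N.
Proof.
move=> xn.
have ex1 : exists a, (0 < a)%N && all S (index_iota a x).
  by exists x; rewrite /index_iota subnn /= andbT; lia.
have ex2 : exists b, (x <= b <= n)%N && all S (index_iota x b).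
  by exists x; rewrite /index_iota subnn /= andbT; lia.
have bd b : (x <= b <= n)%N && all S (index_iota x b) -> (b <= n)%N by lia.
case: (ex_minnP ex1) => a /andP[a0 Sa] mina; case: (ex_maxnP ex2 bd) => b /andP[xb Sb] maxb.
have ax : (a <= x)%N by apply: mina; rewrite /index_iota subnn /= andbT; lia.
have allP' i j : all S (index_iota i j) <-> forall r, (i <= r < j)%N -> S r.
  by split=> [/allP H r ir|H]; [apply: H|apply/allP => r]; rewrite mem_index_iota // => /H.
exists a, b; split; last by rewrite ax; lia.
split=> //; try lia.
  apply/allP' => r rab; case: (ltnP r x) => rx.
    by move/allP': Sa; apply; lia.
  by move/allP': Sb; apply; lia.
move=> a' b' a'0 a'a bb' b'n /allP' H.
have aa' : (a <= a')%N.
  by apply: mina; rewrite a'0 /=; apply/allP' => r rx; apply: H; lia.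
have b'b : (b' <= b)%N.
  apply: maxb; apply/andP; split; first by lia.
  by apply/allP' => r rx; apply: H; lia.
by split; lia.
Qed.

Lemma run_mem (S : pred nat) a b r : is_run n S a b -> (a <= r < b)%N -> S r.
Proof.
by move=> [_ _ _ /allP H _] rab; apply: H; rewrite mem_index_iota.
Qed.

Lemma block_upper_upin (S : pred nat) A : block_upper S A -> upin S A.
Proof.
move=> H; apply/upinP => r i j Sr jr ri.
have [a [b [Rab iab]]] := @run_exists S i.+1 (ltn_ord i).
have [a' [b' [Rab' jab]]] := @run_exists S j.+1 (ltn_ord j).
apply: (H a b a' b') => //; rewrite ltnNge; apply/negP => ab'.
case/negP: Sr; case: (ltnP r b') => rb'; first by apply: (run_mem Rab'); lia.
by apply: (run_mem Rab); lia.
Qed.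

Lemma block_lower_loin (S : pred nat) A : block_lower S A -> loin S A.
Proof.
move=> H; apply/loinP => r i j Sr ir rj.
have [a [b [Rab iab]]] := @run_exists S i.+1 (ltn_ord i).
have [a' [b' [Rab' jab]]] := @run_exists S j.+1 (ltn_ord j).
apply: (H a b a' b') => //; rewrite ltnNge; apply/negP => ab'.
case/negP: Sr; case: (ltnP r b) => rb'; first by apply: (run_mem Rab); lia.
by apply: (run_mem Rab'); lia.
Qed.

Lemma corr_is_run d a a' m : corr T d a a' m -> is_run n (Gam1 T) a.+1 (a + m).+1.
Proof.
move=> c; have m0 := corr_m c; have an := corr_n c.
split=> //; try lia; first exact: (corr_interval c).
move=> x y x0 xa ay yn /allP H; split; apply/eqP.
  rewrite eqn_leq xa /= ltnNge; apply/negP => xa'; case/negP: (corr_a c).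
  by apply: H; rewrite mem_index_iota; lia.
rewrite eqn_leq ay andbT leqNgt; apply/negP => xa'; case/negP: (corr_am c).
by apply: H; rewrite mem_index_iota; lia.
Qed.

End InD.

Section GroupD.
Variables (R : realType) (n : nat) (T : BDtriple n).

Lemma corr_run_image d a a' m : corr T d a a' m ->
  run_image T a.+1 (a + m).+1 a'.+1 (a' + m).+1.
Proof.
move=> c; have m0 := corr_m c; split; try lia; first exact: corr_is_run c.
  exact: (corr_is_run (corr_opP c)).
move=> k kam; have := corr_gam c (k := (k - a).-1).
rewrite (_ : (a + (k - a).-1).+1 = k); last by lia.
by move=> ->; [case: (d)|]; lia.
Qed.

Lemma inD_group_rel (p : 'M[R[i]]_n * 'M[R[i]]_n) : inD T p -> group_rel T (cst1 R) p.1 p.2.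
Proof.
move=> [u1 u2 b1 b2 H]; split=> //; [exact: block_upper_upin|exact: block_lower_loin|].
move=> d a a' m c; have := H _ _ _ _ (corr_run_image c); rewrite subSS addKn /=.
have g k : (a.+1 <= k)%N -> (k < (a + m).+1)%N ->
    gam T k = if d then (a' + (m - (k - a).-1))%N else (a' + (k - a).-1).+1.
  move=> ak km; have := corr_gam c (k := (k - a).-1).
  by rewrite (_ : (a + (k - a).-1).+1 = k); [apply|]; lia.
have [ub1 _] := corr_blockV1 c (block_upper_upin b1) u1.
rewrite /cst1 !scale1r.
case: d c g => c g [Hi Hd]; last first.
  by apply: Hi => k l ak kl lm; rewrite !g; lia.
rewrite Hd; last first.
  split; first by have := corr_d c isT; lia.
  by move=> k l ak kl lm; rewrite !g; lia.
rewrite mulmxKV ?w0_unit // -mulmxA -trmx_mul mulmxV // trmx1 mulmx1 //.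
Qed.

End GroupD.

(** * The character *)

Section Generated.
Variables (R : realType) (X : Type) (gens : (X -> R[i]) -> Prop).

Lemma generated_alg : function_algebra (generated gens).
Proof. by split; [exact: generated_const|exact: generated_add|exact: generated_mul]. Qed.

Lemma generated_trailing m r (M : X -> 'M[R[i]]_m) :
  (forall i j, generated gens (fun x => M x i j)) ->
  generated gens (fun x => trailing_minor r (M x)).
Proof.
move=> H; apply: (@falg_ext _ _ _ (fun x => \det (trailing_mx r (M x)))).
  by move=> x; rewrite trailing_minorE.
apply: (falg_det generated_alg) => i j.
apply: (@falg_ext _ _ _ (fun x => if (r <= i)%N && (r <= j)%N then M x i j else (i == j)%:R)).
  by move=> x; rewrite mxE.
by case: ((r <= i)%N && (r <= j)%N); [exact: H|exact: generated_const].
Qed.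

End Generated.

Section PartOne.
Variables (R : realType) (n : nat) (T : BDtriple n).

Lemma GL2_coord_fst i j : generated (@GL2_coord R n) (fun p => p.1 i j).
Proof.
apply: (@generated_gen _ _ (@GL2_coord R n) (fun p => p.1 i j)).
by exists (fun U => U i j); [left; exists i, j|left].
Qed.

Lemma GL2_coord_snd i j : generated (@GL2_coord R n) (fun p => p.2 i j).
Proof.
apply: (@generated_gen _ _ (@GL2_coord R n) (fun p => p.2 i j)).
by exists (fun U => U i j); [left; exists i, j|right].
Qed.

Lemma GL2_coord_det2 : generated (@GL2_coord R n) (fun p => (\det p.2)^-1).
Proof.
apply: (@generated_gen _ _ (@GL2_coord R n) (fun p => (\det p.2)^-1)).
by exists (fun U => (\det U)^-1); [right|right].
Qed.

Lemma ext_semi_invariantW (psi : 'M[R[i]]_n -> R[i]) :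
  ext_semi_invariant T psi -> semi_invariant T psi.
Proof.
move=> [rs [Hrs H]].
have [|k [/(_ erefl) -> Hk]] := H (cst1 R); first by move=> *; exact: oner_neq0.
pose chi (p : 'M[R[i]]_n * 'M[R[i]]_n) :=
  \prod_(r <- rs) (trailing_minor r.1 p.1 * trailing_minor r.2 (invmx p.2)).
have V2 (p : 'M[R[i]]_n * 'M[R[i]]_n) r : inD T p -> ~~ Gam2 T r ->
    trailing_minor r (invmx p.2) = (trailing_minor r p.2)^-1 /\ trailing_minor r p.2 != 0.
  by move=> /inD_group_rel[_ u2 _ l2 _] nr; exact: trailing_minorV2 nr l2 u2.
exists chi; last first.
  move=> p U pD uU; rewrite (Hk _ _ _ (inD_group_rel pD) uU) mul1r; congr (_ * _).
  rewrite /chi !big_seq; apply: eq_bigr => r /Hrs[n1 n2].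
  by rewrite (V2 p r.2 pD n2).1.
split.
- exists (fun p => \prod_(r <- rs) (trailing_minor r.1 p.1 *
     trailing_minor r.2 ((\det p.2)^-1 *: \adj p.2))); last first.
    move=> p [_ u2 _ _ _]; rewrite /chi; apply: eq_bigr => r _.
    by rewrite {1}/invmx u2.
  apply: (falg_prod (@generated_alg _ _ _)) => r _; apply: generated_mul.
    by apply: generated_trailing => i j; exact: GL2_coord_fst.
  apply: generated_trailing => i j.
  apply: (@falg_ext _ _ _ (fun p => (\det p.2)^-1 * ((-1) ^+ (j + i) * \det (row' j (col' i p.2))))).
    by move=> p; rewrite !mxE.
  apply: generated_mul; first exact: GL2_coord_det2.
  apply: generated_mul; first exact: generated_const.
  apply: (falg_det (@generated_alg _ _ _)) => x l.
  apply: (@falg_ext _ _ _ (fun p : 'M[R[i]]_n * 'M[R[i]]_n => p.2 (lift j x) (lift i l))).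
    by move=> p; rewrite !mxE.
  exact: GL2_coord_snd.
- move=> p pD; rewrite /chi prodf_seq_neq0; apply/allP => r /Hrs[n1 n2] /=.
  have [u1 _ l1 _ _] := inD_group_rel pD.
  rewrite mulf_neq0 //; first by have [] := trailing_minorV1 n1 l1 u1.
  by have [-> t0] := V2 p r.2 pD n2; rewrite invr_eq0.
- move=> p q pD qD; rewrite /chi -big_split /= !big_seq; apply: eq_bigr => r /Hrs[n1 n2].
  have [_ u2 l1 l2 _] := inD_group_rel pD; have [_ u2' l1' l2' _] := inD_group_rel qD.
  rewrite (trailing_minorM1 _ n1 l1) (V2 p r.2 pD n2).1 (V2 q r.2 qD n2).1.
  have uM : p.2 *m q.2 \in unitmx by rewrite unitmx_mul u2.
  rewrite (trailing_minorV2 n2 (loinM l2 l2') uM).1 (trailing_minorM2 _ n2 l2').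
  by rewrite invfM; ring.
Qed.

End PartOne.

(** * Derivatives and gradients *)

Import numFieldNormedType.Exports ComplexField.Normc.

Local Open Scope classical_set_scope.
Local Open Scope ring_scope.
Local Open Scope complex_scope.

Section Gradient.
Variables (R : realType) (n : nat).

(** [Dv f v]: the function [f] has derivative [v] at [t0]. Real and complex
    parameters are treated at once. *)
Record deriv_rules (D : Type) (t0 : D) (Dv : (D -> R[i]) -> R[i] -> Prop) : Prop := DerivRules {
  dr_const : forall k, Dv (fun=> k) 0;
  dr_add : forall f g a b, Dv f a -> Dv g b -> Dv (fun t => f t + g t) (a + b);
  dr_mul : forall f g a b, Dv f a -> Dv g b -> Dv (fun t => f t * g t) (f t0 * b + g t0 * a);
  dr_inv : forall f a, f t0 != 0 -> Dv f a -> Dv (fun t => (f t)^-1) (- (f t0)^-1 ^+ 2 * a)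
}.

Lemma dr_sum (D : Type) (t0 : D) Dv (H : deriv_rules t0 Dv) (I : Type) (r : seq I) (F : I -> D -> R[i]) (a : I -> R[i]) :
  (forall i, Dv (F i) (a i)) -> Dv (fun t => \sum_(i <- r) F i t) (\sum_(i <- r) a i).
Proof.
move=> Fa; elim: r => [|i r IH].
  rewrite big_nil (_ : (fun t => _) = fun=> 0); first exact: dr_const H _.
  by apply/funext => t; rewrite big_nil.
rewrite big_cons (_ : (fun t => _) = fun t => F i t + \sum_(j <- r) F j t); first exact: (dr_add H).
by apply/funext => t; rewrite big_cons.
Qed.

Lemma dr_mulmxl (D : Type) (t0 : D) Dv (H : deriv_rules t0 Dv) (A : D -> 'M[R[i]]_n) (U x : 'M[R[i]]_n) :
  (forall i j, Dv (fun t => A t i j) (x i j)) ->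
  forall i j, Dv (fun t => (U *m A t) i j) ((U *m x) i j).
Proof.
move=> HA i j; rewrite mxE (_ : (fun t => _) = (fun t => \sum_k U i k * A t k j)); last first.
  by apply/funext => t; rewrite mxE.
apply: (dr_sum H) => k.
by have := dr_mul H (dr_const H (U i k)) (HA k j); rewrite mulr0 addr0.
Qed.

Lemma dr_mulmxr (D : Type) (t0 : D) Dv (H : deriv_rules t0 Dv) (A : D -> 'M[R[i]]_n) (U x : 'M[R[i]]_n) :
  (forall i j, Dv (fun t => A t i j) (x i j)) ->
  forall i j, Dv (fun t => (A t *m U) i j) ((x *m U) i j).
Proof.
move=> HA i j; rewrite mxE (_ : (fun t => _) = (fun t => \sum_k A t i k * U k j)); last first.
  by apply/funext => t; rewrite mxE.
apply: (dr_sum H) => k.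
by have := dr_mul H (HA i k) (dr_const H (U k j)); rewrite mulr0 add0r mulrC.
Qed.

Definition is_gradient (f : 'M[R[i]]_n -> R[i]) (G : 'M[R[i]]_n -> 'M[R[i]]_n) :=
  forall D (t0 : D) Dv, deriv_rules t0 Dv -> forall (c : D -> 'M[R[i]]_n) (V : 'M[R[i]]_n),
  c t0 \in unitmx -> (forall i j, Dv (fun t => c t i j) (V i j)) ->
  Dv (fun t => f (c t)) (\tr (G (c t0) *m V)).

Definition generated_mx (G : 'M[R[i]]_n -> 'M[R[i]]_n) :=
  forall i j, generated (@GL_coord R n) (fun U => G U i j).

Definition smooth f := generated (@GL_coord R n) f /\ exists2 G, generated_mx G & is_gradient f G.

Lemma smooth_const k : smooth (fun=> k).
Proof.
split; first exact: generated_const.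
exists (fun=> 0).
  by move=> i j; apply: falg_ext (generated_const _ 0) => U; rewrite mxE.
by move=> D t0 Dv H c V _ _; rewrite mul0mx mxtrace0; exact: dr_const H _.
Qed.

Lemma smooth_coord i j : smooth (fun U => U i j).
Proof.
split; first by apply: generated_gen; left; exists i, j.
exists (fun=> delta_mx j i).
  by move=> k l; exact: generated_const.
by move=> D t0 Dv H c V _ /(_ i j); rewrite mxtrace_mulC mxtrace_delta.
Qed.

Lemma smooth_add f g : smooth f -> smooth g -> smooth (fun U => f U + g U).
Proof.
move=> [gf [F gF HF]] [gg [G gG HG]]; split; first exact: generated_add.
exists (fun U => F U + G U).
  move=> i j; apply: falg_ext (generated_add (gF i j) (gG i j)) => U.
  by rewrite mxE.
move=> D t0 Dv H c V u Hc; rewrite mulmxDl mxtraceD.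
by apply: (dr_add H); [apply: HF|apply: HG].
Qed.

Lemma smooth_mul f g : smooth f -> smooth g -> smooth (fun U => f U * g U).
Proof.
move=> [gf [F gF HF]] [gg [G gG HG]]; split; first exact: generated_mul.
exists (fun U => f U *: G U + g U *: F U).
  move=> i j; apply: falg_ext (generated_add (generated_mul gf (gG i j)) (generated_mul gg (gF i j))) => U.
  by rewrite !mxE.
move=> D t0 Dv H c V u Hc; rewrite mulmxDl mxtraceD -!scalemxAl !mxtraceZ.
by apply: (@dr_mul _ _ _ H (f \o c) (g \o c)); [apply: HF|apply: HG].
Qed.

Lemma smooth_det : smooth (fun U => \det U).
Proof.
apply: falg_det smooth_coord.
by split; [exact: smooth_const|exact: smooth_add|exact: smooth_mul].
Qed.

Lemma smooth_det_inv : smooth (fun U => (\det U)^-1).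
Proof.
have gV : generated (@GL_coord R n) (fun U => (\det U)^-1).
  by apply: generated_gen; right.
have [_ [F gF HF]] := smooth_det; split=> //.
exists (fun U => (- (\det U)^-1 ^+ 2) *: F U).
  move=> i j; apply: falg_ext (generated_mul (generated_const _ (-1)) (generated_mul (generated_mul gV gV) (gF i j))) => U.
  by rewrite mxE; ring.
move=> D t0 Dv H c V u Hc; rewrite -scalemxAl mxtraceZ.
apply: (@dr_inv _ _ _ H (fun t => \det (c t))); last exact: HF.
by move: u; rewrite unitmxE unitfE.
Qed.

Lemma generated_smooth f : generated (@GL_coord R n) f -> smooth f.
Proof.
elim=> {f} [f|k|f g _ IHf _ IHg|f g _ IHf _ IHg].
- by case=> [[i [j ->]]|->]; [exact: smooth_coord|exact: smooth_det_inv].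
- exact: smooth_const.
- exact: smooth_add.
- exact: smooth_mul.
Qed.

End Gradient.

Section RealDerivative.
Variable R : realType.

Definition rderiv (t0 : R) (f : R -> R[i]) (v : R[i]) :=
  is_derive t0 1 (fun t => complex.Re (f t)) (complex.Re v) /\
  is_derive t0 1 (fun t => complex.Im (f t)) (complex.Im v).

Lemma ReD (x y : R[i]) : complex.Re (x + y) = complex.Re x + complex.Re y.
Proof. by case: x y => [? ?] [? ?]. Qed.
Lemma ImD (x y : R[i]) : complex.Im (x + y) = complex.Im x + complex.Im y.
Proof. by case: x y => [? ?] [? ?]. Qed.
Lemma ReN (x : R[i]) : complex.Re (- x) = - complex.Re x. Proof. by case: x. Qed.
Lemma ImN (x : R[i]) : complex.Im (- x) = - complex.Im x. Proof. by case: x. Qed.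
Lemma ReM (x y : R[i]) :
  complex.Re (x * y) = complex.Re x * complex.Re y - complex.Im x * complex.Im y.
Proof. by case: x y => [? ?] [? ?]. Qed.
Lemma ImM (x y : R[i]) :
  complex.Im (x * y) = complex.Re x * complex.Im y + complex.Im x * complex.Re y.
Proof. by case: x y => [? ?] [? ?]. Qed.
Lemma ReV (x : R[i]) :
  complex.Re x^-1 = complex.Re x / (complex.Re x ^+ 2 + complex.Im x ^+ 2).
Proof. by case: x. Qed.
Lemma ImV (x : R[i]) :
  complex.Im x^-1 = - complex.Im x / (complex.Re x ^+ 2 + complex.Im x ^+ 2).
Proof. by case: x => x y /=; rewrite mulNr. Qed.

Lemma sqnorm_neq0 (x : R[i]) : x != 0 -> complex.Re x ^+ 2 + complex.Im x ^+ 2 != 0.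
Proof.
case: x => x y; apply: contra => /=; rewrite paddr_eq0 ?sqr_ge0 // !sqrf_eq0.
by move=> /andP[/eqP -> /eqP ->].
Qed.

Lemma rderiv_rules t0 : deriv_rules t0 (rderiv t0).
Proof.
split.
- by move=> k; split; exact: is_derive_cst.
- move=> f g a b [f1 f2] [g1 g2]; split.
    have := is_deriveD f1 g1; rewrite -ReD.
    by rewrite (_ : _ + _ = (fun t => complex.Re (f t + g t))) //; apply/funext => t; rewrite ReD.
  have := is_deriveD f2 g2; rewrite -ImD.
  by rewrite (_ : _ + _ = (fun t => complex.Im (f t + g t))) //; apply/funext => t; rewrite ImD.
- move=> f g a b [f1 f2] [g1 g2]; split.
    have := is_deriveB (is_deriveM f1 g1) (is_deriveM f2 g2).
    rewrite (_ : _ - _ = (fun t => complex.Re (f t * g t))); last first.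
      by apply/funext => t; rewrite ReM.
    by move=> h; apply: is_derive_eq h _; rewrite ReD !ReM /GRing.scale /=; ring.
  have := is_deriveD (is_deriveM f1 g2) (is_deriveM f2 g1).
  rewrite (_ : _ + _ = (fun t => complex.Im (f t * g t))); last first.
    by apply/funext => t; rewrite ImM.
  by move=> h; apply: is_derive_eq h _; rewrite ImD !ImM /GRing.scale /=; ring.
move=> f a f0 [f1 f2]; have N0 := sqnorm_neq0 f0.
have dN : is_derive t0 1 (fun t => complex.Re (f t) ^+ 2 + complex.Im (f t) ^+ 2)
   (2 * (complex.Re (f t0) * complex.Re a + complex.Im (f t0) * complex.Im a)).
  have := is_deriveD (is_deriveM f1 f1) (is_deriveM f2 f2).
  rewrite (_ : _ + _ = (fun t => complex.Re (f t) ^+ 2 + complex.Im (f t) ^+ 2)); last first.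
    by apply/funext => t; rewrite !expr2.
  by move=> h; apply: is_derive_eq h _; rewrite /GRing.scale /=; ring.
have dV := @is_deriveV _ (fun t => complex.Re (f t) ^+ 2 + complex.Im (f t) ^+ 2) t0 _ 1 N0 dN.
split.
  have := is_deriveM f1 dV.
  rewrite (_ : _ * _ = (fun t => complex.Re (f t)^-1)); last first.
    by apply/funext => t; rewrite ReV.
  move=> h; apply: is_derive_eq h _.
  rewrite !expr2 ReM ReN ImN ReM ImM !ReV !ImV /GRing.scale /=; field.
  by rewrite -?expr2.
have := is_deriveM (is_deriveN f2) dV.
rewrite (_ : _ * _ = (fun t => complex.Im (f t)^-1)); last first.
  by apply/funext => t; rewrite ImV.
move=> h; apply: is_derive_eq h _.
rewrite ?opprfctE !expr2 ImM ReN ImN ReM ImM !ReV !ImV /GRing.scale /=; field.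
by rewrite -?expr2.
Qed.

End RealDerivative.

Section ComplexDerivative.
Variable R : realType.

Definition cderiv (t0 : R[i]^o) (f : R[i] -> R[i]) (v : R[i]) :=
  is_derive t0 (1 : R[i]^o) (f : R[i]^o -> R[i]^o) v.

Lemma cderiv_rules (t0 : R[i]^o) : deriv_rules (t0 : R[i]) (cderiv t0).
Proof.
split.
- by move=> k; exact: is_derive_cst.
- by move=> f g a b df dg; exact: is_deriveD.
- by move=> f g a b df dg; exact: is_deriveM.
move=> f a f0 [df da]; split; first exact: derivableV.
by rewrite (deriveV f0 df) da /GRing.scale /= exprVn.
Qed.

End ComplexDerivative.

Section SeriesBound.
Variable R : realType.

Lemma series_quadratic_bound (y : nat -> R) (r s : R) : 0 <= r <= 1 -> 0 <= s ->
  (forall k, `|y k| <= r ^+ k * exp_coeff s k) ->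
  cvgn (series y) /\ `|limn (series y) - (y 0%N + y 1%N)| <= r ^+ 2 * expR s.
Proof.
move=> /andP[r0 r1] s0 H.
have ec0 k : 0 <= exp_coeff s k by exact: exp_coeff_ge0.
have H1 k : `|y k| <= exp_coeff s k.
  by apply: le_trans (H k) _; rewrite ler_piMl // exprn_ile1.
have cy : cvgn (series y).
  apply: normed_cvg; apply: (series_le_cvg (v_ := exp_coeff s)) => //.
    by move=> k; exact: normr_ge0.
  exact: is_cvg_series_exp_coeff.
split=> //.
have cyc : (fun N => `|series y N - (y 0%N + y 1%N)|) @ \oo --> `|limn (series y) - (y 0%N + y 1%N)|.
  by apply: cvg_norm; apply: cvgB; [exact: cy|exact: cvg_cst].
rewrite -(cvg_lim (@Rhausdorff R) cyc); apply: limr_le; first exact: cvgP cyc.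
near=> N; have N2 : (2 <= N)%N by near: N; exact: nbhs_infty_ge.
have -> : series y N - (y 0%N + y 1%N) = \sum_(2 <= k < N) y k.
  rewrite /series /= (big_cat_nat (n := 2)) //= big_nat_recr //= big_nat1.
  by rewrite [LHS]addrC addKr.
apply: le_trans (ler_norm_sum _ _ _) _.
have : \sum_(2 <= k < N) `|y k| <= r ^+ 2 * \sum_(0 <= k < N) exp_coeff s k.
  rewrite mulr_sumr [X in _ <= X](big_cat_nat (n := 2)) //=.
  rewrite -[X in X <= _]add0r; apply: lerD.
    by apply: sumr_ge0 => k _; rewrite mulr_ge0 // exprn_ge0.
  rewrite !big_nat; apply: ler_sum => k /andP[k2 _]; apply: le_trans (H k) _.
  rewrite ler_wpM2r // -(subnK k2) exprD ler_piMl ?exprn_ge0 //.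
  exact: exprn_ile1.
move/le_trans; apply; rewrite ler_wpM2l ?exprn_ge0 //.
apply: (@nondecreasing_cvgn_le _ (series (exp_coeff s))); last exact: is_cvg_series_exp_coeff.
by apply: nondecreasing_series => k _ _.
Unshelve. all: by end_near. Qed.

Lemma normr_normc (z : R[i]) : `|z| = (normc z)%:C.
Proof. by rewrite normc_def; case: z. Qed.

Lemma normc_ge0 (z : R[i]) : 0 <= normc z.
Proof. by case: z => a b /=; exact: sqrtr_ge0. Qed.

Lemma Re_le_normc (z : R[i]) : `|complex.Re z| <= normc z.
Proof. by rewrite -lecR -normr_normc; exact: normc_ge_Re. Qed.

Lemma Im_le_normc (z : R[i]) : `|complex.Im z| <= normc z.
Proof.
case: z => a b /=; rewrite -sqrtr_sqr ler_sqrt ?addr_ge0 ?sqr_ge0 //.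
by rewrite lerDr sqr_ge0.
Qed.

Lemma normc_le_ReIm (z : R[i]) : normc z <= `|complex.Re z| + `|complex.Im z|.
Proof.
have -> : z = (complex.Re z)%:C + (0 +i* complex.Im z).
  by case: z => a b; apply/eqP; rewrite eq_complex /= addr0 add0r !eqxx.
apply: le_trans (le_normcD _ _) _.
by case: z => a b; rewrite /= !(expr0n, addr0, add0r) !sqrtr_sqr.
Qed.

Lemma gt0_complex (e : R[i]) : 0 < e -> exists2 d : R, 0 < d & e = d%:C.
Proof.
case: e => a b; rewrite ltcE /= => /andP[/eqP -> a0].
by exists a.
Qed.

Lemma cvg_complex (u : nat -> R[i]) (a b : R) :
  (fun k => complex.Re (u k)) @ \oo --> a -> (fun k => complex.Im (u k)) @ \oo --> b ->
  (u : nat -> R[i]^o) @ \oo --> (a +i* b : R[i]^o).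
Proof.
move=> /cvgrPdist_lt Ha /cvgrPdist_lt Hb; apply/cvgrPdist_lt => e /gt0_complex[d d0 ->].
have d2 : 0 < d / 2 by rewrite divr_gt0.
near=> k; rewrite normr_normc ltcR; apply: le_lt_trans (normc_le_ReIm _) _.
rewrite (splitr d); apply: ltrD.
  have -> : complex.Re ((a +i* b) - u k) = a - complex.Re (u k) by case: (u k).
  by near: k; exact: Ha.
have -> : complex.Im ((a +i* b) - u k) = b - complex.Im (u k) by case: (u k).
by near: k; exact: Hb.
Unshelve. all: by end_near. Qed.

Lemma complex_series_bound (y : nat -> R[i]) (r s : R) : 0 <= r <= 1 -> 0 <= s ->
  (forall k, normc (y k) <= r ^+ k * exp_coeff s k) ->
  normc (limn ((fun N => \sum_(k < N) y k) : nat -> R[i]^o) - (y 0%N + y 1%N)) <= 2 * (r ^+ 2 * expR s).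
Proof.
move=> r01 s0 H.
have [c1 b1] := series_quadratic_bound r01 s0 (fun k => le_trans (Re_le_normc (y k)) (H k)).
have [c2 b2] := series_quadratic_bound r01 s0 (fun k => le_trans (Im_le_normc (y k)) (H k)).
set a := limn (series (fun k => complex.Re (y k))) in c1 b1 *.
set b := limn (series (fun k => complex.Im (y k))) in c2 b2 *.
have cv : (fun N => \sum_(k < N) y k : R[i]^o) @ \oo --> (a +i* b : R[i]^o).
  apply: cvg_complex.
    rewrite (_ : (fun k => _) = series (fun k => complex.Re (y k))); first exact: c1.
    apply/funext => N; rewrite /series /= big_mkord.
    by elim/big_ind2: _ => // x1 x2 z1 z2 <- <-; rewrite ReD.
  rewrite (_ : (fun k => _) = series (fun k => complex.Im (y k))); first exact: c2.
  apply/funext => N; rewrite /series /= big_mkord.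
  by elim/big_ind2: _ => // x1 x2 z1 z2 <- <-; rewrite ImD.
rewrite (cvg_lim _ cv) //.
apply: le_trans (normc_le_ReIm _) _; rewrite mulr2n mulrDl mul1r; apply: lerD.
  by rewrite ReD ReN ReD.
by rewrite ImD ImN ImD.
Qed.

End SeriesBound.

Section ExpDerivative.
Variable R : realType.

Lemma normcX (z : R[i]) k : normc (z ^+ k) = normc z ^+ k.
Proof. by elim: k => [|k IH]; [rewrite !expr0 normc1|rewrite !exprS normcM IH]. Qed.

Lemma normc_nat k : normc (k%:R : R[i]) = k%:R.
Proof.
have -> : (k%:R : R[i]) = (k%:R)%:C by rewrite rmorph_nat.
by rewrite /= expr0n addr0 sqrtr_sqr normr_nat.
Qed.

Lemma normc_sum (I : Type) (r : seq I) (F : I -> R[i]) :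
  normc (\sum_(i <- r) F i) <= \sum_(i <- r) normc (F i).
Proof.
elim: r => [|i r IH]; first by rewrite !big_nil normc0.
rewrite !big_cons; apply: le_trans (le_normcD _ _) _.
by rewrite lerD2l.
Qed.

Lemma normc_mx_exp n (x : 'M[R[i]]_n) k i j :
  normc ((x ^+ k) i j) <= (\sum_i \sum_j normc (x i j)) ^+ k.
Proof.
set s := \sum_i _; have s0 : 0 <= s by do 2!apply: sumr_ge0 => ? _; exact: normc_ge0.
elim: k i j => [|k IH] i j.
  by rewrite !expr0 mxE; case: eqP => _; rewrite ?normc1 ?normc0.
rewrite exprS -mulmxE mxE; apply: le_trans (normc_sum _ _) _.
apply: (@le_trans _ _ (\sum_l normc (x i l) * s ^+ k)).
  by apply: ler_sum => l _; rewrite normcM ler_wpM2l ?normc_ge0.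
rewrite -mulr_suml exprS ler_wpM2r ?exprn_ge0 // /s [leRHS](bigD1 i) //= lerDl.
by do 2!apply: sumr_ge0 => ? _; exact: normc_ge0.
Qed.

Lemma scalemx_exp n (x : 'M[R[i]]_n) (t : R[i]) k : (t *: x) ^+ k = t ^+ k *: x ^+ k.
Proof.
elim: k => [|k IH]; first by rewrite !expr0 scale1r.
by rewrite !exprS IH -!mulmxE -scalemxAl -scalemxAr scalerA.
Qed.

Lemma expmx_bound n (x : 'M[R[i]]_n) i j : exists C : R, forall t : R[i], normc t <= 1 ->
  normc (expmx (t *: x) i j - ((i == j)%:R + t * x i j)) <= C * normc t ^+ 2.
Proof.
pose s := \sum_i \sum_j normc (x i j).
have s0 : 0 <= s by do 2!apply: sumr_ge0 => ? _; exact: normc_ge0.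
exists (2 * expR s) => t t1; rewrite mxE.
pose y k : R[i] := (k`!%:R)^-1 * (t ^+ k * (x ^+ k) i j).
have -> : (fun N => (\sum_(k < N) (k`!%:R)^-1 *: (t *: x) ^+ k) i j : R[i]^o) =
    (fun N => \sum_(k < N) y k : R[i]^o).
  apply/funext => N; rewrite summxE; apply: eq_bigr => k _.
  by rewrite scalemx_exp !mxE.
have -> : (i == j)%:R + t * x i j = y 0%N + y 1%N.
  by rewrite /y !expr0 !expr1 fact0 invr1 !mul1r mxE.
have := @complex_series_bound R y (normc t) s; rewrite normc_ge0 t1 s0 => /(_ isT isT).
rewrite (_ : 2 * (normc t ^+ 2 * expR s) = 2 * expR s * normc t ^+ 2); last by ring.
apply.
move=> k; rewrite /y !normcM normcV normc_nat normcX /exp_coeff /=.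
rewrite mulrCA ler_wpM2l ?exprn_ge0 ?normc_ge0 // mulrC ler_wpM2r ?invr_ge0 ?ler0n //.
exact: normc_mx_exp.
Qed.

Lemma cderiv0_bound (f : R[i] -> R[i]) (a b : R[i]) (C : R) :
  (forall t, normc t <= 1 -> normc (f t - (a + t * b)) <= C * normc t ^+ 2) ->
  f 0 = a /\ cderiv (0 : R[i]^o) f b.
Proof.
move=> H.
have f0 : f 0 = a.
  have := H 0; rewrite normc0 ler01 => /(_ isT); rewrite expr0n mulr0 mul0r addr0.
  move=> h; apply/eqP; rewrite -subr_eq0; apply/eqP/eq0_normc/eqP.
  by rewrite eq_le h normc_ge0.
split=> //.
have C0 : 0 <= C.
  have := H 1; rewrite normc1 lexx => /(_ isT); rewrite expr1n mulr1.
  by apply: le_trans; exact: normc_ge0.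
have cv : (fun h : R[i]^o => h^-1 *: (((f : R[i]^o -> R[i]^o) \o shift 0) (h *: (1 : R[i]^o)) - f 0)) @ 0^' --> (b : R[i]^o).
  apply/cvgrPdist_lt => e /gt0_complex[d d0 ->].
  have C1 : 0 < C + 1 by rewrite ltr_wpDl.
  have m0 : 0 < Num.min 1 (d / (C + 1)) by rewrite lt_min ltr01 divr_gt0.
  near=> h.
  have h0 : h != 0 by near: h; exact: nbhs_dnbhs_neq.
  have hm : normc h < Num.min 1 (d / (C + 1)).
    rewrite -ltcR -normr_normc; near: h; apply: dnbhs0_lt.
    by rewrite ltcR.
  move: hm; rewrite lt_min => /andP[h1 hd].
  have nh0 : normc h != 0 by apply: contra_neq h0; exact: eq0_normc.
  have nh : 0 < normc h by rewrite lt_neqAle eq_sym nh0 normc_ge0.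
  rewrite normr_normc ltcR /= /GRing.scale /= mulr1 addr0 f0.
  have -> : b - h^-1 * (f h - a) = - (h^-1 * (f h - (a + h * b))) by field.
  rewrite normcN normcM normcV ltr_pdivrMl //.
  apply: le_lt_trans (H h (ltW h1)) _.
  rewrite expr2 mulrA [ltRHS]mulrC ltr_pM2r //.
  apply: le_lt_trans (_ : (C + 1) * normc h < _); last by rewrite mulrC -ltr_pdivlMr.
  by rewrite ler_wpM2r ?normc_ge0 // lerDl.
split; first exact: cvgP cv.
exact: (cvg_lim _ cv).
Unshelve. all: by end_near. Qed.

Lemma cderiv_expmx n (x : 'M[R[i]]_n) i j :
  cderiv (0 : R[i]^o) (fun t => expmx (t *: x) i j) (x i j) /\ expmx (0 *: x) i j = (i == j)%:R.
Proof.
have [C HC] := expmx_bound x i j.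
have [f0 d] := @cderiv0_bound (fun t => expmx (t *: x) i j) _ _ C HC.
by split; [exact: d|exact: f0].
Qed.

End ExpDerivative.

Opaque expmx.

Section Gradients.
Variables (R : realType) (n : nat).
Implicit Types (U x X V : 'M[R[i]]_n).

Lemma cderiv_continuous (t0 : R[i]) (f : R[i] -> R[i]) v : cderiv t0 f v ->
  (f : R[i]^o -> R[i]^o) y @[y --> (t0 : R[i]^o)] --> (f t0 : R[i]^o).
Proof. by move=> [df _]; exact/differentiable_continuous/derivable1_diffP. Qed.

Definition has_gradient (f : 'M[R[i]]_n -> R[i]) G := generated_mx G /\
  exists g, [/\ generated (@GL_coord R n) g, is_gradient g G & forall U, U \in unitmx -> f U = g U].

Lemma regular_gradient f : regular f -> exists G, has_gradient f G.
Proof.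
move=> [g gg fg]; have [_ [G gG HG]] := generated_smooth gg.
by exists G; split=> //; exists g.
Qed.

Lemma cderiv_curve f G (c : R[i] -> 'M[R[i]]_n) V : has_gradient f G ->
  c 0 \in unitmx -> (forall i j, cderiv (0 : R[i]^o) (fun t => c t i j) (V i j)) ->
  cderiv (0 : R[i]^o) (fun t => f (c t)) (\tr (G (c 0) *m V)).
Proof.
move=> [_ [g [_ Hg fg]]] u0 Hc.
have dg := Hg _ _ _ (cderiv_rules (0 : R[i]^o)) c V u0 Hc.
have [_ [F _ HF]] := smooth_det R n.
have dd := HF _ _ _ (cderiv_rules (0 : R[i]^o)) c V u0 Hc.
have cd := cderiv_continuous dd.
have d0 : \det (c 0) != 0 by move: u0; rewrite unitmxE unitfE.
have [d dpos dE] : exists2 d : R, 0 < d & `|\det (c 0)| = d%:C.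
  by apply: gt0_complex; rewrite normr_gt0.
have nr : \forall t \near (0 : R[i]^o), (g (c t) : R[i]^o) = f (c t).
  near=> t; apply/esym/fg; rewrite unitmxE unitfE.
  have : `|\det (c 0) - \det (c t)| < d%:C.
    by near: t; move/cvgrPdist_lt: cd; apply; rewrite ltcR.
  by apply: contraTneq => ->; rewrite subr0 dE ltxx.
exact: (near_eq_is_derive nr dg).
Unshelve. all: by end_near. Qed.

Lemma cderiv_curve_at f G (c : R[i] -> 'M[R[i]]_n) U V : has_gradient f G ->
  c 0 = U -> U \in unitmx -> (forall i j, cderiv (0 : R[i]^o) (fun t => c t i j) (V i j)) ->
  cderiv (0 : R[i]^o) (fun t => f (c t)) (\tr (G U *m V)).
Proof. by move=> HG <-; exact: cderiv_curve. Qed.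

Definition lie_proj (G : gtype) X := if G is SL then X - (\tr X / n%:R)%:M else X.

Lemma lie_proj_in G X : inLie G (lie_proj G X).
Proof.
case: G => //=; rewrite /inLie /= linearB /= mxtrace_scalar.
case: (posnP n) => [n0|n0].
  have -> : \tr X = 0 by rewrite /mxtrace big1 // => i _; have := ltn_ord i; rewrite {2}n0.
  by rewrite mul0r mul0rn subrr.
by rewrite -(mulr_natr (_ / _)) mulfVK ?subrr // pnatr_eq0 -lt0n.
Qed.

Lemma mxtrace_lie_proj G X x : inLie G x -> \tr (lie_proj G X *m x) = \tr (X *m x).
Proof.
case: G => //= tx; rewrite mulmxBl linearB /= mul_scalar_mx mxtraceZ tx mulr0.
exact: subr0.
Qed.

Lemma mxtrace_lie_nondegenerate G X : inLie G X ->
  (forall x, inLie G x -> \tr (X *m x) = 0) -> X = 0.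
Proof.
case: G => /= tX H; last first.
  apply/matrixP => i j; rewrite [RHS]mxE -mxtrace_delta; exact: H.
have off (i j : 'I_n) : i != j -> X i j = 0.
  move=> ij; rewrite -mxtrace_delta; apply: H; rewrite /inLie /= /mxtrace big1 // => k _.
  rewrite mxE; case: andP => // -[/eqP kj /eqP ki]; move: ij.
  by rewrite -ki -kj eqxx.
have dg (i j : 'I_n) : X i i = X j j.
  apply/eqP; rewrite -subr_eq0 -!mxtrace_delta -linearB /= -mulmxBr; apply/eqP/H.
  by rewrite /inLie /= linearB /= !mxtrace_delta_diag subrr.
apply/matrixP => i j; rewrite [RHS]mxE; have [<-|/off //] := eqVneq i j.
move: tX; rewrite /inLie /= /mxtrace (eq_bigr (fun=> X i i)); last by move=> k _; exact: dg.
rewrite sumr_const card_ord -mulr_natr => /eqP; rewrite mulf_eq0 pnatr_eq0 => /orP[/eqP //|].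
by move=> /eqP n0; have := ltn_ord i; rewrite {2}n0.
Qed.

Lemma lie_proj_unique G X Y : inLie G Y ->
  (forall x, inLie G x -> \tr (Y *m x) = \tr (X *m x)) -> Y = lie_proj G X.
Proof.
move=> LY H; apply/eqP; rewrite -subr_eq0; apply/eqP/(@mxtrace_lie_nondegenerate G).
  case: G LY {H} => //=; rewrite /inLie /= => tY.
  by rewrite linearB /= tY (lie_proj_in SL) subr0.
by move=> x Lx; rewrite mulmxBl linearB /= mxtrace_lie_proj // H // subrr.
Qed.

Lemma gradLE G f F U : has_gradient f F -> U \in unitmx ->
  gradL G f U = lie_proj G (F U *m U).
Proof.
move=> HF uU; rewrite /gradL.
have D x : is_derive (0 : R[i]^o) (1 : R[i]^o)
    (fun t : R[i]^o => f (U *m expmx (t *: x)) : R[i]^o) (\tr (F U *m U *m x)).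
  have U0 : U *m expmx (0 *: x) = U.
    rewrite -[RHS]mulmx1; congr (_ *m _); apply/matrixP => i j.
    by rewrite (cderiv_expmx x i j).2 mxE.
  have Dx := dr_mulmxl (cderiv_rules (0 : R[i]^o)) U (fun i j => (cderiv_expmx x i j).1).
  rewrite -mulmxA; exact: (cderiv_curve_at HF U0 uU Dx).
have P : is_gradL G f U (lie_proj G (F U *m U)).
  split; first exact: lie_proj_in.
  by move=> x Lx; rewrite mxtrace_lie_proj.
apply: xget_unique => // Y [LY HY]; apply: lie_proj_unique => // x Lx.
by have [_ <-] := HY x Lx; have [_ <-] := D x.
Qed.

Lemma gradRE G f F U : has_gradient f F -> U \in unitmx ->
  gradR G f U = lie_proj G (U *m F U).
Proof.
move=> HF uU; rewrite /gradR.
have D x : is_derive (0 : R[i]^o) (1 : R[i]^o)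
    (fun t : R[i]^o => f (expmx (t *: x) *m U) : R[i]^o) (\tr (U *m F U *m x)).
  have U0 : expmx (0 *: x) *m U = U.
    rewrite -[RHS]mul1mx; congr (_ *m _); apply/matrixP => i j.
    by rewrite (cderiv_expmx x i j).2 mxE.
  have Dx := dr_mulmxr (cderiv_rules (0 : R[i]^o)) U (fun i j => (cderiv_expmx x i j).1).
  rewrite -mulmxA mxtrace_mulC -mulmxA; exact: (cderiv_curve_at HF U0 uU Dx).
have P : is_gradR G f U (lie_proj G (U *m F U)).
  split; first exact: lie_proj_in.
  by move=> x Lx; rewrite mxtrace_lie_proj.
apply: xget_unique => // Y [LY HY]; apply: lie_proj_unique => // x Lx.
by have [_ <-] := HY x Lx; have [_ <-] := D x.
Qed.

Lemma grad_diff G f F U : has_gradient f F -> U \in unitmx ->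
  gradL G f U - gradR G f U = F U *m U - U *m F U.
Proof.
move=> HF uU; rewrite (gradLE G HF uU) (gradRE G HF uU); case: G => //=.
by rewrite (mxtrace_mulC U) opprB addrA subrK.
Qed.

End Gradients.

(** * The bracket in terms of gradients *)

Section Triangular.
Variables (R : realType) (n : nat).
Implicit Types (A B x y : 'M[R[i]]_n).

Lemma mxtraceB A B : \tr (A - B) = \tr A - \tr B.
Proof. exact: linearB. Qed.

Lemma mxtraceN A : \tr (- A) = - \tr A.
Proof. exact: linearN. Qed.

Lemma mxtrace_strict_upper A B : strict_upper A -> upper_tri B -> \tr (A *m B) = 0.
Proof.
move=> HA HB; rewrite /mxtrace big1 // => i _; rewrite mxE big1 // => k _.
by case: (leqP k i) => ki; [rewrite HA ?mul0r|rewrite HB ?mulr0].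
Qed.

Lemma mxtrace_strict_lower A B : strict_lower A -> lower_tri B -> \tr (A *m B) = 0.
Proof.
move=> HA HB; rewrite /mxtrace big1 // => i _; rewrite mxE big1 // => k _.
by case: (leqP i k) => ki; [rewrite HA ?mul0r|rewrite HB ?mulr0].
Qed.

Lemma strict_upperW A : strict_upper A -> upper_tri A.
Proof. by move=> H i j /ltnW; exact: H. Qed.

Lemma strict_lowerW A : strict_lower A -> lower_tri A.
Proof. by move=> H i j /ltnW; exact: H. Qed.

Lemma upper_part_strict x : strict_upper (upper_part x).
Proof. by move=> i j ji; rewrite mxE ltnNge ji. Qed.

Lemma lower_part_strict x : strict_lower (lower_part x).
Proof. by move=> i j ji; rewrite mxE ltnNge ji. Qed.

Lemma diag_part_upper x : upper_tri (diag_part x).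
Proof. by move=> i j ji; rewrite mxE -val_eqE gtn_eqF. Qed.

Lemma diag_part_lower x : lower_tri (diag_part x).
Proof. by move=> i j ji; rewrite mxE -val_eqE ltn_eqF. Qed.

Lemma triangular_decomp x : x = upper_part x + lower_part x + diag_part x.
Proof.
apply/matrixP => i j; rewrite !mxE -val_eqE.
by case: ltngtP => _; rewrite ?addr0 ?add0r.
Qed.

Lemma is_diag_upper x : is_diag_mx x -> upper_tri x.
Proof. by move=> /is_diag_mxP H i j ji; apply: H; rewrite neq_ltn ji orbT. Qed.

Lemma is_diag_lower x : is_diag_mx x -> lower_tri x.
Proof. by move=> /is_diag_mxP H i j ji; apply: H; rewrite neq_ltn ji. Qed.

Lemma mxtrace_triangular a b d y : strict_upper a -> strict_lower b -> is_diag_mx d ->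
  \tr ((a + b + d) *m y) =
  \tr (a *m lower_part y) + \tr (b *m upper_part y) + \tr (d *m diag_part y).
Proof.
move=> ua lb dd; rewrite {1}[y]triangular_decomp !mulmxDl !mulmxDr !mxtraceD.
rewrite (mxtrace_strict_upper ua (strict_upperW (upper_part_strict y))).
rewrite (mxtrace_strict_upper ua (@diag_part_upper y)).
rewrite (mxtrace_strict_lower lb (strict_lowerW (lower_part_strict y))).
rewrite (mxtrace_strict_lower lb (@diag_part_lower y)).
rewrite (mxtrace_mulC d (upper_part y)) (mxtrace_strict_upper (upper_part_strict y) (is_diag_upper dd)).
rewrite (mxtrace_mulC d (lower_part y)) (mxtrace_strict_lower (lower_part_strict y) (is_diag_lower dd)).
by rewrite !(addr0, add0r).
Qed.

End Triangular.

Section Rplus.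
Variables (R : realType) (n : nat) (G : gtype) (T : BDtriple n).
Variable R0 : {linear 'M[R[i]]_n -> 'M[R[i]]_n}.
Implicit Types (x y z U : 'M[R[i]]_n).

Let Eu x : 'M[R[i]]_n := \sum_(0 <= k < n) iter k (gamma_up T) x.
Let El x : 'M[R[i]]_n := \sum_(1 <= k < n) iter k (gamma_adj T) x.

Lemma gamma_upD x y : gamma_up T (x + y) = gamma_up T x + gamma_up T y.
Proof.
rewrite !gamma_upE -big_split; apply: eq_bigr => i _; rewrite -big_split.
by apply: eq_bigr => j _; rewrite mxE scalerDl.
Qed.

Lemma gamma_upZ c x : gamma_up T (c *: x) = c *: gamma_up T x.
Proof.
rewrite !gamma_upE scaler_sumr; apply: eq_bigr => i _; rewrite scaler_sumr.
by apply: eq_bigr => j _; rewrite mxE scalerA.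
Qed.

Lemma gamma_adjD x y : gamma_adj T (x + y) = gamma_adj T x + gamma_adj T y.
Proof.
apply/matrixP => i j; rewrite !mxE; case: ifP => _; last by rewrite addr0.
by rewrite mulmxDl mxtraceD.
Qed.

Lemma gamma_adjZ c x : gamma_adj T (c *: x) = c *: gamma_adj T x.
Proof.
apply/matrixP => i j; rewrite !mxE; case: ifP => _; last by rewrite mulr0.
by rewrite -scalemxAl mxtraceZ.
Qed.

Lemma iterD_additive (f : 'M[R[i]]_n -> 'M[R[i]]_n) k x y :
  (forall x y, f (x + y) = f x + f y) -> iter k f (x + y) = iter k f x + iter k f y.
Proof. by move=> fD; elim: k => //= k ->. Qed.

Lemma iterZ_scalable (f : 'M[R[i]]_n -> 'M[R[i]]_n) k c x :
  (forall c x, f (c *: x) = c *: f x) -> iter k f (c *: x) = c *: iter k f x.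
Proof. by move=> fZ; elim: k => //= k ->. Qed.

Lemma EuD x y : Eu (x + y) = Eu x + Eu y.
Proof.
rewrite /Eu -big_split; apply: eq_bigr => k _.
by rewrite iterD_additive //; exact: gamma_upD.
Qed.

Lemma ElD x y : El (x + y) = El x + El y.
Proof.
rewrite /El -big_split; apply: eq_bigr => k _.
by rewrite iterD_additive //; exact: gamma_adjD.
Qed.

Lemma RplusD x y : Rplus T R0 (x + y) = Rplus T R0 x + Rplus T R0 y.
Proof.
rewrite /Rplus -!/(Eu _) -!/(El _).
have -> : upper_part (x + y) = upper_part x + upper_part y.
  by apply/matrixP => i j; rewrite !mxE; case: ifP; rewrite ?addr0.
have -> : lower_part (x + y) = lower_part x + lower_part y.
  by apply/matrixP => i j; rewrite !mxE; case: ifP; rewrite ?addr0.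
have -> : diag_part (x + y) = diag_part x + diag_part y.
  by apply/matrixP => i j; rewrite !mxE; case: ifP; rewrite ?addr0.
rewrite EuD ElD (linearD R0).
by apply/matrixP => i j; rewrite !mxE; ring.
Qed.

Lemma RplusZ c x : Rplus T R0 (c *: x) = c *: Rplus T R0 x.
Proof.
rewrite /Rplus.
have -> : upper_part (c *: x) = c *: upper_part x.
  by apply/matrixP => i j; rewrite !mxE; case: ifP; rewrite ?mulr0.
have -> : lower_part (c *: x) = c *: lower_part x.
  by apply/matrixP => i j; rewrite !mxE; case: ifP; rewrite ?mulr0.
have -> : diag_part (c *: x) = c *: diag_part x.
  by apply/matrixP => i j; rewrite !mxE; case: ifP; rewrite ?mulr0.
rewrite linearZ /= !scalerDr scalerN !scaler_sumr; congr (_ - _ + _).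
  by apply: eq_bigr => k _; rewrite iterZ_scalable //; exact: gamma_upZ.
by apply: eq_bigr => k _; rewrite iterZ_scalable //; exact: gamma_adjZ.
Qed.

Lemma iter_gamma_up_strict k x : strict_upper x -> strict_upper (iter k (gamma_up T) x).
Proof. by case: k => [|k] H i j ji; [exact: H|exact: gamma_up_strict]. Qed.

Lemma iter_gamma_adj_strict k x : strict_lower x -> strict_lower (iter k (gamma_adj T) x).
Proof. by case: k => [|k] H i j ji; [exact: H|exact: gamma_adj_strict]. Qed.

Lemma Eu_strict x : strict_upper x -> strict_upper (Eu x).
Proof.
by move=> H i j ji; rewrite summxE big1 // => k _; exact: iter_gamma_up_strict.
Qed.

Lemma El_strict x : strict_lower x -> strict_lower (El x).
Proof.
by move=> H i j ji; rewrite summxE big1 // => k _; exact: iter_gamma_adj_strict.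
Qed.

Lemma mxtrace_Eu_El x y : strict_lower x -> strict_upper y ->
  \tr (x *m Eu y) - \tr (El x *m y) = \tr (x *m y).
Proof.
move=> lx uy; case: (posnP n) => [n0|n0].
  have tr0 (A : 'M[R[i]]_n) : \tr A = 0.
    by rewrite /mxtrace big1 // => i _; have := ltn_ord i; rewrite {2}n0.
  by rewrite !tr0 subr0.
have E1 : \tr (x *m Eu y) = \sum_(0 <= k < n) \tr (x *m iter k (gamma_up T) y).
  by rewrite mulmx_sumr linear_sum.
have E2 : \tr (El x *m y) = \sum_(1 <= k < n) \tr (x *m iter k (gamma_up T) y).
  rewrite mulmx_suml linear_sum; apply: eq_bigr => k _.
  exact: mxtrace_iter_gamma_adj.
by rewrite -/(Eu y) -/(El x) E1 E2 big_ltn // addrK.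
Qed.

Hypothesis hR0 : BD_quadruple G T R0.

Lemma Rplus_triangular x : cartan G (diag_part x) ->
  [/\ Rplus T R0 x = Eu (upper_part x) + - El (lower_part x) + R0 (diag_part x),
      strict_upper (Eu (upper_part x)), strict_lower (- El (lower_part x)) &
      is_diag_mx (R0 (diag_part x))].
Proof.
move=> cx; split=> //; first exact/Eu_strict/upper_part_strict.
  by move=> i j ij; rewrite mxE (El_strict (lower_part_strict x)) ?oppr0.
by have [+ _ _] := hR0 => /(_ _ cx) [].
Qed.

Lemma diag_part_diag x : is_diag_mx x -> diag_part x = x.
Proof.
move=> /is_diag_mxP H; apply/matrixP => i j; rewrite mxE; case: eqP => // /eqP ij.
by rewrite H.
Qed.

Lemma Rplus_adjoint x y : cartan G (diag_part x) -> cartan G (diag_part y) ->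
  \tr (Rplus T R0 x *m y) + \tr (x *m Rplus T R0 y) = \tr (x *m y).
Proof.
move=> cx cy.
have [-> ux lx dx] := Rplus_triangular cx; have [-> uy ly dy] := Rplus_triangular cy.
have ddx : is_diag_mx (diag_part x) by case: cx.
rewrite (mxtrace_triangular y ux lx dx) (mxtrace_mulC x) (mxtrace_triangular x uy ly dy).
rewrite [in RHS](triangular_decomp x) (mxtrace_triangular y (upper_part_strict x) (lower_part_strict x) ddx).
have E1 := mxtrace_Eu_El (lower_part_strict x) (upper_part_strict y).
have E2 := mxtrace_Eu_El (lower_part_strict y) (upper_part_strict x).
have [_ E3 _] := hR0; have {}E3 := E3 _ _ cx cy.
rewrite !mulNmx !mxtraceN -E3 -E1.
rewrite [\tr (upper_part x *m lower_part y)]mxtrace_mulC -E2.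
rewrite [\tr (lower_part x *m Eu _)]mxtrace_mulC [\tr (lower_part y *m Eu _)]mxtrace_mulC.
rewrite [\tr (diag_part x *m R0 _)]mxtrace_mulC.
move: (\tr (Eu (upper_part x) *m lower_part y)) (\tr (El (lower_part x) *m upper_part y))
  (\tr (R0 (diag_part x) *m diag_part y)) (\tr (Eu (upper_part y) *m lower_part x))
  (\tr (El (lower_part y) *m upper_part x)) (\tr (R0 (diag_part y) *m diag_part x)) => a b c d e f.
by ring.
Qed.

Lemma inLie_mxtrace0 x : \tr x = 0 -> inLie G x.
Proof. by case: G. Qed.

Lemma diag_part_cartan x : \tr x = 0 -> cartan G (diag_part x).
Proof.
move=> tx; split; first by apply/is_diag_mxP => i j ij; rewrite mxE -val_eqE (negbTE ij).
apply: inLie_mxtrace0; rewrite -tx; apply: eq_bigr => i _.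
by rewrite mxE eqxx.
Qed.

Lemma pbracketE f1 f2 F1 F2 U : has_gradient f1 F1 -> has_gradient f2 F2 -> U \in unitmx ->
  let z := F2 U *m U - U *m F2 U in
  pbracket G T R0 f1 f2 U =
  \tr (F1 U *m (Rplus T R0 z *m U - U *m (Rplus T R0 z - z))).
Proof.
move=> H1 H2 uU z; rewrite /pbracket !(grad_diff _ H1 uU) !(grad_diff _ H2 uU) -/z.
rewrite (gradLE G H2 uU).
set d1 := F1 U *m U - U *m F1 U.
have t1 : \tr d1 = 0 by rewrite linearB /= [X in _ - X]mxtrace_mulC subrr.
have tz : \tr z = 0 by rewrite linearB /= [X in _ - X]mxtrace_mulC subrr.
rewrite (mxtrace_mulC d1 (lie_proj _ _)) mxtrace_lie_proj; last exact: inLie_mxtrace0.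
have := Rplus_adjoint (diag_part_cartan t1) (diag_part_cartan tz).
move/(canRL (addrK _)) => ->.
rewrite (mxtrace_mulC (F2 U *m U)) -!mxtraceB -!mulmxBr.
set y := z - _ - _.
rewrite /d1 mulmxBl mxtraceB -mulmxA -[U *m F1 U *m y]mulmxA (mxtrace_mulC U) -mulmxA.
rewrite -mxtraceB -mulmxBr; congr (\tr (_ *m _)).
rewrite /y; move: (Rplus T R0 z) => p; rewrite /z; move: (F2 U) => f.
rewrite !(mulmxBr, mulmxBl) !mulmxA.
move: (p *m U) (U *m p) (f *m U *m U) (U *m f *m U) (U *m U *m f) => a b d e g.
by apply/matrixP => i j; rewrite !mxE; ring.
Qed.

End Rplus.

(** * Directions along one-parameter subgroups *)

Section ComplexExponential.
Variable R : realType.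
Implicit Types w a : R[i].

Definition cexp w : R[i] :=
  (expR (complex.Re w) * cos (complex.Im w)) +i* (expR (complex.Re w) * sin (complex.Im w)).

Lemma cexpD w a : cexp (w + a) = cexp w * cexp a.
Proof.
apply/eqP; rewrite eq_complex /= ReD ImD expRD cosD sinD.
by apply/andP; split; apply/eqP; ring.
Qed.

Lemma cexp0 : cexp 0 = 1.
Proof. by rewrite /cexp /= expR0 cos0 sin0 mulr1 mulr0. Qed.

Lemma cexp_neq0 w : cexp w != 0.
Proof.
apply/eqP => w0; have := cexpD w (- w); rewrite subrr cexp0 w0 mul0r.
by move/eqP; rewrite oner_eq0.
Qed.

Lemma rderiv_ext t0 (f g : R -> R[i]) v : f =1 g -> rderiv t0 f v -> rderiv t0 g v.
Proof. by move=> /funext ->. Qed.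

Lemma rderiv_unique t0 (f : R -> R[i]) v v' : rderiv t0 f v -> rderiv t0 f v' -> v = v'.
Proof.
move=> [[_ r] [_ i]] [[_ r'] [_ i']]; apply/eqP; rewrite eq_complex.
by rewrite -r -r' -i -i' !eqxx.
Qed.

Lemma rderiv_id (t0 : R) : rderiv t0 (fun t => t%:C) 1.
Proof. by split; [exact: is_derive_id|exact: is_derive_cst]. Qed.

Lemma rderiv_cexp a : rderiv (0 : R) (fun t => cexp (t%:C * a)) a.
Proof.
have E t : cexp (t%:C * a) = (expR (t * complex.Re a) * cos (t * complex.Im a)) +i*
   (expR (t * complex.Re a) * sin (t * complex.Im a)).
  by rewrite /cexp ReM ImM /= !mul0r subr0 addr0.
have lin (b : R) : is_derive (0 : R) 1 (fun t => t * b) b.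
  have := is_deriveM (is_derive_id (0 : R) 1) (is_derive_cst b (0 : R) 1).
  by move=> h; apply: is_derive_eq h _; rewrite /GRing.scale /=; ring.
have de : is_derive (0 : R) 1 (fun t => expR (t * complex.Re a)) (complex.Re a).
  have := @is_derive1_comp _ expR _ _ _ _ (is_derive_expR _) (lin (complex.Re a)).
  by move=> h; apply: is_derive_eq h _; rewrite mul0r expR0 /GRing.scale /= ?mulr1 ?mul1r.
have dc : is_derive (0 : R) 1 (fun t => cos (t * complex.Im a)) 0.
  have := @is_derive1_comp _ cos _ _ _ _ (is_derive_cos _) (lin (complex.Im a)).
  by move=> h; apply: is_derive_eq h _; rewrite mul0r sin0 /GRing.scale /=; ring.
have ds : is_derive (0 : R) 1 (fun t => sin (t * complex.Im a)) (complex.Im a).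
  have := @is_derive1_comp _ sin _ _ _ _ (is_derive_sin _) (lin (complex.Im a)).
  by move=> h; apply: is_derive_eq h _; rewrite mul0r cos0 /GRing.scale /= ?mulr1 ?mul1r.
apply: (rderiv_ext (fun t => esym (E t))); split => /=.
  have h := is_deriveM de dc; apply: is_derive_eq h _.
  by rewrite !mul0r cos0 expR0 /GRing.scale /=; ring.
have h := is_deriveM de ds; apply: is_derive_eq h _.
by rewrite !mul0r sin0 expR0 /GRing.scale /=; ring.
Qed.

Lemma rderiv_exp k : rderiv (0 : R) (fun t => t%:C ^+ k) (k == 1)%N%:R.
Proof.
elim: k => [|k IH]; first exact: (dr_const (rderiv_rules 0)).
have := dr_mul (rderiv_rules 0) (rderiv_id 0) IH.
rewrite mul0r add0r mulr1 => h.
have -> : (k.+1 == 1)%N%:R = 0%:C ^+ k :> R[i] by rewrite expr0n eqSS.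
by apply: rderiv_ext h => t; rewrite exprS.
Qed.

Lemma rderiv_nilexp n (X : 'M[R[i]]_n) : X ^+ n = 0 ->
  forall i j, rderiv (0 : R) (fun t => nilexp (t%:C *: X) i j) (X i j).
Proof.
move=> Xn i j.
have E t : \sum_(k < n) t%:C ^+ k * ((k`!%:R)^-1 * (X ^+ k) i j) = nilexp (t%:C *: X) i j.
  rewrite nilexpE summxE; apply: eq_bigr => k _.
  by rewrite mxE scalemx_exp mxE mulrCA.
apply: (rderiv_ext E).
have H : rderiv (0 : R) (fun t => \sum_(k < n) t%:C ^+ k * ((k`!%:R)^-1 * (X ^+ k) i j))
   (\sum_(k < n) (k == 1 :> nat)%N%:R * ((k`!%:R)^-1 * (X ^+ k) i j)).
  apply: (dr_sum (rderiv_rules 0)) => k.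
  have := dr_mul (rderiv_rules 0) (rderiv_exp k) (dr_const (rderiv_rules 0) ((k`!%:R)^-1 * (X ^+ k) i j)).
  by rewrite mulr0 add0r [X in rderiv _ _ X]mulrC.
suff <- : \sum_(k < n) (k == 1 :> nat)%N%:R * ((k`!%:R)^-1 * (X ^+ k) i j) = X i j by [].
case: (ltnP 1 n) => n1.
  rewrite (bigD1 (Ordinal n1)) //= big1 ?addr0 => [|k /negbTE k1].
    by rewrite mul1r invr1 mul1r expr1.
  by rewrite -val_eqE /= in k1; rewrite k1 mul0r.
have n1' : n = 1%N by have := ltn_ord i; lia.
have X0 : X = 0 by have := Xn; rewrite [X in _ ^+ X]n1' expr1.
by rewrite big1 ?X0 ?mxE // => k _; case: eqP => [->|_]; rewrite ?mul0r // expr1 mxE !mulr0.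
Qed.

End ComplexExponential.

Section Curves.
Variables (R : realType) (n : nat).
Implicit Types (U X Y : 'M[R[i]]_n).

Lemma rderiv_curve f F (c : R -> 'M[R[i]]_n) (V : 'M[R[i]]_n) (t0 : R) : has_gradient f F ->
  (forall t, c t \in unitmx) -> (forall i j, rderiv t0 (fun t => c t i j) (V i j)) ->
  rderiv t0 (fun t => f (c t)) (\tr (F (c t0) *m V)).
Proof.
move=> [_ [g [_ Hg fg]]] uc Hc.
apply: (@rderiv_ext _ _ (fun t => g (c t))); first by move=> t; rewrite fg.
exact: Hg (rderiv_rules t0) _ _ (uc t0) Hc.
Qed.

Variables (psi : 'M[R[i]]_n -> R[i]) (D : 'M[R[i]]_n -> 'M[R[i]]_n).
Hypothesis hD : has_gradient psi D.
Variables (P Q : R -> 'M[R[i]]_n) (X Y : 'M[R[i]]_n).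
Hypotheses (P0 : P 0 = 1%:M) (Q0 : Q 0 = 1%:M).
Hypotheses (uP : forall t, P t \in unitmx) (uQ : forall t, Q t \in unitmx).
Hypotheses (dP : forall i j, rderiv (0 : R) (fun t => P t i j) (X i j)).
Hypotheses (dQ : forall i j, rderiv (0 : R) (fun t => Q t i j) (Y i j)).

Lemma rderiv_curvel U : U \in unitmx -> rderiv (0 : R) (fun t => psi (P t *m U)) (\tr (D U *m (X *m U))).
Proof.
move=> uU; have := @rderiv_curve _ _ (fun t => P t *m U) (X *m U) 0 hD.
rewrite P0 mul1mx; apply; first by move=> t; rewrite unitmx_mul uP.
exact: (dr_mulmxr (rderiv_rules 0)).
Qed.

Lemma rderiv_curver U : U \in unitmx -> rderiv (0 : R) (fun t => psi (U *m Q t)) (\tr (D U *m (U *m Y))).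
Proof.
move=> uU; have := @rderiv_curve _ _ (fun t => U *m Q t) (U *m Y) 0 hD.
rewrite Q0 mulmx1; apply; first by move=> t; rewrite unitmx_mul uQ uU.
exact: (dr_mulmxl (rderiv_rules 0)).
Qed.

Lemma invariant_direction :
  (forall t U, U \in unitmx -> psi (P t *m U) = psi (U *m Q t)) ->
  forall U, U \in unitmx -> \tr (D U *m (X *m U - U *m Y)) = 0.
Proof.
move=> H U uU; rewrite mulmxBr mxtraceB; apply/eqP; rewrite subr_eq0; apply/eqP.
apply: rderiv_unique (rderiv_curvel uU) _.
by apply: rderiv_ext (rderiv_curver uU) => t; rewrite H.
Qed.

(** The character is not assumed differentiable in [t]; comparing two points
    eliminates it. *)
Lemma semi_invariant_direction :
  (forall t, exists chi, forall U, U \in unitmx -> psi (P t *m U) = chi * psi (U *m Q t)) ->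
  exists l, forall U, U \in unitmx -> \tr (D U *m (X *m U - U *m Y)) = l * psi U.
Proof.
move=> H.
pose a U := \tr (D U *m (X *m U)); pose b U := \tr (D U *m (U *m Y)).
have abE U : \tr (D U *m (X *m U - U *m Y)) = a U - b U.
  by rewrite mulmxBr mxtraceB; exact: erefl.
have E U U0 : U \in unitmx -> U0 \in unitmx -> (a U - b U) * psi U0 = (a U0 - b U0) * psi U.
  move=> uU uU0.
  have d1 := dr_mul (rderiv_rules 0) (rderiv_curvel uU) (rderiv_curver uU0).
  have d2 := dr_mul (rderiv_rules 0) (rderiv_curvel uU0) (rderiv_curver uU).
  have {d1 d2} := rderiv_unique d1 (rderiv_ext _ d2).
  rewrite P0 Q0 !mul1mx !mulmx1 -!/(a _) -!/(b _).
  move: (a U) (b U) (a U0) (b U0) => x y x0 y0 /(_ _)/(canRL (addKr _)) E.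
  have {}E := E _; rewrite !mulrBl [x * _]mulrC E.
    by ring.
  by move=> t; have [chi Hc] := H t; rewrite (Hc _ uU) (Hc _ uU0); ring.
have [[U0 uU0 nz]|Z] := pselect (exists2 U0, U0 \in unitmx & psi U0 != 0).
  exists ((a U0 - b U0) / psi U0) => U uU.
  by rewrite abE -[RHS]mulrAC -(E _ _ uU uU0) (mulfK nz); exact: erefl.
have Z0 U : U \in unitmx -> psi U = 0.
  by move=> uU; apply/eqP; apply: contrapT => /negP nz; apply: Z; exists U.
exists 0 => U uU; rewrite mul0r; apply: invariant_direction => // t V uV.
by rewrite !Z0 // unitmx_mul ?uP ?uV // uQ.
Qed.

End Curves.

Lemma sum_iter_nilpotent (V : nmodType) (f : V -> V) N z : iter N f z = 0 ->
  \sum_(0 <= k < N) f (iter k f z) = \sum_(1 <= k < N) iter k f z.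
Proof.
case: N => [|N] fz; first by rewrite !big_geq.
by rewrite big_nat_recr //= -iterS fz addr0 big_add1.
Qed.

Section Directions.
Variables (R : realType) (n : nat) (G : gtype) (T : BDtriple n).
Variable R0 : {linear 'M[R[i]]_n -> 'M[R[i]]_n}.
Hypothesis hR0 : BD_quadruple G T R0.
Implicit Types (U X Y x y z : 'M[R[i]]_n).

Lemma strict_upperZ k x : strict_upper x -> strict_upper (k *: x).
Proof. by move=> H i j ij; rewrite mxE H ?mulr0. Qed.

Lemma strict_lowerZ k x : strict_lower x -> strict_lower (k *: x).
Proof. by move=> H i j ij; rewrite mxE H ?mulr0. Qed.

Lemma upper_part_upper x : strict_upper x -> upper_part x = x.
Proof. by move=> H; apply/matrixP => i j; rewrite mxE; case: ltnP => // ji; rewrite H. Qed.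

Lemma lower_part_upper x : strict_upper x -> lower_part x = 0.
Proof. by move=> H; apply/matrixP => i j; rewrite !mxE; case: ltnP => // ji; rewrite H // ltnW. Qed.

Lemma diag_part_strict_upper x : strict_upper x -> diag_part x = 0.
Proof. by move=> H; apply/matrixP => i j; rewrite !mxE; case: eqP => // ->; rewrite H. Qed.

Lemma upper_part_lower x : strict_lower x -> upper_part x = 0.
Proof. by move=> H; apply/matrixP => i j; rewrite !mxE; case: ltnP => // ji; rewrite H // ltnW. Qed.

Lemma lower_part_lower x : strict_lower x -> lower_part x = x.
Proof. by move=> H; apply/matrixP => i j; rewrite mxE; case: ltnP => // ji; rewrite H. Qed.

Lemma diag_part_strict_lower x : strict_lower x -> diag_part x = 0.
Proof. by move=> H; apply/matrixP => i j; rewrite !mxE; case: eqP => // ->; rewrite H. Qed.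

Lemma gamma_up0 : gamma_up T 0 = 0 :> 'M[R[i]]_n.
Proof. by rewrite -{1}(scale0r (0 : 'M[R[i]]_n)) gamma_upZ scale0r. Qed.

Lemma gamma_adj0 : gamma_adj T 0 = 0 :> 'M[R[i]]_n.
Proof. by rewrite -{1}(scale0r (0 : 'M[R[i]]_n)) gamma_adjZ scale0r. Qed.

Lemma gamma_up_sum (I : Type) (r : seq I) (F : I -> 'M[R[i]]_n) :
  gamma_up T (\sum_(k <- r) F k) = \sum_(k <- r) gamma_up T (F k).
Proof.
elim: r => [|k r IH]; first by rewrite !big_nil; exact: gamma_up0.
by rewrite !big_cons gamma_upD IH.
Qed.

Lemma gamma_adj_sum (I : Type) (r : seq I) (F : I -> 'M[R[i]]_n) :
  gamma_adj T (\sum_(k <- r) F k) = \sum_(k <- r) gamma_adj T (F k).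
Proof.
elim: r => [|k r IH]; first by rewrite !big_nil; exact: gamma_adj0.
by rewrite !big_cons gamma_adjD IH.
Qed.

Lemma Rplus_upper z : (0 < n)%N -> strict_upper z -> exists X,
  [/\ Rplus T R0 z = X, strict_upper X & Rplus T R0 z - z = gamma_up T X].
Proof.
move=> n0 uz; pose X : 'M[R[i]]_n := \sum_(0 <= k < n) iter k (gamma_up T) z.
have E : Rplus T R0 z = X.
  rewrite /Rplus (upper_part_upper uz) (lower_part_upper uz) (diag_part_strict_upper uz).
  rewrite linear0 addr0 [X in _ - X]big_nat_cond [X in _ - X]big1 ?subr0 //.
  by move=> k _; elim: k => //= k ->; exact: gamma_adj0.
exists X; split=> //; first exact: Eu_strict.
rewrite E /X gamma_up_sum big_ltn //= addrC addKr.
by rewrite sum_iter_nilpotent //; exact: gamma_up_nilpotent.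
Qed.

Lemma Rplus_lower z : (0 < n)%N -> strict_lower z -> exists Y,
  [/\ Rplus T R0 z - z = Y, strict_lower Y & Rplus T R0 z = gamma_adj T Y].
Proof.
move=> n0 lz; pose Y : 'M[R[i]]_n := - \sum_(0 <= k < n) iter k (gamma_adj T) z.
have E : Rplus T R0 z = - \sum_(1 <= k < n) iter k (gamma_adj T) z.
  rewrite /Rplus (upper_part_lower lz) (lower_part_lower lz) (diag_part_strict_lower lz).
  rewrite linear0 addr0 [X in X - _]big_nat_cond [X in X - _]big1 ?sub0r //.
  by move=> k _; elim: k => //= k ->; exact: gamma_up0.
exists Y; split.
- by rewrite E /Y [in RHS]big_ltn // opprD addrC.
- move=> i j ij; rewrite mxE summxE big1 ?oppr0 // => k _.
  by rewrite (iter_gamma_adj_strict T k lz).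
rewrite E /Y -[in RHS]scaleN1r gamma_adjZ scaleN1r gamma_adj_sum; congr (- _).
by rewrite sum_iter_nilpotent //; exact: gamma_adj_nilpotent.
Qed.

Section Psi.
Variables (psi : 'M[R[i]]_n -> R[i]) (D : 'M[R[i]]_n -> 'M[R[i]]_n).
Hypotheses (hD : has_gradient psi D) (epsi : ext_semi_invariant T psi).

Definition bracket_dir z U : R[i] :=
  \tr (D U *m (Rplus T R0 z *m U - U *m (Rplus T R0 z - z))).

Lemma bracket_dirD x y U : bracket_dir (x + y) U = bracket_dir x U + bracket_dir y U.
Proof.
rewrite /bracket_dir -mxtraceD -mulmxDr RplusD; congr (\tr (_ *m _)).
move: (Rplus T R0 x) (Rplus T R0 y) => a b; rewrite !(mulmxBr, mulmxDl, mulmxDr).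
by apply/matrixP => i j; rewrite !mxE; ring.
Qed.

Lemma bracket_dirZ k x U : bracket_dir (k *: x) U = k * bracket_dir x U.
Proof.
rewrite /bracket_dir -mxtraceZ scalemxAr RplusZ; congr (\tr (_ *m _)).
by rewrite -scalerBr -scalemxAl -scalemxAr -scalerBr.
Qed.

Lemma ext_rel_invariant c P Q : nz_scalars c -> group_rel T c P Q ->
  exists chi, forall U, U \in unitmx -> psi (P *m U) = chi * psi (U *m Q).
Proof.
move=> c0 H; have [rs [_ /(_ c c0) [k [_ E]]]] := epsi.
exists (k * \prod_(r <- rs) (trailing_minor r.1 P / trailing_minor r.2 Q)) => U uU.
have [_ uQ _ _ _] := H.
by rewrite -(E _ _ _ H) ?unitmx_mul ?uU // mulmxA mulmxK.
Qed.

Lemma ext_unip_invariant P Q U : group_rel T (cst1 R) P Q ->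
  (forall r, trailing_minor r P = 1) -> (forall r, trailing_minor r Q = 1) ->
  U \in unitmx -> psi (P *m U) = psi (U *m Q).
Proof.
move=> H tP tQ uU; have [rs [_ /(_ (cst1 R) (fun _ _ _ _ => oner_neq0 _)) [k [k1 E]]]] := epsi.
have [_ uQ _ _ _] := H.
have := E P Q (U *m Q) H; rewrite mulmxA mulmxK // unitmx_mul uU uQ => -> //.
rewrite k1 // big1 ?mul1r // => r _.
by rewrite tP tQ divr1.
Qed.

Lemma strict_direction X Y : lie_rel T X Y -> X ^+ n = 0 -> Y ^+ n = 0 ->
  (forall t r, trailing_minor r (nilexp (t *: X)) = 1) ->
  (forall t r, trailing_minor r (nilexp (t *: Y)) = 1) ->
  forall U, U \in unitmx -> \tr (D U *m (X *m U - U *m Y)) = 0.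
Proof.
move=> H Xn Yn tX tY.
have tn t : (t *: X) ^+ n = 0 /\ (t *: Y) ^+ n = 0.
  by rewrite !scalemx_exp Xn Yn !scaler0.
have G1 t : group_rel T (cst1 R) (nilexp (t *: X)) (nilexp (t *: Y)).
  by have [? ?] := tn t; apply: group_rel_nilexp => //; exact: lie_relZ.
have z1 (Z : 'M[R[i]]_n) : Z ^+ n = 0 -> nilexp (0 *: Z) = 1%:M.
  move=> _; rewrite scale0r.
  have := nilexp_uniplog (unip_lower1 R n); rewrite uniplog1; exact.
apply: (@invariant_direction R n psi D hD (fun t => nilexp (t%:C *: X)) (fun t => nilexp (t%:C *: Y))).
- exact: z1.
- exact: z1.
- by move=> t; exact: nilexp_unit (tn _).1.
- by move=> t; exact: nilexp_unit (tn _).2.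
- exact: rderiv_nilexp.
- exact: rderiv_nilexp.
move=> t U uU; exact: (ext_unip_invariant (G1 _) (tX _) (tY _) uU).
Qed.

Lemma trailing_minor_unip_upper r (A : 'M[R[i]]_n) : unip_upper A -> trailing_minor r A = 1.
Proof.
move=> [uA dA]; rewrite -trailing_minor_tr; apply: trailing_minor_unip; split.
  by move=> i j ij; rewrite mxE uA.
by move=> i; rewrite mxE dA.
Qed.

Lemma bracket_dir_upper z U : strict_upper z -> U \in unitmx -> bracket_dir z U = 0.
Proof.
move=> uz uU; case: (posnP n) => [n0|n0].
  by rewrite /bracket_dir /mxtrace big1 // => i _; have := ltn_ord i; rewrite {2}n0.
have [X [E1 uX E2]] := Rplus_upper n0 uz.
rewrite /bracket_dir E2 E1.
have uY : strict_upper (gamma_up T X) by move=> i j; exact: gamma_up_strict.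
apply: (strict_direction (lie_rel_gamma_up T uX)) => //.
- exact: strict_upper_nilpotent.
- exact: strict_upper_nilpotent.
- by move=> t r; exact/trailing_minor_unip_upper/nilexp_unip_upper/strict_upperZ.
by move=> t r; exact/trailing_minor_unip_upper/nilexp_unip_upper/strict_upperZ.
Qed.

Lemma bracket_dir_lower z U : strict_lower z -> U \in unitmx -> bracket_dir z U = 0.
Proof.
move=> lz uU; case: (posnP n) => [n0|n0].
  by rewrite /bracket_dir /mxtrace big1 // => i _; have := ltn_ord i; rewrite {2}n0.
have [Y [E1 lY E2]] := Rplus_lower n0 lz.
rewrite /bracket_dir E1 E2.
have lX : strict_lower (gamma_adj T Y) by move=> i j; exact: gamma_adj_strict.
apply: (strict_direction (lie_rel_gamma_adj T lY)) => //.
- exact: strict_lower_nilpotent.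
- exact: strict_lower_nilpotent.
- by move=> t r; exact/trailing_minor_unip/nilexp_unip_lower/strict_lowerZ.
by move=> t r; exact/trailing_minor_unip/nilexp_unip_lower/strict_lowerZ.
Qed.

End Psi.
End Directions.

Section DiagonalDirection.
Variables (R : realType) (n : nat) (G : gtype) (T : BDtriple n).
Variable R0 : {linear 'M[R[i]]_n -> 'M[R[i]]_n}.
Hypothesis hR0 : BD_quadruple G T R0.
Implicit Types (U X Y x y z : 'M[R[i]]_n).

Lemma coroot_delta (i j : 'I_n) : j = i.+1 :> nat ->
  coroot R n i.+1 = delta_mx i i - delta_mx j j.
Proof. by move=> ji; rewrite /coroot -ji !Eij_delta ji Eij_delta. Qed.

Lemma cartan_delta (i j : 'I_n) : cartan G (delta_mx i i - delta_mx j j : 'M[R[i]]_n).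
Proof.
split; last by apply: inLie_mxtrace0; rewrite mxtraceB !mxtrace_delta_diag subrr.
apply/is_diag_mxP => k l /negbTE kl; rewrite !mxE.
have H (p : 'I_n) : (k == p) && (l == p) = false.
  by apply/andP => -[/eqP kp /eqP lp]; move: kl; rewrite kp lp eqxx.
by rewrite !H subrr.
Qed.

Lemma root_ord a : (0 < a < n)%N -> exists i j : 'I_n, a = i.+1 /\ j = i.+1 :> nat.
Proof.
case/andP; case: a => // a _ an.
by exists (Ordinal (ltnW an)), (Ordinal an).
Qed.

Lemma mxtrace_coroot a x : (0 < a < n)%N ->
  \tr (coroot R n a *m x) = diag_entry x a.-1 - diag_entry x a.
Proof.
move=> /root_ord[i [j [-> ji]]]; rewrite (coroot_delta ji) mulmxBl mxtraceB /= -ji.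
by rewrite !diag_entryE !(mxtrace_mulC (delta_mx _ _)) !mxtrace_delta.
Qed.

Lemma cartan_coroot a : (0 < a < n)%N -> cartan G (coroot R n a).
Proof. by move=> /root_ord[i [j [-> ji]]]; rewrite (coroot_delta ji); exact: cartan_delta. Qed.

Lemma cartanB x y : cartan G x -> cartan G y -> cartan G (x - y).
Proof.
move=> [/is_diag_mxP dx Lx] [/is_diag_mxP dy Ly]; split.
  by apply/is_diag_mxP => i j ij; rewrite !mxE dx ?dy // subr0.
by case: G Lx Ly => //=; rewrite /inLie /= mxtraceB => -> ->; rewrite subr0.
Qed.

Lemma root_relation z a : cartan G z -> Gam1 T a ->
  diag_entry (R0 z) a.-1 - diag_entry (R0 z) a =
  diag_entry (R0 z - z) (gam T a).-1 - diag_entry (R0 z - z) (gam T a).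
Proof.
move=> cz Ga; have a1 := Gam1_sub Ga; have a2 := Gam2_sub (gam_in Ga).
have [_ adj /(_ a Ga) Ea] := hR0.
have key (h h' X : 'M[R[i]]_n) : R0 (h - h') = h ->
    \tr (R0 (h - h') *m z) + \tr ((h - h') *m X) = \tr ((h - h') *m z) ->
    \tr (h *m X) = \tr (h' *m (X - z)).
  move=> ->; rewrite !mulmxBl mulmxBr !mxtraceB.
  move: (\tr (h *m z)) (\tr (h *m X)) (\tr (h' *m X)) (\tr (h' *m z)) => p q r s E.
  have -> : q = p + (q - r) - p + r by ring.
  by rewrite E; ring.
rewrite -(mxtrace_coroot _ a1) -(mxtrace_coroot _ a2).
exact: (key _ _ _ Ea (adj _ z (cartanB (cartan_coroot a1) (cartan_coroot a2)) cz)).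
Qed.

Lemma corr_root_const d a a' m X x k : corr T d a a' m ->
  (forall b, Gam1 T b -> diag_entry X b.-1 - diag_entry X b =
     diag_entry x (gam T b).-1 - diag_entry x (gam T b)) -> (k <= m)%N ->
  if d then diag_entry x (a' + (m - k)) + diag_entry X (a + k) = diag_entry x (a' + m) + diag_entry X a
  else diag_entry x (a' + k) - diag_entry X (a + k) = diag_entry x a' - diag_entry X a.
Proof.
move=> r H; elim: k => [|k IH] km; first by rewrite subn0 !addn0; case: d r.
have := H _ (corr_Gam1 r km); rewrite (corr_gam r km) addnS /=.
have := IH (ltnW km); case: d {r IH} => /=.
  have -> : (a' + (m - k)).-1 = (a' + (m - k.+1))%N by lia.
  move: (diag_entry x _) (diag_entry x _) (diag_entry X _) (diag_entry X _) => p q r s.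
  by move=> <- /(canRL (subrK _)) ->; ring.
rewrite addnS.
move: (diag_entry x (a' + k)) (diag_entry x _.+1) (diag_entry X (a + k)) (diag_entry X _.+1) => p q r s.
by move=> <- /(canRL (subrK _)) ->; ring.
Qed.

Definition diag_exp (t : R) X : 'M[R[i]]_n := diag_mx (\row_i cexp (t%:C * X i i)).

Lemma diag_expE t X i j : diag_exp t X i j = cexp (t%:C * X i i) *+ (i == j).
Proof. by rewrite !mxE; case: eqP => // ->. Qed.

Lemma diag_exp0 X : diag_exp 0 X = 1%:M.
Proof. by apply/matrixP => i j; rewrite diag_expE mxE mul0r cexp0. Qed.

Lemma diag_exp_unit t X : diag_exp t X \in unitmx.
Proof.
rewrite unitmxE unitfE det_diag; apply/prodf_neq0 => i _.
by rewrite mxE cexp_neq0.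
Qed.

Lemma diag_exp_diag t X (i j : 'I_n) : i != j -> diag_exp t X i j = 0.
Proof. by rewrite diag_expE => /negbTE ->. Qed.

Lemma rderiv_diag_exp X : is_diag_mx X ->
  forall i j, rderiv (0 : R) (fun t => diag_exp t X i j) (X i j).
Proof.
move=> /is_diag_mxP dX i j; have [<-|ij] := eqVneq i j.
  by apply: rderiv_ext (rderiv_cexp (X i i)) => t; rewrite diag_expE eqxx.
rewrite dX //; apply: rderiv_ext (dr_const (rderiv_rules (0 : R)) 0) => t.
by rewrite diag_exp_diag.
Qed.

Lemma diag_entry_diag_exp t X k : (k < n)%N ->
  diag_entry (diag_exp t X) k = cexp (t%:C * diag_entry X k).
Proof.
move=> kn; rewrite -[k]/(nat_of_ord (Ordinal kn)) !diag_entryE diag_expE eqxx.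
by [].
Qed.

Lemma block_diag_exp m a t X (p q : 'I_m.+1) : (a + m < n)%N ->
  block m.+1 a.+1 (diag_exp t X) p q = cexp (t%:C * diag_entry X (a + p)) *+ (p == q).
Proof.
move=> amn; have [<-|pq] := eqVneq p q.
  by rewrite block_diag // diag_entry_diag_exp //; have := ltn_ord p; lia.
have lp : (a + p < n)%N by have := ltn_ord p; lia.
have lq : (a + q < n)%N by have := ltn_ord q; lia.
rewrite (@blockE _ _ _ _ _ p q (Ordinal lp) (Ordinal lq)) // diag_exp_diag //.
by rewrite -val_eqE /= eqn_add2l.
Qed.

Lemma group_rel_diag_exp t X x :
  (forall b, Gam1 T b -> diag_entry X b.-1 - diag_entry X b =
     diag_entry x (gam T b).-1 - diag_entry x (gam T b)) ->
  exists2 c, nz_scalars c & group_rel T c (diag_exp t X) (diag_exp t x).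
Proof.
move=> H; exists (fun d a a' m => cexp (t%:C *
  (if d then diag_entry x (a' + m) + diag_entry X a else diag_entry x a' - diag_entry X a))).
  by move=> d a a' m; exact: cexp_neq0.
split; [exact: diag_exp_unit|exact: diag_exp_unit| | |].
- by apply: upper_upin => i j ji; apply: diag_exp_diag; rewrite -val_eqE gtn_eqF.
- by apply: lower_loin => i j ji; apply: diag_exp_diag; rewrite -val_eqE ltn_eqF.
move=> d a a' m r; have an := corr_n r; have an' := corr_n' r.
have K k (km : (k <= m)%N) := corr_root_const r H km.
case: d r K => r K; apply/matrixP => p q.
  rewrite -mulmxA mxE (bigD1 p) //= big1 ?addr0; last first.
    by move=> k kp; rewrite block_diag_exp // eq_sym (negbTE kp) mul0r.
  rewrite block_diag_exp // eqxx mxE (bigD1 q) //= big1 ?addr0; last first.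
    by move=> k kp; rewrite [trmx _ _ _]mxE block_diag_exp // eq_sym (negbTE kp) mulr0.
  rewrite [trmx _ _ _]mxE block_diag_exp // eqxx !mulr1n [RHS]mxE w0E.
  have [->|_] := eqVneq p (rev_ord q); last by rewrite !(mulr0, mul0r).
  have qm : (q <= m)%N by have := ltn_ord q.
  by rewrite -(K q qm) mulrDr cexpD /= subSS; ring.
rewrite [RHS]mxE !block_diag_exp //; case: eqP => _; last by rewrite !mulr0n mulr0.
have pm : (p <= m)%N by have := ltn_ord p.
by rewrite !mulr1n -(K p pm) -cexpD -mulrDr subrK.
Qed.

Section Psi.
Variables (psi : 'M[R[i]]_n -> R[i]) (D : 'M[R[i]]_n -> 'M[R[i]]_n).
Hypotheses (hD : has_gradient psi D) (epsi : ext_semi_invariant T psi).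

Lemma bracket_dir_diag z : cartan G z ->
  exists w, forall U, U \in unitmx -> bracket_dir T R0 D z U = w * psi U.
Proof.
move=> cz; have dz : is_diag_mx z by case: cz.
have [RC _ _] := hR0.
have dX : is_diag_mx (R0 z) by have [] := RC _ cz.
have dY : is_diag_mx (R0 z - z) by have [] := cartanB (RC _ cz) cz.
have ud : upper_part z = 0.
  apply/matrixP => i j; rewrite !mxE; case: ltnP => // ij.
  by move/is_diag_mxP: dz => -> //; rewrite -?val_eqE ltn_eqF.
have ld : lower_part z = 0.
  apply/matrixP => i j; rewrite !mxE; case: ltnP => // ij.
  by move/is_diag_mxP: dz => -> //; rewrite -?val_eqE gtn_eqF.
have E : Rplus T R0 z = R0 z.
  rewrite /Rplus ud ld (diag_part_diag dz) big1_seq ?big1_seq ?subrr ?add0r //.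
    by move=> k _; elim: k => //= k ->; exact: gamma_adj0.
  by move=> k _; elim: k => //= k ->; exact: gamma_up0.
have [w H] : exists w, forall U, U \in unitmx ->
    \tr (D U *m (R0 z *m U - U *m (R0 z - z))) = w * psi U.
  apply: (@semi_invariant_direction R n psi D hD (fun t => diag_exp t (R0 z)) (fun t => diag_exp t (R0 z - z))).
  - exact: diag_exp0.
  - exact: diag_exp0.
  - by move=> t; exact: diag_exp_unit.
  - by move=> t; exact: diag_exp_unit.
  - exact: rderiv_diag_exp.
  - exact: rderiv_diag_exp.
  move=> t; have [c c0 r] := group_rel_diag_exp t (fun b => root_relation cz (a := b)).
  exact: (ext_rel_invariant epsi c0 r).
exists w => U uU; rewrite /bracket_dir E; exact: H.
Qed.

Lemma diag_part_comm F U : diag_part (F *m U - U *m F) =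
  \sum_i \sum_j (F j i * U i j) *: (delta_mx j j - delta_mx i i) :> 'M[R[i]]_n.
Proof.
apply/matrixP => k l; rewrite summxE.
under eq_bigr => i _ do rewrite summxE.
rewrite !mxE; have [<-{l}|kl] := eqVneq k l; last first.
  rewrite big1 // => i _; rewrite big1 // => j _; rewrite !mxE.
  have H (p : 'I_n) : (k == p) && (l == p) = false.
    by apply/andP => -[/eqP kp /eqP lp]; move: kl; rewrite kp lp eqxx.
  by rewrite !H subrr mulr0.
have -> : \sum_i \sum_j ((F j i * U i j) *: (delta_mx j j - delta_mx i i)) k k =
   \sum_i \sum_j (F j i * U i j) * (k == j)%:R - \sum_i \sum_j (F j i * U i j) * (k == i)%:R.
  rewrite -sumrB; apply: eq_bigr => i _; rewrite -sumrB; apply: eq_bigr => j _.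
  by rewrite !mxE !andbb mulrBr.
congr (_ - _).
  apply: eq_bigr => i _; rewrite (bigD1 k) //= eqxx mulr1 big1 ?addr0 // => j jk.
  by rewrite eq_sym (negbTE jk) mulr0.
rewrite [RHS](bigD1 k) //= [X in _ = _ + X]big1 ?addr0 => [|i ik].
  by apply: eq_bigr => j _; rewrite eqxx mulr1 mulrC.
by rewrite big1 // => j _; rewrite eq_sym (negbTE ik) mulr0.
Qed.

Lemma pbracket_log : exists w : 'I_n -> 'I_n -> R[i], forall f F U,
  has_gradient f F -> U \in unitmx ->
  pbracket G T R0 psi f U = (\sum_i \sum_j w i j * (F U j i * U i j)) * psi U.
Proof.
have /choice[w0 Hw] : forall p : 'I_n * 'I_n, exists w, forall U, U \in unitmx ->
    bracket_dir T R0 D (delta_mx p.2 p.2 - delta_mx p.1 p.1) U = w * psi U.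
  by move=> p; exact/bracket_dir_diag/cartan_delta.
exists (fun i j => w0 (i, j)) => f F U hF uU.
rewrite (pbracketE hR0 hD hF uU) -/(bracket_dir T R0 D _ U).
set z := F U *m U - U *m F U.
rewrite (triangular_decomp z) !bracket_dirD.
rewrite (bracket_dir_upper R0 hD epsi (@upper_part_strict _ _ z) uU).
rewrite (bracket_dir_lower R0 hD epsi (@lower_part_strict _ _ z) uU) !add0r.
rewrite diag_part_comm.
have S (I : Type) (r : seq I) (H : I -> 'M[R[i]]_n) :
    bracket_dir T R0 D (\sum_(k <- r) H k) U = \sum_(k <- r) bracket_dir T R0 D (H k) U.
  elim: r => [|k r IH]; last by rewrite !big_cons bracket_dirD IH.
  by rewrite !big_nil -(scale0r (0 : 'M[R[i]]_n)) bracket_dirZ mul0r.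
rewrite S mulr_suml; apply: eq_bigr => i _; rewrite S mulr_suml; apply: eq_bigr => j _.
rewrite bracket_dirZ (Hw (i, j) U uU) mulrA; congr (_ * _).
exact: mulrC.
Qed.

End Psi.
End DiagonalDirection.

(** * The coefficients of the characteristic polynomial *)

Section Casimirs.
Variables (R : realType) (n : nat).
Implicit Types (A B : 'M[R[i]]_n).

Definition generated_coefs (X : Type) (gens : set (X -> R[i])) (p : X -> {poly R[i]}) :=
  forall k, generated gens (fun U => (p U)`_k).

Lemma generated_coefs_const (X : Type) (gens : set (X -> R[i])) q : generated_coefs gens (fun=> q).
Proof. by move=> k; exact: generated_const. Qed.

Lemma generated_coefs_add (X : Type) (gens : set (X -> R[i])) p q :
  generated_coefs gens p -> generated_coefs gens q -> generated_coefs gens (fun U => p U + q U).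
Proof.
move=> gp gq k; apply: falg_ext (generated_add (gp k) (gq k)) => U.
by rewrite coefD.
Qed.

Lemma generated_coefs_mul (X : Type) (gens : set (X -> R[i])) p q :
  generated_coefs gens p -> generated_coefs gens q -> generated_coefs gens (fun U => p U * q U).
Proof.
move=> gp gq k.
apply: (@falg_ext _ _ _ (fun U => \sum_(j < k.+1) (p U)`_j * (q U)`_(k - j))).
  by move=> U; rewrite coefM.
by apply: (falg_sum (@generated_alg _ _ _)) => j _; exact: generated_mul.
Qed.

Lemma generated_coefs_alg (X : Type) (gens : set (X -> R[i])) :
  function_algebra (generated_coefs gens).
Proof.
by split; [exact: generated_coefs_const|exact: generated_coefs_add|exact: generated_coefs_mul].
Qed.

Lemma regular_charcoef i : regular (@charcoef R n i).
Proof.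
exists (@charcoef R n i) => //.
apply: generated_mul; first exact: generated_const.
apply: (falg_det (@generated_coefs_alg _ _)) => k l.
move=> m; apply: (@falg_ext _ _ _
    (fun U : 'M[R[i]]_n => ((1%:M : 'M[{poly R[i]}]_n) k l)`_m + (m == 1)%N%:R * U k l)).
  by move=> U; rewrite !mxE coefD coefXM coefC; case: m => [|[|m]] //=; rewrite ?mul0r ?mul1r.
apply: generated_add; first exact: generated_const.
apply: generated_mul; first exact: generated_const.
by apply: generated_gen; left; exists k, l.
Qed.

Lemma charcoef_mulC i A B : B \in unitmx -> charcoef i (A *m B) = charcoef i (B *m A).
Proof.
move=> uB; rewrite /charcoef !map_mxM.
set a := map_mx _ A; set b := map_mx _ B.
have b0 : \det b != 0.
  by rewrite /b det_map_mx polyC_eq0; move: uB; rewrite unitmxE unitfE.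
suff -> : \det (1%:M + 'X *: (a *m b)) = \det (1%:M + 'X *: (b *m a)) by [].
apply: (mulfI b0); rewrite [RHS]mulrC -!det_mulmx mulmxDl mulmxDr mulmx1 mul1mx.
by rewrite -scalemxAr -scalemxAl !mulmxA.
Qed.

Lemma cderiv_unique (t0 : R[i]^o) (f : R[i] -> R[i]) v v' :
  cderiv t0 f v -> cderiv t0 f v' -> v = v'.
Proof. by move=> [_ <-] [_ <-]. Qed.

Lemma charcoef_gradient_comm i D U : has_gradient (@charcoef R n i) D -> U \in unitmx ->
  D U *m U = U *m D U.
Proof.
move=> hD uU.
have lin a b : cderiv (0 : R[i]^o) (fun t => a + t * b) b.
  have r := cderiv_rules (0 : R[i]^o).
  have id1 : cderiv (0 : R[i]^o) (fun t => t) 1 by exact: is_derive_id.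
  have := dr_add r (dr_const r a) (dr_mul r id1 (dr_const r b)).
  by rewrite mul0r !add0r mulr1.
have H x : \tr (D U *m (x *m U)) = \tr (D U *m (U *m x)).
  have d1 := @cderiv_curve_at R n _ _ (fun t => U + t *: (x *m U)) U (x *m U) hD.
  have d2 := @cderiv_curve_at R n _ _ (fun t => U + t *: (U *m x)) U (U *m x) hD.
  rewrite !scale0r !addr0 in d1 d2.
  have {}d1 := d1 erefl uU (fun i j => _).
  have {}d2 := d2 erefl uU (fun i j => _).
  have E : (fun t => charcoef i (U + t *: (U *m x))) = (fun t => charcoef i (U + t *: (x *m U))).
    apply/funext => t.
    have -> : U + t *: (x *m U) = (1%:M + t *: x) *m U by rewrite mulmxDl mul1mx scalemxAl.
    have -> : U + t *: (U *m x) = U *m (1%:M + t *: x) by rewrite mulmxDr mulmx1 scalemxAr.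
    exact/esym/charcoef_mulC.
  rewrite E in d2; apply: (cderiv_unique (d1 _) (d2 _)).
    by move=> k l; under eq_fun do rewrite !mxE; rewrite mxE; exact: lin.
  by move=> k l; under eq_fun do rewrite !mxE; rewrite mxE; exact: lin.
apply/matrixP => k l; rewrite -!mxtrace_delta.
by rewrite -mulmxA -H mulmxA mxtrace_mulC mulmxA.
Qed.

End Casimirs.

(** * Leaves in the zero locus *)

Section LinearODE.
Variables (R : realType) (a b : R) (N k : R -> R).
Hypothesis dN : forall x, a < x < b -> is_derive x 1 N (k x * N x).
Hypothesis dk : forall x, a < x < b -> derivable k x 1.

Lemma exp_weight_increment m x y : a < x -> x < y -> y < b -> exists2 z, x <= z <= y &
  N y * expR (m * y) - N x * expR (m * x) = (k z + m) * N z * expR (m * z) * (y - x).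
Proof.
move=> ax xy yb.
have ab z : x <= z <= y -> a < z < b.
  by case/andP=> xz zy; rewrite (lt_le_trans ax xz) (le_lt_trans zy yb).
have dM z : x <= z <= y -> is_derive z 1 (fun z => N z * expR (m * z)) ((k z + m) * N z * expR (m * z)).
  move=> /ab zab.
  have lin : is_derive z 1 (fun z => m * z) m.
    have := is_deriveM (is_derive_cst m z 1) (is_derive_id z 1).
    by move=> h; apply: is_derive_eq h _; rewrite /GRing.scale /=; ring.
  have de := @is_derive1_comp _ expR _ _ _ _ (is_derive_expR _) lin.
  have := is_deriveM (dN zab) de.
  by move=> h; apply: is_derive_eq h _; rewrite /GRing.scale /=; ring.
have [||z zxy E] := @MVT R (fun z => N z * expR (m * z)) (fun z => (k z + m) * N z * expR (m * z)) x y xy.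
- by move=> z; rewrite in_itv /= => /andP[xz zy]; apply: dM; rewrite !ltW.
- by apply: derivable_within_continuous => z; rewrite in_itv /= => /dM[].
by exists z => //; move: zxy; rewrite in_itv /= => /andP[xz zy]; rewrite !ltW.
Qed.

Lemma linear_ode_zero : (forall x, 0 <= N x) -> forall s t, a < s < b -> a < t < b ->
  N s = 0 -> N t = 0.
Proof.
move=> N0 s t /andP[as' sb] /andP[at' tb] Ns.
have kc x y : a < x -> y < b -> {within `[x, y], continuous k}.
  move=> ax yb; apply: derivable_within_continuous => z; rewrite in_itv /= => /andP[xz zy].
  by apply: dk; rewrite (lt_le_trans ax xz) (le_lt_trans zy yb).
apply/eqP; rewrite eq_le N0 andbT.
have [st|ts|<-] := ltgtP s t; last by rewrite Ns.
  have [c _ kM] := EVT_max (ltW st) (kc _ _ as' tb).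
  have [z zst] := exp_weight_increment (- k c) as' st tb; rewrite Ns mul0r subr0 => E.
  rewrite -(pmulr_lle0 _ (expR_gt0 (- k c * t))) E.
  have kz : k z - k c <= 0 by rewrite subr_le0 kM // in_itv.
  rewrite pmulr_lle0 ?subr_gt0 // pmulr_lle0 ?expR_gt0 //.
  by rewrite mulr_le0_ge0.
have [c _ km] := EVT_min (ltW ts) (kc _ _ at' sb).
have [z zts] := exp_weight_increment (- k c) at' ts sb; rewrite Ns mul0r sub0r => E.
rewrite -(pmulr_lle0 _ (expR_gt0 (- k c * t))) -oppr_ge0 E.
have kz : 0 <= k z - k c by rewrite subr_ge0 km // in_itv.
by rewrite !mulr_ge0 ?expR_ge0 // subr_ge0 ltW.
Qed.

End LinearODE.

Section ComplexLinearODE.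
Variables (R : realType) (a b : R) (f k : R -> R[i]).

Lemma complex_linear_ode_zero :
  (forall x, a < x < b -> rderiv x f (k x * f x)) ->
  (forall x, a < x < b -> exists v, rderiv x k v) ->
  forall s t, a < s < b -> a < t < b -> f s = 0 -> f t = 0.
Proof.
move=> df dk s t hs ht fs.
pose N x := complex.Re (f x) ^+ 2 + complex.Im (f x) ^+ 2.
have dN x : a < x < b -> is_derive x 1 N (2 * complex.Re (k x) * N x).
  move=> /df[f1 f2]; have := is_deriveD (is_deriveM f1 f1) (is_deriveM f2 f2).
  rewrite (_ : _ + _ = N); last by apply/funext => z; rewrite /N !expr2.
  by move=> h; apply: is_derive_eq h _; rewrite ReM ImM /N /GRing.scale /=; ring.
have dK x : a < x < b -> derivable (fun x => 2 * complex.Re (k x)) x 1.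
  by move=> /dk[v [d _]]; have [] := is_deriveM (is_derive_cst (2 : R) x 1) d.
have N0 x : 0 <= N x by rewrite addr_ge0 ?sqr_ge0.
have Ns : N s = 0 by rewrite /N fs /= !expr0n /= addr0.
have := linear_ode_zero dN dK N0 hs ht Ns.
move/eqP; apply: contraTeq => ft.
by have := sqnorm_neq0 ft.
Qed.

End ComplexLinearODE.

Section Frozen.
Variables (R : realType) (n : nat) (G : gtype) (T : BDtriple n).
Variable R0 : {linear 'M[R[i]]_n -> 'M[R[i]]_n}.
Hypothesis hR0 : BD_quadruple G T R0.

Lemma inG_unit (U : 'M[R[i]]_n) : inG G U -> U \in unitmx.
Proof. by case: G; rewrite /inG //= unitmxE => ->; exact: unitr1. Qed.

Lemma has_gradient_coord (i j : 'I_n) :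
  has_gradient (fun U : 'M[R[i]]_n => U i j) (fun=> delta_mx j i).
Proof.
split; first by move=> k l; exact: generated_const.
exists (fun U => U i j); split=> //; first by apply: generated_gen; left; exists i, j.
by move=> D t0 Dv H c V _ /(_ i j); rewrite mxtrace_mulC mxtrace_delta.
Qed.

Lemma frozen_regular cv (psi : 'M[R[i]]_n -> R[i]) : frozen cv G T psi -> regular psi.
Proof.
case=> [[i _ ->]|[]]; first exact: regular_charcoef.
- by [].
- by [].
by move=> _; exists (fun U => \det U) => //; have [] := smooth_det R n.
Qed.

Definition log_bracket (psi : 'M[R[i]]_n -> R[i]) := exists w : 'I_n -> 'I_n -> R[i],
  forall f F U, has_gradient f F -> U \in unitmx ->
  pbracket G T R0 psi f U = (\sum_i \sum_j w i j * (F U j i * U i j)) * psi U.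

Lemma casimir_log_bracket psi : casimir_frozen psi -> log_bracket psi.
Proof.
move=> [i _ ->]; exists (fun _ _ => 0) => f F U hF uU.
rewrite big1 ?mul0r; last by move=> k _; rewrite big1 // => l _; rewrite mul0r.
have [D hD] := regular_gradient (regular_charcoef R n i).
rewrite (pbracketE hR0 hD hF uU).
have E := charcoef_gradient_comm hD uU.
set r := Rplus T R0 _; move: r => r; move: (D U) (F U) E => d g E.
have -> : d *m (r *m U - U *m (r - (g *m U - U *m g))) =
    (d *m r *m U - U *m (d *m r)) + (d *m U *m g *m U - U *m (d *m U *m g)).
  rewrite !mulmxBr !mulmxA -E.
  by apply/matrixP => k l; move: (d *m r *m U) (d *m U *m r) (d *m U *m g *m U) (d *m U *m U *m g) => p q p' q';
    rewrite !mxE; ring.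
have c0 (A : 'M[R[i]]_n) : \tr (A *m U - U *m A) = 0.
  by rewrite mxtraceB [\tr (U *m A)]mxtrace_mulC; exact: subrr.
have := c0 (d *m r); have := c0 (d *m U *m g).
move: (d *m r *m U - _) (d *m U *m g *m U - _) => p q hq hp.
by rewrite mxtraceD hp hq addr0.
Qed.

Lemma frozen_log_bracket cv psi : frozen cv G T psi -> log_bracket psi.
Proof.
move=> H; have rpsi := frozen_regular H; case: H => [/casimir_log_bracket //|m].
have [D hD] := regular_gradient rpsi.
exact: (pbracket_log hR0 hD (minor_frozen_ext m)).
Qed.

Lemma log_bracket_log_canonical psi i j : log_bracket psi ->
  log_canonical G T R0 psi (fun U => U i j).
Proof.
move=> [w H]; exists (w i j) => U /inG_unit uU.
rewrite (H _ _ _ (has_gradient_coord i j) uU) (bigD1 i) //= (bigD1 j) //= !big1 ?addr0.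
- by rewrite mxE !eqxx mul1r mulrAC.
- by move=> k ki; rewrite big1 // => l _; rewrite mxE (negbTE ki) andbF mul0r mulr0.
by move=> l lj; rewrite mxE (negbTE lj) mul0r mulr0.
Qed.

Lemma hamiltonian_step_zero psi (U V : 'M[R[i]]_n) : regular psi -> log_bracket psi ->
  hamiltonian_step G T R0 U V -> zero_locus G psi U -> zero_locus G psi V.
Proof.
move=> rpsi [w Hw] [f [a [b [s [t [c [rf Hc hs ht [<- <-]]]]]]]] [_ psi0].
have [iGt _] := Hc t ht; split=> //.
have [D hD] := regular_gradient rpsi; have [F hF] := regular_gradient rf.
have [_ [g [gg Hg psig]]] := hD.
have uc x : a < x < b -> c x \in unitmx by move=> /Hc[/inG_unit].
rewrite psig; last exact: uc.
have gs : g (c s) = 0 by rewrite -psig //; exact: uc.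
pose K U := \sum_i \sum_j w i j * (F U j i * U i j).
have [_ [GK _ HK]] : smooth K.
  apply: generated_smooth; apply: (falg_sum (@generated_alg _ _ _)) => i _; apply: (falg_sum (@generated_alg _ _ _)) => j _.
  apply: generated_mul; first exact: generated_const.
  by apply: generated_mul; [exact: (hF.1 j i)|apply: generated_gen; left; exists i, j].
pose W x : 'M[R[i]]_n := let z := F (c x) *m c x - c x *m F (c x) in
   Rplus T R0 z *m c x - c x *m (Rplus T R0 z - z).
have dc x : a < x < b -> forall i j, rderiv x (fun r => c r i j) (W x i j).
  move=> hx i j; have [_ /(_ i j)] := Hc x hx.
  rewrite (pbracketE hR0 (has_gradient_coord i j) hF (uc x hx)) /=.
  by rewrite mxtrace_mulC mxtrace_delta.
apply: (@complex_linear_ode_zero R a b (fun x => g (c x)) (fun x => K (c x)) _ _ s t hs ht gs).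
  move=> x hx; have := Hg _ _ _ (rderiv_rules x) c (W x) (uc x hx) (dc x hx).
  have := Hw f F (c x) hF (uc x hx); rewrite (pbracketE hR0 hD hF (uc x hx)).
  rewrite -/(W x) -/(K (c x)) (psig _ (uc x hx)) => ->.
  exact.
move=> x hx; exists (\tr (GK (c x) *m W x)).
exact: HK (rderiv_rules x) c (W x) (uc x hx) (dc x hx).
Qed.

Lemma union_of_leaves_zero_locus psi : regular psi -> log_bracket psi ->
  union_of_leaves G T R0 (zero_locus G psi).
Proof.
move=> rpsi lpsi; exists [set L | exists2 U, zero_locus G psi U & L = leaf G T R0 U].
  by move=> L [U [iU _] ->]; exists U.
apply/seteqP; split=> U.
  by move=> ZU; exists (leaf G T R0 U); [exists U|exact: rt_refl].
move=> [L [V ZV ->]]; rewrite /leaf /= => VU.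
elim: VU ZV => // [A B|A B C _ IH1 _ IH2 /IH1/IH2 //].
exact: hamiltonian_step_zero.
Qed.

End Frozen.

Theorem proposition1p8 (R : realType) (n : nat) (G : gtype) (T : BDtriple n)
    (R0 : {linear 'M[R[i]]_n -> 'M[R[i]]_n})
    (hR0 : BD_quadruple G T R0)
    (cv : convention) (psi : 'M[R[i]]_n -> R[i])
    (hpsi : frozen cv G T psi) :
  [/\ minor_frozen cv G T psi -> semi_invariant T psi,
      forall i j : 'I_n, log_canonical G T R0 psi (fun U => U i j) &
      union_of_leaves G T R0 (zero_locus G psi)].
Proof.
have lpsi := frozen_log_bracket hR0 hpsi; split.
- by move/minor_frozen_ext/ext_semi_invariantW.
- by move=> i j; exact: log_bracket_log_canonical.
exact: (union_of_leaves_zero_locus hR0 (frozen_regular hpsi) lpsi).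
Qed.
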